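(* Let $k\ge 2$ be an integer and let $H=(V,E,\Gamma)$ be a $k$-uniform homogeneous hypergraph, where $\Gamma$ is a compact group that is metrizable by a right-invariant density metric. If $\alpha(H)>0$, then $$\alpha(H)^{k-1}=\vartheta_{\mathrm{small}}(H,\mathrm{CP}(V,k)_{\mathrm c}).$$
   Context: All functions and measures are real valued; groups and spaces are Hausdorff. A $k$-uniform homogeneous hypergraph under a compact group $\Gamma$, $H=(V,E,\Gamma)$, is a $k$-uniform hypergraph $(V,E)$ (edges are $k$-element subsets of $V$, $E$ identified with the symmetric set of tuples $(v_1,\dots,v_k)\in V^k$ with $\{v_1,\dots,v_k\}$ an edge) such that $\Gamma$ acts on $V$ by automorphisms of the hypergraph, $V$ is a homogeneous $\Gamma$-space (continuous transitive action, so $V\cong\Gamma/\mathrm{Stab}(v_0)$ with the quotient topology), and $E\subseteq V^k$ is Borel. $V$ is equipped with the quotient measure $\mu$: the pushforward of the Haar measure $\nu$ of $\Gamma$, normalized by $\nu(\Gamma)=1$, under the quotient map $\Gamma\to V$. A set $I\subseteq V$ is independent if $I^k\cap E=\emptyset$, and $\alpha(H)=\sup\{\mu(I): I\subseteq V\text{ measurable and independent}\}$. Density metric: let $V'$ be a metric space with a Borel measure $\rho$ with full support and let $\mathcal B^+$ be the Borel sets of nonzero measure. A family $\mathcal D\subseteq\mathcal B^+$ such that for each $v$ the members containing $v$ are directed by reverse inclusion is a density system if $\rho(A\,\triangle\, D(A))=0$ for all $A\in\mathcal B^+$, where $D(A)$ is the set of points $v$ with $\lim_{v\in D\in\mathcal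 D}\rho(D\cap A)/\rho(D)=1$. The metric is a density metric if the set of open balls forms a density system; in particular $\lim_{\delta\to0}\rho(A\cap B_\delta(v))/\rho(B_\delta(v))=1$ for all $A\in\mathcal B^+$ and almost all $v\in A$. Here this is applied to $\Gamma$ with its Haar measure. A metric $d$ on $\Gamma$ is right-invariant if $d(xg,yg)=d(x,y)$ for all $x,y,g\in\Gamma$. $L^2_{\mathrm{sym}}(V,k)$ is the space of square-integrable functions on $V^k$ invariant under permutation of coordinates, with $\langle F,G\rangle=\int FG\,d\mu^k$; $f^{\otimes k}(v_1,\dots,v_k)=f(v_1)\cdots f(v_k)$; $\mathbf 1$ is the constant function $1$. $\mathrm{CP}(V,k)$ is the closed convex cone in $L^2_{\mathrm{sym}}(V,k)$ generated by all $f^{\otimes k}$ with $0\le f\in L^2(V)$, and $\mathrm{CP}(V,k)_{\mathrm c}=\mathrm{CP}(V,k)\cap C(V^k)$. $A$ is slice positive if $\int_{V^{k-2}}\int_V\int_V A(x,y,v)G(v)f(x)f(y)\ge0$ for all $0\le G\in L^2(V^{k-2})$, $f\in L^2(V)$. For a convex cone $\mathcal C$ of continuous symmetric functions on $V^k$, $\vartheta_{\mathrm{small}}(H,\mathcal C)$ is the supremum of $\langle A,\mathbf 1^{\otimes k}\rangle$ over all slice-positive $A\in\mathcal C$ with $\int_V A(v,\dots,v)\,d\mu(v)=1$ and $A(v_1,\dots,v_k)=0$ for all $v_1\cdots v_k\in E$. *)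

(* Defs.v *)
From HB Require Import structures.
From mathcomp Require Import all_boot all_order all_algebra perm.
From mathcomp Require Import all_classical all_reals all_analysis.

Set Implicit Arguments.
Unset Strict Implicit.
Unset Printing Implicit Defensive.
Import Order.TTheory GRing.Theory Num.Theory.
Import numFieldNormedType.Exports.

Local Open Scope classical_set_scope.
Local Open Scope ring_scope.

(* A topological space whose measurable sets are exactly the Borel sets. *)
HB.mixin Record isBorel (d : measure_display) T
    of Topological T & Measurable d T := {
  measurable_borel : (@measurable d T) = <<s @open T >>
}.

#[short(type="borelType")]
HB.structure Definition Borel d :=
  {T of Topological T & Measurable d T & isBorel d T}.

(* The library only has additive (commutative) topological groups. *)
HB.mixin Record isTopologicalGroup G of Group G & Topological G := {
  mulg_continuous : continuous (fun p : G * G => (p.1 * p.2)%g);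
  invg_continuous : continuous (fun x : G => (x^-1)%g)
}.

#[short(type="borelGroupType")]
HB.structure Definition BorelGroup d :=
  {G of Group G & Borel d G & isTopologicalGroup G}.

Section tuple_topology.
Context (k : nat) (T : topologicalType).

Definition tuple_coords (t : k.-tuple T) : {ptws 'I_k -> T} := tnth t.

(* The product topology on T^k. *)
HB.instance Definition _ :=
  Topological.copy (k.-tuple T) (initial_topology tuple_coords).

End tuple_topology.

Lemma continuous_borel_measurable d1 d2 (T1 : borelType d1) (T2 : borelType d2)
  (f : T1 -> T2) : continuous f -> measurable_fun [set: T1] f.
Proof.
move=> /continuousP cf; apply: (measurability _ (measurable_borel (s := T2))).
move=> _ [A oA <-]; rewrite setTI measurable_borel.
by apply: sub_sigma_algebra; exact: cf.
Qed.

Definition perm_tuple (T : Type) (k : nat) (s : 'S_k) (t : k.-tuple T) :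
  k.-tuple T := [tuple tnth t (s i) | i < k].

Section haar.
Context (R : realType) (d : measure_display) (G : borelGroupType d).

(* On a compact metrizable group every finite Borel measure is regular, so
   regularity need not be required. *)
Definition haar_probability (nu : probability G R) : Prop :=
  forall (g : G) (A : set G), measurable A ->
    nu [set (g * x)%g | x in A] = nu A.

End haar.

Section density_metric.
Context (R : realType).

Definition is_metric (T : Type) (dist : T -> T -> R) : Prop :=
  [/\ forall x y, 0 <= dist x y,
      forall x y, dist x y = 0 <-> x = y,
      forall x y, dist x y = dist y x
    & forall x y z, dist x z <= dist x y + dist y z].

Definition metric_ball (T : Type) (dist : T -> T -> R) (x : T) (r : R) : set T :=
  [set y | dist x y < r].

Definition metrizes (T : topologicalType) (dist : T -> T -> R) : Prop :=
  is_metric dist /\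
  forall x : T, nbhs x = filter_from [set r : R | 0 < r] (metric_ball dist x).

Definition right_invariant (G : groupType) (dist : G -> G -> R) : Prop :=
  forall x y g : G, dist (x * g)%g (y * g)%g = dist x y.

Context (d : measure_display) (T : measurableType d).

(* The members of DD containing v, directed by reverse inclusion. *)
Definition shrinking_to (DD : set (set T)) (v : T) : set_system (set T) :=
  filter_from [set D | DD D /\ D v]
    (fun D => [set D' | [/\ DD D', D' v & D' `<=` D]]).

Definition directed_at (DD : set (set T)) (v : T) : Prop :=
  (exists D, DD D /\ D v) /\
  forall D1 D2, DD D1 -> D1 v -> DD D2 -> D2 v ->
    exists D3, [/\ DD D3, D3 v & D3 `<=` D1 `&` D2].

Definition density_points (rho : {finite_measure set T -> \bar R})
    (DD : set (set T)) (A : set T) : set T :=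
  [set v | (fun D => fine (rho (D `&` A)) / fine (rho D))
             @ shrinking_to DD v --> (1 : R)].

Definition density_system (rho : {finite_measure set T -> \bar R})
    (DD : set (set T)) : Prop :=
  [/\ forall D, DD D -> measurable D /\ (0 < rho D)%E,
      forall v, directed_at DD v
    & forall A, measurable A -> (0 < rho A)%E ->
        rho.-negligible (A `+` density_points rho DD A)].

(* rho has full support as soon as the balls form a density system, since its
   members have positive measure. *)
Definition density_metric (rho : {finite_measure set T -> \bar R})
    (dist : T -> T -> R) : Prop :=
  density_system rho
    [set B | exists x r, 0 < r /\ B = metric_ball dist x r].

End density_metric.

(* Continuity and transitivity of the action of a compact group on a Hausdorff
   space make the orbit maps G -> V quotient maps. *)
Record homogeneous_hypergraph (k : nat) (dG dV : measure_display)
    (G : borelGroupType dG) (V : borelType dV) := HomogeneousHypergraph {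
  act : G -> V -> V;
  act_one : forall v, act 1%g v = v;
  act_mul : forall g h v, act (g * h)%g v = act g (act h v);
  act_continuous : continuous (fun p : G * V => act p.1 p.2);
  act_transitive : forall v w, exists g, act g v = w;
  edge : set (k.-tuple V);
  edge_uniq : forall t, edge t -> uniq t;
  edge_sym : forall t (s : 'S_k), edge t -> edge (perm_tuple s t);
  edge_act : forall g t, edge t -> edge (map_tuple (act g) t);
  edge_borel : <<s @open (k.-tuple V) >> edge
}.

Section quotient_measure.
Context (R : realType) (k : nat) (dG dV : measure_display).
Context (G : borelGroupType dG) (V : borelType dV).
Variables (H : homogeneous_hypergraph k G V) (v0 : V).

Definition orbit_map (g : G) : V := act H g v0.

Lemma orbit_map_measurable : measurable_fun [set: G] orbit_map.
Proof.
apply: continuous_borel_measurable => g.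
have ct : (fun h : G => (h, v0)) @ g --> nbhs (g, v0).
  by apply: cvg_pair; [exact: cvg_id|exact: cvg_cst].
exact: (cvg_comp _ _ ct (@act_continuous _ _ _ _ _ H (g, v0))).
Qed.

HB.instance Definition _ :=
  isMeasurableFun.Build _ _ _ _ orbit_map orbit_map_measurable.

Definition quotient_measure (nu : probability G R) : probability V R :=
  distribution nu orbit_map.

End quotient_measure.

Section power_measure.
Context (R : realType) (d : measure_display) (V : measurableType d).

Definition tuple_cons (n : nat) (p : V * n.-tuple V) : n.+1.-tuple V :=
  [tuple of p.1 :: p.2].

Lemma tuple_cons_measurable n : measurable_fun [set: V * n.-tuple V] (@tuple_cons n).
Proof. exact: measurable_cons. Qed.

HB.instance Definition _ n :=
  isMeasurableFun.Build _ _ _ _ (@tuple_cons n) (@tuple_cons_measurable n).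

(* The k-fold product measure mu^k. *)
Fixpoint power_measure (mu : probability V R) (k : nat) :
    probability (k.-tuple V) R :=
  match k with
  | 0%N => \d_ [tuple]
  | n.+1 => distribution (mu \x power_measure mu n)%E (@tuple_cons n)
  end.

End power_measure.

Section independence.
Context (R : realType) (k : nat) (dG dV : measure_display).
Context (G : borelGroupType dG) (V : borelType dV).
Variables (H : homogeneous_hypergraph k G V) (mu : probability V R).

Definition independent (I : set V) : Prop :=
  [set t : k.-tuple V | forall i, I (tnth t i)] `&` edge H = set0.

Definition alpha : \bar R :=
  ereal_sup [set mu I | I in [set I | measurable I /\ independent I]].

End independence.

Section cones.
Context (R : realType) (d : measure_display) (V : borelType d).
Variables (mu : probability V R) (k : nat).

Definition tensor (f : V -> R) (t : k.-tuple V) : R :=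
  \prod_(i < k) f (tnth t i).

(* Elements of L^2 are represented by functions, hence "almost everywhere". *)
Definition L2sym : set (k.-tuple V -> R) :=
  [set F | F \in Lfun (power_measure mu k) 2%:E /\
     forall s : 'S_k, {ae power_measure mu k, forall t, F (perm_tuple s t) = F t}].

Definition inner (F F' : k.-tuple V -> R) : \bar R :=
  (\int[power_measure mu k]_t (F t * F' t)%:E)%E.

Definition L2_closed (C : set (k.-tuple V -> R)) : Prop :=
  forall F, L2sym F ->
    (forall e : R, 0 < e -> exists2 F', C F' &
       ('N[power_measure mu k]_(2%:E)[EFin \o (F \- F')%R] < e%:E)%E) ->
    C F.

Definition closed_convex_cone (C : set (k.-tuple V -> R)) : Prop :=
  [/\ C `<=` L2sym,
      forall F F', C F -> C F' -> C (F \+ F'),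
      forall (c : R) F, 0 <= c -> C F -> C (fun t => c * F t)
    & L2_closed C].

Definition CP : set (k.-tuple V -> R) :=
  smallest closed_convex_cone
    [set tensor f | f in [set f | f \in Lfun mu 2%:E /\
                                  {ae mu, forall v, 0 <= f v}]].

Definition CPc : set (k.-tuple V -> R) := CP `&` [set A | continuous A].

End cones.
Arguments L2sym {R d V} mu k _.
Arguments CP {R d V} mu k _.
Arguments CPc {R d V} mu k _.

(* Only meaningful for k >= 2. *)
Definition slice_positive (R : realType) (d : measure_display) (V : borelType d)
    (mu : probability V R) (k : nat) : (k.-tuple V -> R) -> Prop :=
  match k with
  | n.+2 => fun A =>
      forall (g : n.-tuple V -> R) (f : V -> R),
        g \in Lfun (power_measure mu n) 2%:E ->
        {ae power_measure mu n, forall v, 0 <= g v} ->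
        f \in Lfun mu 2%:E ->
        0 <= \int[power_measure mu n]_v \int[mu]_y \int[mu]_x
               (A [tuple of x :: y :: v] * g v * f x * f y)
  | _ => fun _ => True
  end.

Definition theta_small (R : realType) (k : nat) (dG dV : measure_display)
    (G : borelGroupType dG) (V : borelType dV)
    (H : homogeneous_hypergraph k G V) (mu : probability V R)
    (C : set (k.-tuple V -> R)) : \bar R :=
  ereal_sup [set inner mu A (tensor (cst 1)) | A in
    [set A | [/\ C A, slice_positive mu A,
       (\int[mu]_v (A [tuple v | _ < k])%:E = 1)%E
     & forall t, edge H t -> A t = 0]]].

(* Main.v *)
(* Lower bound: for an independent set I of positive measure, average the tensor
   powers of the indicators of the translates of I over the group and divide by
   the measure of I.  This kernel is feasible (continuous because translations
   are continuous in measure, completely positive as an L^2 limit of Riemann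
   sums) and has integral mu(I)^(k-1).

   Upper bound: let A be feasible and 0 < th < <A, 1>.  Membership of A in CP is
   tested against functionals of the form "integral against a signed measure on
   V^k": if such a functional is positive on A, it is positive on the tensor
   power of some step function f >= 0.  Suitable functionals provide densities
   f_n with integral 1 and with the integral of f_n^k at most 1/th, whose
   oscillation on finer and finer partitions is controlled uniformly (this uses
   the continuity of A at the diagonal), and for which the average over the
   group of f_n(g v_1) ... f_n(g v_k) tends to 0 on a countable dense set of
   edges.  The f_n are therefore precompact in L^1, and the support S of a limit
   satisfies mu(S)^(k-1) >= th (Hoelder), while the measure of the set of g
   moving an edge into S vanishes on a dense set of edges, hence, by continuity,
   on all edges.  Finally the density points of S form an independent set: near
   an edge consisting of density points this measure would be positive. *)
Require Import Defs.
From mathcomp Require Import all_boot all_order all_algebra perm.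
From mathcomp Require Import all_classical all_reals all_analysis.
From mathcomp Require Import measurable_realfun ring lra.
Import Order.TTheory GRing.Theory Num.Theory.
Import numFieldNormedType.Exports.

Set Implicit Arguments.
Unset Strict Implicit.
Unset Printing Implicit Defensive.

Local Open Scope classical_set_scope.
Local Open Scope ring_scope.

(** * Integration of bounded measurable functions *)

(** The edges may form a null set of V^k, and so may the diagonal, so the L^2 closure defining [CP]
    says nothing about either by itself: the measures to test with are singular with respect to
    mu^k. What ties them to L^2 is that their k marginals are absolutely continuous. Replacing the
    continuous A by its means over products of cells of V changes it uniformly little outside tuples
    with a coordinate in a null cell, and such means are L^1-continuous and factor on tensors.
    Positivity on A thus passes to a tensor without writing A as a limit or an integral of tensors.
    All requirements on a density must be packed into one linear functional of its tensor power. A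
    bound on the integral of f^k gives only weak compactness, under which products of k values of f
    do not pass to the limit. Strong compactness comes from the integral of f^k minus that of
    f^(k-1) times the cell average of f, which is linear in the tensor power, nonnegative on tensors
    and small on A. Right invariance of the metric makes the ball about g a right translate of the
    ball about 1, so that the density ratio at g depends only on the point g v0 of V. *)

Section bounded_measurable.
Context {R : realType} {d : measure_display} {T : measurableType d}.
Implicit Types f g : T -> R.

(** This class is closed under algebra, composition with measurable maps and partial integration, so
    integrability comes for free. The bound holds everywhere, not almost everywhere, because the
    same function on V^k is integrated against mutually singular measures. *)
Definition bounded_measurable f :=
  measurable_fun setT f /\ exists M, forall x, `|f x| <= M.

Lemma bounded_measurable_cst (c : R) : bounded_measurable (fun=> c).
Proof. by split => //; exists `|c|. Qed.

Lemma bounded_measurableD f g : bounded_measurable f -> bounded_measurable g ->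
  bounded_measurable (fun x => f x + g x).
Proof.
move=> [mf [M fM]] [mg [N gN]]; split; first exact: measurable_funD.
by exists (M + N) => x; rewrite (le_trans (ler_normD _ _))// lerD.
Qed.

Lemma bounded_measurableM f g : bounded_measurable f -> bounded_measurable g ->
  bounded_measurable (fun x => f x * g x).
Proof.
move=> [mf [M fM]] [mg [N gN]]; split; first exact: measurable_funM.
by exists (M * N) => x; rewrite normrM ler_pM.
Qed.

Lemma bounded_measurableZ (c : R) f : bounded_measurable f ->
  bounded_measurable (fun x => c * f x).
Proof. exact/bounded_measurableM/bounded_measurable_cst. Qed.

Lemma bounded_measurableB f g : bounded_measurable f -> bounded_measurable g ->
  bounded_measurable (fun x => f x - g x).
Proof.
move=> bf bg; apply: bounded_measurableD => //.
by under eq_fun do rewrite -mulN1r; exact: bounded_measurableZ.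
Qed.

Lemma bounded_measurable_norm f : bounded_measurable f ->
  bounded_measurable (fun x => `|f x|).
Proof.
move=> [mf [M fM]]; split; first exact: measurableT_comp.
by exists M => x; rewrite normr_id.
Qed.

Lemma bounded_measurable_sum (I : Type) (s : seq I) (P : pred I)
    (F : I -> T -> R) : (forall i, bounded_measurable (F i)) ->
  bounded_measurable (fun x => \sum_(i <- s | P i) F i x).
Proof.
move=> bF; elim: s => [|i s IH].
  by under eq_fun do rewrite big_nil; exact: bounded_measurable_cst.
under eq_fun do rewrite big_cons; case: (P i) => //.
exact: bounded_measurableD.
Qed.

Lemma bounded_measurable_prod (I : Type) (s : seq I) (P : pred I)
    (F : I -> T -> R) : (forall i, bounded_measurable (F i)) ->
  bounded_measurable (fun x => \prod_(i <- s | P i) F i x).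
Proof.
move=> bF; elim: s => [|i s IH].
  by under eq_fun do rewrite big_nil; exact: bounded_measurable_cst.
under eq_fun do rewrite big_cons; case: (P i) => //.
exact: bounded_measurableM.
Qed.

Lemma bounded_measurable_exp f n : bounded_measurable f ->
  bounded_measurable (fun x => f x ^+ n).
Proof.
move=> bf; elim: n => [|n IH]; first exact: bounded_measurable_cst.
by under eq_fun do rewrite exprS; exact: bounded_measurableM.
Qed.

Lemma bounded_measurable_indic (A : set T) : measurable A ->
  bounded_measurable (\1_A : T -> R).
Proof.
move=> mA; split; first exact: measurable_indic.
by exists 1 => x; rewrite indicE; case: (x \in A); rewrite ?normr1 ?normr0.
Qed.

Lemma bounded_measurable_integrable (P : probability T R) f :
  bounded_measurable f -> P.-integrable setT (EFin \o f).
Proof.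
move=> [mf [M fM]]; apply: measurable_bounded_integrable => //.
  by rewrite (le_lt_trans (probability_le1 P measurableT))// ltry.
exists M; split; first exact: num_real.
by move=> N MN x _ /=; rewrite (le_trans (fM x))// ltW.
Qed.

End bounded_measurable.

Lemma bounded_measurable_comp {R : realType} d1 d2 (T1 : measurableType d1)
    (T2 : measurableType d2) (f : T2 -> R) (h : T1 -> T2) :
  bounded_measurable f -> measurable_fun setT h -> bounded_measurable (f \o h).
Proof.
move=> [mf [M fM]] mh; split; first exact: measurableT_comp.
by exists M => x /=.
Qed.

Section real_integral.
Context {R : realType} {d : measure_display} {T : measurableType d}.
Variable P : probability T R.
Implicit Types f g : T -> R.

Lemma Rintegral_sum (I : Type) (s : seq I) (F : I -> T -> R) :
  (forall i, P.-integrable setT (EFin \o F i)) ->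
  \int[P]_x (\sum_(i <- s) F i x) = \sum_(i <- s) \int[P]_x F i x.
Proof.
move=> iF; elim: s => [|i s IH].
  under eq_Rintegral do rewrite big_nil.
  by rewrite Rintegral_cst// mul0r big_nil.
under eq_Rintegral do rewrite big_cons.
rewrite big_cons RintegralD// ?IH//.
have := @integrable_sum _ _ _ P setT measurableT I s xpredT
  (fun i => EFin \o F i) (fun i _ => iF i).
apply: eq_integrable => // x _ /=.
by rewrite -sumEFin.
Qed.

Lemma Rintegral_const (c : R) : \int[P]_x c = c.
Proof.
rewrite Rintegral_cst// -[RHS]mulr1; congr (_ * _).
by rewrite [X in fine X](probability_setT P). Qed.

Lemma Rintegral_indic (A : set T) : measurable A ->
  \int[P]_x (\1_A x : R) = fine (P A).
Proof. by move=> mA; rewrite /Rintegral integral_indic// setIT. Qed.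

Lemma Rintegral_EFin f : P.-integrable setT (EFin \o f) ->
  (\int[P]_x (f x)%:E = (\int[P]_x f x)%:E)%E.
Proof. by move=> fi; rewrite fineK//; exact: integrable_fin_num. Qed.

Lemma Rintegral_le_const f (c : R) : P.-integrable setT (EFin \o f) ->
  (forall x, f x <= c) -> \int[P]_x f x <= c.
Proof.
move=> fi fc; rewrite -[leRHS]Rintegral_const; apply: le_Rintegral => //.
by have := @bounded_measurable_integrable _ _ _ P _ (bounded_measurable_cst c).
Qed.

Lemma Rintegral_distribution d' (T' : measurableType d')
    (X : {mfun T >-> T'}) (f : T' -> R) : measurable_fun setT f ->
  P.-integrable setT (EFin \o (f \o X)) ->
  \int[distribution P X]_y f y = \int[P]_x f (X x).
Proof.
move=> mf fi; rewrite /Rintegral integral_distribution//.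
exact/measurable_EFinP.
Qed.

Lemma integrable_distribution d' (T' : measurableType d')
    (X : {mfun T >-> T'}) (f : T' -> R) : measurable_fun setT f ->
  P.-integrable setT (EFin \o (f \o X)) ->
  (distribution P X).-integrable setT (EFin \o f).
Proof.
move=> mf /integrableP[_ fi]; apply/integrableP; split.
  exact/measurable_EFinP.
rewrite ge0_integral_distribution//; apply/measurable_EFinP.
exact: measurableT_comp.
Qed.

Lemma Rintegral_ae_eq f g (N : set T) : measurable_fun setT f ->
  measurable_fun setT g -> measurable N -> P N = 0%E ->
  (forall x, ~ N x -> f x = g x) -> \int[P]_x f x = \int[P]_x g x.
Proof.
move=> mf mg mN PN fg; congr fine; apply: ae_eq_integral => //.
- exact/measurable_EFinP.
- exact/measurable_EFinP.
exists N; split => // x /= /existsNP[/= _ fgx]; apply: contrapT => Nx.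
by apply: fgx; rewrite fg.
Qed.

End real_integral.

Section real_fubini.
Context {R : realType} {d1 d2 : measure_display}.
Context {T1 : measurableType d1} {T2 : measurableType d2}.
Variables (P1 : probability T1 R) (P2 : probability T2 R).

Lemma integrable_tensor2 (f : T1 -> R) (g : T2 -> R) :
  P1.-integrable setT (EFin \o f) -> P2.-integrable setT (EFin \o g) ->
  (P1 \x P2)%E.-integrable setT (EFin \o (fun p => f p.1 * g p.2)).
Proof.
move=> fi gi; have mf := measurable_int _ fi; have mg := measurable_int _ gi.
apply/integrable12ltyP.
  apply/measurable_EFinP/measurable_funM.
    by apply: measurableT_comp measurable_fst; exact/measurable_EFinP.
  by apply: measurableT_comp measurable_snd; exact/measurable_EFinP.
under eq_integral => x _.
  under eq_integral do rewrite /= normrM EFinM.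
  rewrite ge0_integralZl//; last first.
    by apply/measurable_EFinP/measurableT_comp => //; exact/measurable_EFinP.
  over.
have [mg' gy] := integrableP _ _ _ gi.
have gfin : (\int[P2]_y `|g y|%:E)%E \is a fin_num.
  by rewrite ge0_fin_numE ?integral_ge0.
rewrite -(fineK gfin) ge0_integralZr//.
- rewrite fineK//; apply: lte_mul_pinfty => //; first exact: integral_ge0.
    by rewrite ge0_fin_numE ?integral_ge0//; have [] := integrableP _ _ _ fi.
- by apply/measurable_EFinP/measurableT_comp => //; exact/measurable_EFinP.
- by rewrite lee_fin fine_ge0 ?integral_ge0.
Qed.

(** Every section, not almost every one, is asked to be integrable: the inner integral passes
    through [fine], which is undone pointwise. *)
Lemma Rintegral12 (f : T1 * T2 -> R) :
  (P1 \x P2)%E.-integrable setT (EFin \o f) ->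
  (forall x, P2.-integrable setT (fun y => (f (x, y))%:E)) ->
  \int[P1]_x \int[P2]_y f (x, y) = \int[(P1 \x P2)%E]_z f z.
Proof.
move=> fi fxi; rewrite /Rintegral -(integral12_prod_meas1 fi).
congr fine; apply: eq_integral => x _.
by rewrite fineK//; apply: (integrable_fin_num _ (fxi x)).
Qed.

Lemma Rintegral21 (f : T1 * T2 -> R) :
  (P1 \x P2)%E.-integrable setT (EFin \o f) ->
  (forall y, P1.-integrable setT (fun x => (f (x, y))%:E)) ->
  \int[P2]_y \int[P1]_x f (x, y) = \int[(P1 \x P2)%E]_z f z.
Proof.
move=> fi fxi; rewrite /Rintegral -(integral21_prod_meas1 fi).
congr fine; apply: eq_integral => x _.
by rewrite fineK//; apply: (integrable_fin_num _ (fxi x)).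
Qed.

Lemma Rintegral_tensor2 (f : T1 -> R) (g : T2 -> R) :
  P1.-integrable setT (EFin \o f) -> P2.-integrable setT (EFin \o g) ->
  \int[(P1 \x P2)%E]_p (f p.1 * g p.2) = \int[P1]_x f x * \int[P2]_y g y.
Proof.
move=> fi gi; rewrite -Rintegral12//; last 2 first.
- exact: integrable_tensor2.
- by move=> x /=; apply: eq_integrable (integrableZl _ (f x) gi).
under eq_Rintegral => x _ do rewrite /= RintegralZl//.
by rewrite RintegralZr.
Qed.

Lemma bounded_measurable_pair1 (f : T1 * T2 -> R) x :
  bounded_measurable f -> bounded_measurable (fun y => f (x, y)).
Proof. by move=> bf; exact: (bounded_measurable_comp bf (pair1_measurable x)). Qed.

Lemma bounded_measurable_pair2 (f : T1 * T2 -> R) y :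
  bounded_measurable f -> bounded_measurable (fun x => f (x, y)).
Proof. by move=> bf; exact: (bounded_measurable_comp bf (pair2_measurable y)). Qed.

Lemma bounded_measurable_integrable2 (f : T1 * T2 -> R) :
  bounded_measurable f -> (P1 \x P2)%E.-integrable setT (EFin \o f).
Proof. exact: bounded_measurable_integrable. Qed.

Lemma bounded_Fubini (f : T1 * T2 -> R) : bounded_measurable f ->
  \int[P1]_x \int[P2]_y f (x, y) = \int[P2]_y \int[P1]_x f (x, y).
Proof.
move=> bf; rewrite Rintegral12 ?Rintegral21//.
- exact: bounded_measurable_integrable2.
- by move=> y; apply: bounded_measurable_integrable; exact: bounded_measurable_pair2.
- exact: bounded_measurable_integrable2.
- by move=> y; apply: bounded_measurable_integrable; exact: bounded_measurable_pair1.
Qed.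

Lemma bounded_measurable_Rintegral (f : T1 * T2 -> R) : bounded_measurable f ->
  bounded_measurable (fun x => \int[P2]_y f (x, y)).
Proof.
move=> bf; split.
  apply: measurableT_comp => //.
  exact: (measurable_fubini_F (bounded_measurable_integrable2 bf)).
have [mf [M fM]] := bf; exists M => x.
have bfx := bounded_measurable_pair1 x bf.
apply: (le_trans (le_normr_Rintegral _ _)) => //.
  exact: bounded_measurable_integrable.
apply: Rintegral_le_const => //.
exact/bounded_measurable_integrable/bounded_measurable_norm.
Qed.

End real_fubini.

Section power_measure_theory.
Context {R : realType} {d : measure_display} {V : measurableType d}.
Variable mu : probability V R.

(** Integrability is part of the conclusion because the inductive step feeds it to Fubini. The
    factor may depend on the coordinate, so that boxes, marginals and tensors are all instances. *)
Lemma power_measure_prod (k : nat) (h : 'I_k -> V -> R) :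
  (forall i, mu.-integrable setT (EFin \o h i)) ->
  (power_measure mu k).-integrable setT
    (EFin \o (fun t => \prod_(i < k) h i (tnth t i))) /\
  \int[power_measure mu k]_t (\prod_(i < k) h i (tnth t i)) =
  \prod_(i < k) \int[mu]_x h i x.
Proof.
elim: k h => [|k IH] h hi.
  have -> : (fun t : 0.-tuple V => \prod_(i < 0) h i (tnth t i)) = fun=> 1.
    by apply/funext => t; rewrite big_ord0.
  split; last by rewrite Rintegral_const big_ord0.
  exact: (bounded_measurable_integrable _ (bounded_measurable_cst 1)).
have [Hi HE] := IH (fun i => h (lift ord0 i)) (fun i => hi _).
set H := fun t : k.-tuple V => \prod_(i < k) h (lift ord0 i) (tnth t i).
have E (p : V * k.-tuple V) :
    \prod_(i < k.+1) h i (tnth (tuple_cons p) i) = h ord0 p.1 * H p.2.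
  rewrite big_ord_recl tnth0; congr (_ * _).
  by apply: eq_bigr => i _; rewrite tnthS.
have mh : measurable_fun setT
    (fun t : k.+1.-tuple V => \prod_(i < k.+1) h i (tnth t i)).
  apply: measurable_prod => i _; apply: measurableT_comp (measurable_tnth i).
  exact/measurable_EFinP/(measurable_int _ (hi i)).
have ti := integrable_tensor2 (hi ord0) Hi.
have Ti : (mu \x power_measure mu k)%E.-integrable setT (EFin \o
    ((fun t : k.+1.-tuple V => \prod_(i < k.+1) h i (tnth t i)) \o
     @tuple_cons _ _ k)).
  by apply: eq_integrable ti => // p _ /=; rewrite E.
split; first exact: (integrable_distribution mh Ti).
rewrite [LHS](Rintegral_distribution mh Ti).
under eq_Rintegral do rewrite E.
by rewrite Rintegral_tensor2// HE [RHS]big_ord_recl.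
Qed.

Lemma power_measure_box (k : nat) (B : 'I_k -> set V) :
  (forall i, measurable (B i)) ->
  measurable [set t : k.-tuple V | forall i, B i (tnth t i)] /\
  power_measure mu k [set t | forall i, B i (tnth t i)] =
  (\prod_(i < k) fine (mu (B i)))%:E.
Proof.
move=> mB; set S := [set t | _].
have SE : S = \bigcap_(i in [set: 'I_k]) [set t | B i (tnth t i)].
  by apply/seteqP; split=> [t h i _|t h i]; exact: h.
have mS : measurable S.
  rewrite SE; apply: fin_bigcap_measurable => // i _.
  by rewrite -[X in measurable X]setTI; exact: measurable_tnth.
split=> //.
have [|_] := @power_measure_prod k (fun i => \1_(B i)).
  move=> i; apply: bounded_measurable_integrable.
  exact: bounded_measurable_indic.
under [in RHS]eq_bigr do rewrite Rintegral_indic//.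
move=> <-; rewrite -[LHS]fineK ?fin_num_measure// -Rintegral_indic//.
congr EFin; apply: eq_Rintegral => t _; rewrite indicE.
have [tS|tS] := boolP (t \in S).
  rewrite big1// => i _; rewrite indicE mem_set//.
  by move: tS; rewrite inE; exact.
have /existsNP[i Bi] : ~ S t by move/mem_set; rewrite (negPf tS).
by rewrite (bigD1 i)//= indicE memNset// mul0r.
Qed.

Lemma power_measure_marginal (k : nat) (i : 'I_k) (B : set V) : measurable B ->
  measurable [set t : k.-tuple V | B (tnth t i)] /\
  power_measure mu k [set t | B (tnth t i)] = mu B.
Proof.
move=> mB.
have [|mS SE] := @power_measure_box k (fun j => if j == i then B else setT).
  by move=> j; case: eqP.
have E : [set t : k.-tuple V | forall j, (if j == i then B else setT) (tnth t j)]
    = [set t | B (tnth t i)].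
  apply/seteqP; split=> [t /(_ i)|t Bt j] /=; first by rewrite eqxx.
  by case: eqP => // ->.
rewrite -E; split=> //; rewrite SE (bigD1 i)//= eqxx big1 ?mulr1.
  by rewrite fineK ?fin_num_measure.
by move=> j /negPf ->; rewrite probability_setT.
Qed.

End power_measure_theory.

Section tensors.
Context {R : realType} {d : measure_display} {V : borelType d}.
Variable mu : probability V R.

Lemma bounded_measurable_tensor (k : nat) (f : V -> R) :
  bounded_measurable f -> bounded_measurable (@tensor R d V k f).
Proof.
move=> bf; apply: bounded_measurable_prod => i.
exact: (bounded_measurable_comp bf (measurable_tnth i)).
Qed.

Lemma Rintegral_tensor (k : nat) (f : V -> R) : bounded_measurable f ->
  \int[power_measure mu k]_t tensor f t = (\int[mu]_x f x) ^+ k.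
Proof.
move=> bf; have [|_ ->] := @power_measure_prod _ _ _ mu k (fun=> f).
  by move=> i; exact: bounded_measurable_integrable.
by rewrite prodr_const card_ord.
Qed.

Lemma tensor_L2sym (k : nat) (f : V -> R) : f \in Lfun mu 2%:E ->
  L2sym mu k (tensor f).
Proof.
move=> fL; have mf : measurable_fun setT f by exact: set_mem (sub_Lfun_mfun fL).
have mt : measurable_fun setT (@tensor R d V k f).
  apply: measurable_prod => i _; apply: measurableT_comp => //.
  exact: measurable_tnth.
split; last first.
  move=> s; apply: aeW => t; rewrite /tensor.
  under eq_bigr do rewrite tnth_mktuple.
  by rewrite [RHS](reindex_inj (@perm_inj _ s)).
have fi : mu.-integrable setT (EFin \o (fun x => f x ^+ 2)).
  exact: Lfun2_integrable_sqr.
have [|ti _] := @power_measure_prod _ _ _ mu k (fun _ x => f x ^+ 2).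
  by [].
rewrite inE/=; apply/andP; split; rewrite inE//=.
rewrite /finite_norm unlock /=; apply: poweR_lty.
have [_ ] := integrableP _ _ _ ti; apply: le_lt_trans.
rewrite le_eqVlt; apply/orP; left; apply/eqP/eq_integral => t _ /=.
by rewrite powR_mulrn// -normrX /tensor -prodrXl.
Qed.

End tensors.

(** * Finite powers of a compact space *)

Section tuple_topology_theory.
Context {k : nat} {T : topologicalType}.
Implicit Types t : k.-tuple T.

Lemma cvg_tuple (F : set_system (k.-tuple T)) t : Filter F ->
  (forall i, (fun s : k.-tuple T => tnth s i) @ F --> tnth t i) -> F --> t.
Proof.
move=> FF Fi A [B [[C oC <-] Ct] BA].
have : (@tuple_coords k T) @ F --> (tuple_coords t : {ptws 'I_k -> T}).
  apply/cvg_sup => i D [E [[E' oE' <-] E't] ED].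
  apply: (@filterS _ F _ ((fun s : k.-tuple T => tnth s i) @^-1` E')).
    by move=> s; exact: ED.
  by apply: (Fi i E'); exact: open_nbhs_nbhs.
move=> /(_ C (open_nbhs_nbhs (conj oC Ct))) FC.
exact: (@filterS _ F _ _ _ BA FC).
Qed.

Lemma tnth_continuous (i : 'I_k) : continuous (fun t : k.-tuple T => tnth t i).
Proof.
have c1 : continuous (@tuple_coords k T : k.-tuple T -> {ptws 'I_k -> T}).
  by apply/continuousP => A oA; exists A.
move=> t; apply: (continuous_comp (g := fun f : {ptws 'I_k -> T} => f i)).
  exact: c1.
exact: (@proj_continuous _ (fun=> T)).
Qed.

(** The open boxes around [t] generate a filter that converges coordinatewise, hence converges to
    [t] by [cvg_tuple]; every neighbourhood of [t] therefore belongs to it. *)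
Lemma nbhs_tuple_box t (A : set (k.-tuple T)) : nbhs t A ->
  exists U : 'I_k -> set T, (forall i, open (U i) /\ U i (tnth t i)) /\
    forall s : k.-tuple T, (forall i, U i (tnth s i)) -> A s.
Proof.
pose D := [set U : 'I_k -> set T | forall i, open (U i) /\ U i (tnth t i)].
pose F := filter_from D (fun U => [set s : k.-tuple T | forall i, U i (tnth s i)]).
have FF : Filter F.
  apply: filter_from_filter.
    by exists (fun=> setT) => i; split => //; exact: openT.
  move=> U1 U2 D1 D2; exists (fun i => U1 i `&` U2 i).
    by move=> i; case: (D1 i) (D2 i) => ? ? [? ?]; split => //; exact: openI.
  by move=> s Us; split => i; case: (Us i).
move=> tA; suff : F --> t by move=> /(_ A tA) [U DU UA]; exists U.
apply: cvg_tuple => i B; rewrite nbhsE => -[C [oC Ct] CB].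
exists (fun j => if j == i then C else setT).
  by move=> j; case: eqP => [->|_]; split => //; exact: openT.
by move=> s /(_ i) /=; rewrite eqxx; exact: CB.
Qed.

Lemma continuous_tuple (X : topologicalType) (f : X -> k.-tuple T) :
  (forall i, continuous (fun x => tnth (f x) i)) -> continuous f.
Proof.
move=> cf x; apply: cvg_tuple => i; exact: (cf i x).
Qed.

Lemma compact_tuple : compact [set: T] -> compact [set: k.-tuple T].
Proof.
move=> cT; have := @tychonoff 'I_k (fun=> T) (fun=> setT) (fun=> cT).
move=> /(continuous_compact (f := fun f : {ptws 'I_k -> T} => [tuple f i | i < k])).
set S := _ @` _; suff -> : S = setT.
  apply; apply: continuous_subspaceT; apply: continuous_tuple => i.
  rewrite (_ : (fun _ => _) = fun f : {ptws 'I_k -> T} => f i).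
    exact: (@proj_continuous _ (fun=> T)).
  by apply/funext => f; rewrite tnth_mktuple.
apply/seteqP; split=> // t _; exists (tnth t) => //.
by apply: eq_from_tnth => i; rewrite tnth_mktuple.
Qed.

End tuple_topology_theory.

(** Near-covering compactness is applied to the filter of finite sequences ordered by inclusion:
    points near [x] are covered as soon as the sequence contains [x]. *)
Lemma compact_finite_cover (X : topologicalType) (A : set X) (U : X -> set X) :
  compact A -> (forall x, A x -> nbhs x (U x)) ->
  exists s : seq X, forall x, A x -> exists2 y, y \in s & U y x.
Proof.
move=> /compact_near_coveringP cA AU.
pose F := filter_from [set: seq X] (fun s => [set s' : seq X | {subset s <= s'}]).
have FF : Filter F.
  apply: filter_from_filter; first by exists [::].
  move=> s1 s2 _ _; exists (s1 ++ s2) => // s' sub.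
  by split => x xs; apply: sub; rewrite mem_cat xs ?orbT.
have := cA _ F (fun s x => exists2 y, y \in s & U y x) FF.
case=> [x Ax|s _ sA]; last by exists s => x Ax; apply: (sA s).
exists (U x, [set s : seq X | {subset [:: x] <= s}]).
  by split; [exact: AU|exists [:: x]].
by move=> -[x' s] [/= Ux' xs]; exists x => //; apply: xs; rewrite inE.
Qed.

Section partitions.
Context {R : realType} {d : measure_display} {V : borelType d}.

Lemma open_measurable_borel (U : set V) : open U -> measurable U.
Proof. by move=> oU; rewrite measurable_borel; exact: sub_sigma_algebra. Qed.

(** Finitely many boxes on which A varies by less than e cover V^k, and [q v] records which sides of
    which boxes contain [v]; tuples with equal codes lie in the same boxes. The partition is one of
    V, not of V^k, because products of cells are what tensors of step functions can see. *)
Lemma continuous_partition (k : nat) (A : k.-tuple V -> R) (e : R) :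
  compact [set: V] -> continuous A -> 0 < e ->
  exists n, exists q : V -> 'I_n, (forall i, measurable (q @^-1` [set i])) /\
    forall s t : k.-tuple V, (forall i, q (tnth s i) = q (tnth t i)) ->
    `|A s - A t| <= e.
Proof.
move=> cV cA e0.
have /choice[U UP] : forall t : k.-tuple V, exists U : 'I_k -> set V,
    (forall i, open (U i) /\ U i (tnth t i)) /\
    forall s : k.-tuple V, (forall i, U i (tnth s i)) -> `|A t - A s| < e / 2.
  move=> t; apply: nbhs_tuple_box.
  by move/cvgrPdist_lt : (cA t); apply; rewrite divr_gt0.
have [|ss ssP] := compact_finite_cover
    (U := fun t => [set s | forall i, U t i (tnth s i)]) (compact_tuple cV).
  move=> t _; have [Ut _] := UP t.
  have := @filter_forall _ _ (fun i (s : k.-tuple V) => U t i (tnth s i)) (nbhs t) _.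
  apply=> i; apply: tnth_continuous.
  by apply: open_nbhs_nbhs; exact: Ut.
pose I := {ffun 'I_(size ss) * 'I_k -> bool}.
pose q v : I := [ffun p => `[< U (tnth (in_tuple ss) p.1) p.2 v >]].
exists #|{: I}|, (enum_rank \o q); split.
  move=> j; rewrite -(enum_valK j); move: (enum_val j) => phi.
  have -> : (enum_rank \o q) @^-1` [set enum_rank phi] =
      \bigcap_(p in [set: 'I_(size ss) * 'I_k])
        (if phi p then U (tnth (in_tuple ss) p.1) p.2
         else ~` U (tnth (in_tuple ss) p.1) p.2).
    apply/seteqP; split=> [v /enum_rank_inj qv p _|v h].
      by rewrite -qv ffunE; case: asboolP.
    congr enum_rank; apply/ffunP => p; rewrite ffunE.
    by have := h p Logic.I; case: (phi p) => /= ?; apply/asboolP.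
  apply: fin_bigcap_measurable => // p _.
  have mU : measurable (U (tnth (in_tuple ss) p.1) p.2).
    by apply: open_measurable_borel; have [/(_ p.2)[]] := UP (tnth (in_tuple ss) p.1).
  by case: (phi p) => //; exact: measurableC.
move=> s t st; have [u uss us] := ssP s Logic.I.
have [j ju] : exists j, tnth (in_tuple ss) j = u.
  by move: uss; rewrite -[_ \in _]/(u \in in_tuple ss) => /tnthP[j ->]; exists j.
have ut i : U u i (tnth t i).
  have /enum_rank_inj /ffunP/(_ (j, i)) := st i; rewrite !ffunE /= ju.
  by case: asboolP => [_ /esym/asboolP//|/(_ (us i))].
have [_ uA] := UP u.
have -> : A s - A t = (A u - A t) - (A u - A s) by ring.
rewrite (le_trans (ler_normB _ _))// (splitr e) ltW// ltrD//; exact: uA.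
Qed.

End partitions.

Section step_functions.
Context {R : realType} {d : measure_display} {V : borelType d}.
Variables (k n : nat) (q : V -> 'I_n).
Hypothesis mq : forall i, measurable (q @^-1` [set i]).

Definition cell_box (t : k.-tuple 'I_n) : set (k.-tuple V) :=
  [set s | forall i, q (tnth s i) = tnth t i].

Lemma cell_boxE (s : k.-tuple V) t : cell_box t s <-> map_tuple q s = t.
Proof.
split=> [h|<- i]; last by rewrite tnth_map.
by apply: eq_from_tnth => i; rewrite tnth_map.
Qed.

Lemma measurable_cell_box t : measurable (cell_box t).
Proof.
have -> : cell_box t =
    \bigcap_(i in [set: 'I_k]) [set s | (q @^-1` [set tnth t i]) (tnth s i)].
  by apply/seteqP; split=> [s h i _|s h i]; exact: h.
apply: fin_bigcap_measurable => // i _.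
by rewrite -[X in measurable X]setTI; exact: measurable_tnth.
Qed.

Lemma stepE (w : k.-tuple 'I_n -> R) (s : k.-tuple V) :
  w (map_tuple q s) = \sum_(t : k.-tuple 'I_n) w t * \1_(cell_box t) s.
Proof.
rewrite (bigD1 (map_tuple q s))//= big1 ?addr0.
  by rewrite indicE mem_set ?mulr1//; exact/cell_boxE.
move=> t tq; rewrite indicE memNset ?mulr0// => /cell_boxE st.
by rewrite st eqxx in tq.
Qed.

Lemma bounded_measurable_step (w : k.-tuple 'I_n -> R) :
  bounded_measurable (fun s : k.-tuple V => w (map_tuple q s)).
Proof.
under eq_fun do rewrite stepE.
apply: bounded_measurable_sum => t; apply: bounded_measurableZ.
by apply: bounded_measurable_indic; exact: measurable_cell_box.
Qed.

Lemma bounded_measurable_cell (c : 'I_n -> R) :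
  bounded_measurable (fun v : V => c (q v)).
Proof.
have -> : (fun v : V => c (q v)) =
    (fun v : V => \sum_(i < n) c i * \1_(q @^-1` [set i]) v).
  apply/funext => v; rewrite (bigD1 (q v))//= big1 ?addr0.
    by rewrite indicE mem_set ?mulr1.
  move=> i iq; rewrite indicE memNset ?mulr0//= => qi.
  by rewrite qi eqxx in iq.
apply: bounded_measurable_sum => t; apply: bounded_measurableZ.
exact: bounded_measurable_indic.
Qed.

End step_functions.

(** The sigma-algebra of [k.-tuple V] is the product one, so continuity does not give measurability
    directly. A is a uniform limit of step functions on product cells, which are bounded and
    measurable. *)
Lemma continuous_bounded_measurable (R : realType) d (V : borelType d) k
    (A : k.-tuple V -> R) :
  compact [set: V] -> continuous A -> bounded_measurable A.
Proof.
move=> cV cA.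
have /choice[B BP] : forall m, exists B : k.-tuple V -> R,
    bounded_measurable B /\ forall s, `|A s - B s| <= m.+1%:R^-1.
  move=> m.
  have [n [q [mq qA]]] := @continuous_partition R _ V k A m.+1%:R^-1 cV cA ltac:(by []).
  have /choice[w wP] : forall t : k.-tuple 'I_n, exists r : R,
      forall s, map_tuple q s = t -> `|A s - r| <= m.+1%:R^-1.
    move=> t; have [[s0 s0t]|] := pselect (exists s, map_tuple q s = t).
      exists (A s0) => s st; apply: qA => i.
        have := congr1 (fun u => tnth u i) (etrans st (esym s0t)).
        by rewrite !tnth_map.
    by move=> nt; exists 0 => s st; exfalso; apply: nt; exists s.
  exists (fun s => w (map_tuple q s)); split; first exact: bounded_measurable_step.
  by move=> s; exact: wP.
split.
  apply: (measurable_fun_cvg (h := B)) => [m|s _]; first by have [[]] := BP m.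
  apply/cvgrPdist_le => e e0; near=> m.
  have [_ /(_ s) h] := BP m; apply: le_trans h _.
  by apply: ltW; near: m; have := near_infty_natSinv_lt (PosNum e0).
have [[_ [M BM]] B0] := BP 0%N; exists (M + 1) => s.
have -> : A s = B 0%N s + (A s - B 0%N s) by ring.
rewrite (le_trans (ler_normD _ _))// lerD//.
by rewrite (le_trans (B0 s))// invr1.
Unshelve. all: by end_near. Qed.

Section L2.
Context {R : realType} {d : measure_display} {T : measurableType d}.
Variable P : probability T R.

Lemma Lfun2_integrable (f : T -> R) : f \in Lfun P 2%:E ->
  P.-integrable setT (EFin \o f).
Proof.
move=> fL; apply/Lfun1_integrable; apply: Lfun_subset12 fL.
exact: fin_num_measure.
Qed.

(** Integrates [|y| <= e + y ^+ 2 / e] instead of using Cauchy-Schwarz, at the cost of the factor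
    2. *)
Lemma Rintegral_le_L2 (f : T -> R) (e : R) : 0 < e -> f \in Lfun P 2%:E ->
  ('N[P]_(2%:E)[EFin \o f] < e%:E)%E -> \int[P]_x `|f x| <= 2 * e.
Proof.
move=> e0 fL fe.
have fi := Lfun2_integrable fL; have f2i := Lfun2_integrable_sqr fL.
have f2 : \int[P]_x (f x ^+ 2) <= e ^+ 2.
  rewrite -lee_fin -Rintegral_EFin//.
  have -> : (\int[P]_x (f x ^+ 2)%:E = 'N[P]_(2%:E)[EFin \o f] `^ 2)%E.
    rewrite poweR_Lnorm//; apply: eq_integral => x _ /=.
    by rewrite powR_mulrn// -normrX ger0_norm// sqr_ge0.
  rewrite -powR_mulrn; last exact: ltW.
  rewrite -poweR_EFin gt0_ler_poweR//.
  - by rewrite in_itv/= Lnorm_ge0 leey.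
  - by rewrite in_itv/= lee_fin ltW// leey.
  - exact: ltW.
have ce : P.-integrable setT (EFin \o (fun=> e)).
  exact: (bounded_measurable_integrable P (bounded_measurable_cst e)).
have f2e : P.-integrable setT (EFin \o (fun x => e^-1 * f x ^+ 2)).
  by apply: eq_integrable (integrableZl measurableT e^-1 f2i).
apply: (@le_trans _ _ (\int[P]_x (e + e^-1 * f x ^+ 2))).
  apply: le_Rintegral => //.
  - exact: integrable_norm.
  - by apply: eq_integrable (integrableD measurableT ce f2e).
  move=> x _; rewrite -(real_normK (num_real (f x))).
  have := normr_ge0 (f x); move: `|f x| => y y0.
  rewrite -(ler_pM2l e0) mulrDr mulrA mulfV ?gt_eqF// mul1r.
  by nra.
rewrite RintegralD// RintegralZl// Rintegral_const.
rewrite mulrDl mul1r lerD2l.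
by rewrite -(ler_pM2l e0) mulrA mulfV ?gt_eqF// mul1r -expr2.
Qed.

End L2.

(** * Completely positive functions tested by functionals *)

Section cell_means.
Context {R : realType} {d : measure_display} {V : borelType d}.
Variables (mu : probability V R) (n : nat) (q : V -> 'I_n).
Hypothesis mq : forall i, measurable (q @^-1` [set i]).

Definition cell_mass (i : 'I_n) : R := fine (mu (q @^-1` [set i])).

(* On a null cell the mean is [0], since [0^-1 = 0]. *)
Definition cell_mean (f : V -> R) (i : 'I_n) : R :=
  (cell_mass i)^-1 * \int[mu]_x (f x * \1_(q @^-1` [set i]) x).

(** The divisor is written as the product of the cell masses, so that the mean of a tensor factors
    into cell means; a null box gets the value 0. *)
Definition box_mean k (F : k.-tuple V -> R) (t : k.-tuple 'I_n) : R :=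
  (\prod_(i < k) cell_mass (tnth t i))^-1 *
  \int[power_measure mu k]_s (F s * \1_(cell_box q t) s).

Lemma cell_mass_ge0 i : 0 <= cell_mass i.
Proof. exact: fine_ge0. Qed.

Lemma integrable_cell (f : V -> R) i : mu.-integrable setT (EFin \o f) ->
  mu.-integrable setT (EFin \o (fun x => f x * \1_(q @^-1` [set i]) x)).
Proof.
move=> fi; have [mI _] := bounded_measurable_indic (R := R) (mq i).
have mf := measurable_int _ fi; apply: le_integrable fi => //.
  by apply/measurable_EFinP/measurable_funM => //; exact/measurable_EFinP.
move=> x _ /=; rewrite lee_fin normrM indicE; case: (x \in _).
  by rewrite normr1 mulr1.
by rewrite normr0 mulr0.
Qed.

Lemma integrable_box k (F : k.-tuple V -> R) t :
  (power_measure mu k).-integrable setT (EFin \o F) ->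
  (power_measure mu k).-integrable setT
    (EFin \o (fun s => F s * \1_(cell_box q t) s)).
Proof.
move=> fi.
have [mI _] := bounded_measurable_indic (R := R) (measurable_cell_box mq t).
have mf := measurable_int _ fi; apply: le_integrable fi => //.
  by apply/measurable_EFinP/measurable_funM => //; exact/measurable_EFinP.
move=> x _ /=; rewrite lee_fin normrM indicE; case: (x \in _).
  by rewrite normr1 mulr1.
by rewrite normr0 mulr0.
Qed.

Lemma indic_cell_box k (t : k.-tuple 'I_n) (s : k.-tuple V) :
  \1_(cell_box q t) s =
  \prod_(i < k) \1_(q @^-1` [set tnth t i]) (tnth s i) :> R.
Proof.
rewrite indicE; have [|st] := boolP (s \in cell_box q t).
  rewrite inE => st; rewrite big1// => i _.
  by rewrite indicE mem_set//; exact: st.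
have /existsNP[i si] : ~ cell_box q t s by move/mem_set; rewrite (negPf st).
by rewrite (bigD1 i)//= indicE memNset// mul0r.
Qed.

Lemma box_mean_tensor k (f : V -> R) (t : k.-tuple 'I_n) :
  mu.-integrable setT (EFin \o f) ->
  box_mean (tensor f) t = \prod_(i < k) cell_mean f (tnth t i).
Proof.
move=> fi; rewrite /box_mean /cell_mean big_split/= prodfV; congr (_ * _).
have [|_ <-] := @power_measure_prod _ _ _ mu k
    (fun i x => f x * \1_(q @^-1` [set tnth t i]) x).
  by move=> i; exact: integrable_cell.
by apply: eq_Rintegral => s _; rewrite /tensor indic_cell_box -big_split.
Qed.

Lemma cell_mean_ge0 (f : V -> R) i : mu.-integrable setT (EFin \o f) ->
  {ae mu, forall v, 0 <= f v} -> 0 <= cell_mean f i.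
Proof.
move=> fi f0; rewrite mulr_ge0// ?invr_ge0 ?cell_mass_ge0//.
have gi := integrable_cell i fi.
have [N [mN N0 fN]] := f0.
rewrite (@Rintegral_ae_eq _ _ _ mu _ (fun x => `|f x * \1_(q @^-1` [set i]) x|) N)//.
- by apply: Rintegral_ge0 => x _.
- exact/measurable_EFinP/(measurable_int _ gi).
- by apply: measurableT_comp => //; exact/measurable_EFinP/(measurable_int _ gi).
move=> x Nx; rewrite ger0_norm// mulr_ge0//; apply: contrapT => fx.
by apply: Nx; apply: fN => /= h; apply: fx.
Qed.

Lemma box_meanD k (F F' : k.-tuple V -> R) t :
  (power_measure mu k).-integrable setT (EFin \o F) ->
  (power_measure mu k).-integrable setT (EFin \o F') ->
  box_mean (fun s => F s + F' s) t = box_mean F t + box_mean F' t.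
Proof.
move=> Fi Fi'; rewrite /box_mean -mulrDr -RintegralD//; [|exact: integrable_box..].
by congr (_ * _); apply: eq_Rintegral => s _; rewrite mulrDl.
Qed.

Lemma box_meanZ k c (F : k.-tuple V -> R) t :
  (power_measure mu k).-integrable setT (EFin \o F) ->
  box_mean (fun s => c * F s) t = c * box_mean F t.
Proof.
move=> Fi; rewrite /box_mean mulrCA -[X in _ = _ * X]RintegralZl//; last exact: integrable_box.
by congr (_ * _); apply: eq_Rintegral => s _; rewrite mulrA.
Qed.

(** Makes box means continuous in L^1, hence in L^2, which is what lets an inequality between them
    survive the closure in [CP]. *)
Lemma box_mean_le k (F : k.-tuple V -> R) t :
  (power_measure mu k).-integrable setT (EFin \o F) ->
  `|box_mean F t| <= (\prod_(i < k) cell_mass (tnth t i))^-1 *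
                    \int[power_measure mu k]_s `|F s|.
Proof.
move=> Fi; have m0 : 0 <= (\prod_(i < k) cell_mass (tnth t i))^-1.
  by rewrite invr_ge0; apply: prodr_ge0 => i _; exact: cell_mass_ge0.
rewrite normrM ger0_norm// ler_wpM2l//.
have Gi := integrable_box t Fi.
apply: (le_trans (le_normr_Rintegral _ _)) => //.
apply: le_Rintegral => //; try exact: integrable_norm.
move=> s _; rewrite normrM indicE; case: (s \in _).
  by rewrite normr1 mulr1.
by rewrite normr0 mulr0.
Qed.

Lemma box_mean_approx k (A : k.-tuple V -> R) (e : R) t s :
  (power_measure mu k).-integrable setT (EFin \o A) ->
  (forall s', cell_box q t s' -> `|A s' - A s| <= e) ->
  (forall i, cell_mass (tnth t i) != 0) -> `|box_mean A t - A s| <= e.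
Proof.
move=> Ai As t0; pose m := \prod_(i < k) cell_mass (tnth t i).
have m0 : 0 < m.
  apply: prodr_gt0 => i _.
  by rewrite lt_neqAle eq_sym t0 cell_mass_ge0.
have [_ boxE] := power_measure_box mu (fun i => mq (tnth t i)).
have bi : bounded_measurable (\1_(cell_box q t) : k.-tuple V -> R).
  by apply: bounded_measurable_indic; exact: measurable_cell_box.
have mE : \int[power_measure mu k]_s (\1_(cell_box q t) s : R) = m.
  rewrite Rintegral_indic; last exact: measurable_cell_box.
  exact: (congr1 fine boxE).
have ci (c : R) : (power_measure mu k).-integrable setT
    (EFin \o (fun s => c * \1_(cell_box q t) s)).
  by apply: bounded_measurable_integrable; exact: bounded_measurableZ.
have -> : box_mean A t - A s =
    m^-1 * \int[power_measure mu k]_s' ((A s' - A s) * \1_(cell_box q t) s').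
  under eq_Rintegral do rewrite mulrBl.
  rewrite RintegralB//; last exact: integrable_box.
  rewrite RintegralZl ?bounded_measurable_integrable// mE mulrBr.
  by rewrite mulrCA mulVf ?mulr1 ?gt_eqF.
rewrite normrM gtr0_norm ?invr_gt0// mulrC ler_pdivrMr//.
have Di : (power_measure mu k).-integrable setT
    (EFin \o (fun s' => (A s' - A s) * \1_(cell_box q t) s')).
  apply: eq_integrable (integrableB measurableT (integrable_box t Ai) (ci (A s))) => //.
  by move=> s' _ /=; rewrite mulrBl.
apply: (le_trans (le_normr_Rintegral _ _)) => //.
rewrite -mE -RintegralZl ?bounded_measurable_integrable//.
apply: le_Rintegral => //; first exact: integrable_norm.
move=> s' _; rewrite normrM indicE; have [|] := boolP (s' \in cell_box q t).
  by rewrite inE => /As ?; rewrite normr1 !mulr1.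
by rewrite normr0 !mulr0.
Qed.

End cell_means.

Section cp_functional.
Context {R : realType} {d : measure_display} {V : borelType d}.
Variables (mu : probability V R) (k : nat).

Lemma L2sym_integrable (F : k.-tuple V -> R) : L2sym mu k F ->
  (power_measure mu k).-integrable setT (EFin \o F).
Proof. by move=> [FL _]; exact: Lfun2_integrable. Qed.

Let one_le_two : (1 <= 2%:E :> \bar R)%E.
Proof. by rewrite lee_fin ler1n. Qed.

Lemma LfunD (F F' : k.-tuple V -> R) :
  F \in Lfun (power_measure mu k) 2%:E -> F' \in Lfun (power_measure mu k) 2%:E ->
  (fun s => F s + F' s) \in Lfun (power_measure mu k) 2%:E.
Proof. by move=> FL FL'; have [_ +] := Lfun_addr_closed (power_measure mu k) one_le_two; apply. Qed.

Lemma LfunZ c (F : k.-tuple V -> R) :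
  F \in Lfun (power_measure mu k) 2%:E ->
  (fun s => c * F s) \in Lfun (power_measure mu k) 2%:E.
Proof.
move=> FL; have -> : (fun s => c * F s) = c \o* F by apply/funext => s /=; rewrite mulrC.
by apply: Lfun_scale => //; rewrite ler1n.
Qed.

(* The F satisfying the conclusion form a closed convex cone containing the
   tensors, hence containing CP: no description of CP as a closure is needed. *)
Lemma CP_step n (q : V -> 'I_n) (w : k.-tuple 'I_n -> R) (A : k.-tuple V -> R) :
  (forall i, measurable (q @^-1` [set i])) ->
  (forall c : 'I_n -> R, (forall i, 0 <= c i) ->
    \sum_(t : k.-tuple 'I_n) w t * \prod_(i < k) c (tnth t i) <= 0) ->
  CP mu k A ->
  \sum_(t : k.-tuple 'I_n) w t * box_mean mu q A t <= 0.
Proof.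
move=> mq wc.
pose l F := \sum_(t : k.-tuple 'I_n) w t * box_mean mu q F t.
pose C := [set F | L2sym mu k F /\ l F <= 0].
suff : CP mu k `<=` C by move=> /[apply] -[].
pose K := \sum_(t : k.-tuple 'I_n)
  `|w t| * (\prod_(i < k) cell_mass mu q (tnth t i))^-1.
have lD F F' : L2sym mu k F -> L2sym mu k F' ->
    l (fun s => F s + F' s) = l F + l F'.
  move=> sF sF'; rewrite -big_split; apply: eq_bigr => t _ /=.
  by rewrite box_meanD ?mulrDr//; exact: L2sym_integrable.
have lZ c F : L2sym mu k F -> l (fun s => c * F s) = c * l F.
  move=> sF; rewrite mulr_sumr; apply: eq_bigr => t _.
  by rewrite (box_meanZ mq c t (L2sym_integrable sF)) mulrCA.
have lK F : L2sym mu k F -> `|l F| <= K * \int[power_measure mu k]_s `|F s|.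
  move=> sF; rewrite mulr_suml (le_trans (ler_norm_sum _ _ _))//.
  apply: ler_sum => t _; rewrite normrM -mulrA ler_wpM2l//.
  by apply: box_mean_le => //; exact: L2sym_integrable.
have sD F F' : L2sym mu k F -> L2sym mu k F' -> L2sym mu k (fun s => F s + F' s).
  move=> [FL Fs] [FL' Fs']; split; first exact: LfunD.
  by move=> s; apply: filterS2 (Fs s) (Fs' s) => t -> ->.
have sZ c F : L2sym mu k F -> L2sym mu k (fun s => c * F s).
  move=> [FL Fs]; split; first exact: LfunZ.
  by move=> s; apply: filterS (Fs s) => t ->.
apply: smallest_sub; last first.
  move=> _ [f [fL f0] <-]; split; first exact: tensor_L2sym.
  have fi := Lfun2_integrable fL.
  rewrite /l; under eq_bigr do rewrite box_mean_tensor//.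
  by apply: wc => i; exact: cell_mean_ge0.
split.
- by move=> F [].
- move=> F F' [sF lF] [sF' lF']; split; first exact: sD.
  by rewrite lD// -oppr_ge0 opprD addr_ge0// oppr_ge0.
- move=> c F c0 [sF lF]; split; first exact: sZ.
  by rewrite lZ// mulr_ge0_le0.
move=> F sF Fapp; split=> //; rewrite leNgt; apply/negP => lF.
have K0 : 0 <= K.
  apply: sumr_ge0 => t _; rewrite mulr_ge0// invr_ge0.
  by apply: prodr_ge0 => i _; exact: cell_mass_ge0.
(* For [F'] in the cone, [l F <= l F - l F' <= K * (2 * e) < l F]. The 2 is that of
   [Rintegral_le_L2]; adding 1 to [K] covers [K = 0]. *)
pose e := l F / (4 * (K + 1)).
have e0 : 0 < e by rewrite divr_gt0// mulr_gt0// ltr_wpDl.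
have [F' [sF' lF'] FF'] := Fapp _ e0.
have sB : L2sym mu k (fun s => F s + -1 * F' s) by apply: sD => //; exact: sZ.
have lB : l (fun s => F s + -1 * F' s) = l F - l F'.
  by rewrite lD//; [rewrite lZ// mulN1r|exact: sZ].
have := lK _ sB; rewrite lB.
have : \int[power_measure mu k]_s `|F s + -1 * F' s| <= 2 * e.
  apply: Rintegral_le_L2 => //; first by case: sB.
  by under eq_Lnorm do rewrite /= mulN1r.
move=> h1 h2.
have lFK : l F <= K * (2 * e).
  rewrite (le_trans _ (ler_wpM2l K0 h1))// (le_trans _ h2)//.
  by rewrite (le_trans _ (ler_norm _))// lerDl oppr_ge0.
have eE : e * (4 * (K + 1)) = l F by rewrite divfK// gt_eqF// mulr_gt0// ltr_wpDl.
by nra.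
Qed.

End cp_functional.

Section regular_functionals.
Context {R : realType} {d : measure_display} {V : borelType d}.
Variables (mu : probability V R) (k : nat).
Implicit Types (L : (k.-tuple V -> R) -> R) (F : k.-tuple V -> R).

(* Integration against a signed measure on V^k whose marginals are absolutely
   continuous with respect to mu. *)
Definition regular_functional L : Prop :=
  [/\ forall F F', bounded_measurable F -> bounded_measurable F' ->
        L (fun t => F t + F' t) = L F + L F',
      forall c F, bounded_measurable F -> L (fun t => c * F t) = c * L F
    & exists M, forall (N : set V) F e, measurable N -> mu N = 0%E ->
        bounded_measurable F -> 0 <= e ->
        (forall t, (forall i, ~ N (tnth t i)) -> `|F t| <= e) ->
        `|L F| <= M * e].

Lemma regular_functionalD L1 L2 : regular_functional L1 ->
  regular_functional L2 -> regular_functional (fun F => L1 F + L2 F).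
Proof.
move=> [D1 Z1 [M1 B1]] [D2 Z2 [M2 B2]]; split.
- by move=> F F' bF bF'; rewrite D1// D2// addrACA.
- by move=> c F bF; rewrite Z1// Z2// mulrDr.
- exists (M1 + M2) => N F e mN N0 bF e0 Fe; rewrite (le_trans (ler_normD _ _))//.
  by rewrite mulrDl lerD ?(B1 N)// (B2 N).
Qed.

Lemma regular_functionalZ c L : regular_functional L ->
  regular_functional (fun F => c * L F).
Proof.
move=> [D Z [M B]]; split.
- by move=> F F' bF bF'; rewrite D// mulrDr.
- by move=> a F bF; rewrite Z// mulrCA.
- exists (`|c| * M) => N F e mN N0 bF e0 Fe; rewrite normrM -mulrA ler_wpM2l//.
  exact: (B N).
Qed.

Lemma regular_functional_sum n (L : nat -> (k.-tuple V -> R) -> R) :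
  (forall j, regular_functional (L j)) ->
  regular_functional (fun F => \sum_(j < n) L j F).
Proof.
move=> rL; elim: n => [|n IH].
  under eq_fun do rewrite big_ord0; split=> [|c F _|]; first by rewrite addr0.
    by rewrite mulr0.
  by exists 0 => *; rewrite normr0 mul0r.
by under eq_fun do rewrite big_ord_recr/=; exact: regular_functionalD.
Qed.

(** The preimages of [N] under the k coordinates of [tau] are null, so almost surely no coordinate
    falls in [N] and the bound on [F] applies; the constant of regularity is a bound of [h]. *)
Lemma regular_functional_pushforward d' (O : measurableType d')
    (P : probability O R) (tau : O -> k.-tuple V) (h : O -> R) :
  measurable_fun setT tau -> bounded_measurable h ->
  (forall i (N : set V), measurable N -> mu N = 0%E ->
     P [set o | N (tnth (tau o) i)] = 0%E) ->
  regular_functional (fun F => \int[P]_o (F (tau o) * h o)).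
Proof.
move=> mtau bh tauN.
have bFh F : bounded_measurable F -> bounded_measurable (fun o => F (tau o) * h o).
  by move=> bF; apply: bounded_measurableM => //; exact: (bounded_measurable_comp bF mtau).
have iFh F : bounded_measurable F ->
    P.-integrable setT (EFin \o (fun o => F (tau o) * h o)).
  by move=> bF; exact/bounded_measurable_integrable/bFh.
split.
- move=> F F' bF bF'; rewrite -RintegralD//; [|exact: iFh..].
  by apply: eq_Rintegral => o _; rewrite mulrDl.
- move=> c F bF; rewrite -RintegralZl//; last exact: iFh.
  by apply: eq_Rintegral => o _; rewrite mulrA.
have [mh [M hM]] := bh; exists M => N F e mN N0 bF e0 Fe.
have [B [mB B0 sB]] : {ae P, forall o, forall i, ~ N (tnth (tau o) i)}.
  apply: filter_forall => i; exists [set o | N (tnth (tau o) i)]; split.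
  - rewrite -[X in measurable X]setTI.
    exact: (measurableT_comp (measurable_tnth i) mtau).
  - exact: tauN.
  - by move=> o /= /contrapT.
have mBC : measurable (~` B) by exact: measurableC.
have bg : bounded_measurable (fun o => F (tau o) * h o * \1_(~` B) o).
  by apply: bounded_measurableM; [exact: bFh|exact: bounded_measurable_indic].
rewrite (@Rintegral_ae_eq _ _ _ P _ (fun o => F (tau o) * h o * \1_(~` B) o) B)//.
- apply: (le_trans (le_normr_Rintegral _ _)) => //.
    exact: bounded_measurable_integrable.
  apply: Rintegral_le_const.
    by apply: bounded_measurable_integrable; exact: bounded_measurable_norm.
  move=> o; rewrite indicE; have [|_] := boolP (o \in ~` B).
    rewrite inE => /= Bo; rewrite mulr1 normrM mulrC ler_pM//.
    by apply: Fe => i; apply: contrapT => h'; apply: Bo; apply: sB => /(_ i).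
  by rewrite mulr0 normr0 mulr_ge0// (le_trans _ (hM o)).
- by case: (bFh F bF).
- by case: bg.
- by move=> o Bo; rewrite indicE mem_set ?mulr1.
Qed.

(** [L] need not be L^2-continuous, so it is not applied to approximants of [A]. If it were
    nonpositive on tensors of nonnegative step functions, [CP_step] with the weights [w t] would
    give [L A' <= 0] for the cell means [A'] of [A]. As [A'] is within [e] of [A] off null cells,
    regularity would yield [L A <= |M| * e < L A]. *)
Lemma CP_regular_functional (A : k.-tuple V -> R) L : compact [set: V] ->
  regular_functional L -> CPc mu k A -> 0 < L A ->
  exists f : V -> R, [/\ bounded_measurable f, forall v, 0 <= f v &
    0 < L (tensor f)].
Proof.
move=> cV [LD LZ [M LM]] [cpA cA] LA0; apply: contrapT => nof.
pose e := L A / (2 * (`|M| + 1)).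
have e0 : 0 < e by rewrite divr_gt0// mulr_gt0// ltr_wpDl.
have [n [q [mq qA]]] := continuous_partition cV cA e0.
have bA := continuous_bounded_measurable cV cA.
have iA := bounded_measurable_integrable (power_measure mu k) bA.
pose w (t : k.-tuple 'I_n) := L (\1_(cell_box q t)).
have bbox (t : k.-tuple 'I_n) : bounded_measurable (\1_(cell_box q t) : k.-tuple V -> R).
  by apply: bounded_measurable_indic; exact: measurable_cell_box.
have Lstep (a : k.-tuple 'I_n -> R) :
    L (fun s => a (map_tuple q s)) = \sum_(t : k.-tuple 'I_n) w t * a t.
  have -> : (fun s : k.-tuple V => a (map_tuple q s)) =
      (fun s => \sum_(t : k.-tuple 'I_n) a t * \1_(cell_box q t) s).
    by apply/funext => s; rewrite stepE.
  elim: (index_enum _) => [|t r IH].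
    under eq_fun do rewrite big_nil; rewrite big_nil.
    have := LZ 0 (fun=> 0) (bounded_measurable_cst 0).
    by under eq_fun do rewrite mul0r; rewrite mul0r.
  under eq_fun do rewrite big_cons.
  rewrite big_cons LD ?IH ?LZ 1?mulrC//.
    exact: bounded_measurableZ.
  by apply: bounded_measurable_sum => u; exact: bounded_measurableZ.
have wc (c : 'I_n -> R) : (forall i, 0 <= c i) ->
    \sum_(t : k.-tuple 'I_n) w t * \prod_(i < k) c (tnth t i) <= 0.
  move=> c0; rewrite -(Lstep (fun t => \prod_(i < k) c (tnth t i))) leNgt.
  apply/negP => Lc; apply: nof; exists (c \o q); split.
  - exact: bounded_measurable_cell.
  - by move=> v /=.
  have -> // : tensor (c \o q) = fun s : k.-tuple V =>
      \prod_(i < k) c (tnth (map_tuple q s) i).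
  by apply/funext => s; apply: eq_bigr => i _; rewrite tnth_map.
have := CP_step mq wc cpA; rewrite -Lstep => LA'.
set A' := fun s => box_mean mu q A (map_tuple q s) in LA'.
have bA' : bounded_measurable A' by exact: bounded_measurable_step.
(* On null cells the means take the default value 0, unrelated to [A]; these cells form the null set
   ignored by the third clause of [regular_functional]. *)
pose N := \bigcup_(i in [set i | cell_mass mu q i == 0]) q @^-1` [set i].
have mN : measurable N by apply: fin_bigcup_measurable => //.
have N0 : mu N = 0%E.
  have [B [mB B0 sB]] : {ae mu, forall v, cell_mass mu q (q v) != 0}.
    suff : {ae mu, forall v, forall i, q v = i -> cell_mass mu q i != 0}.
      by apply: filterS => v; exact.
    apply: filter_forall => i; have [m0|m0] := eqVneq (cell_mass mu q i) 0; last first.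
      exact: aeW.
    exists (q @^-1` [set i]); split=> //.
      by rewrite -[LHS]fineK ?fin_num_measure//; congr EFin.
    by move=> v /= /not_implyP[].
  apply/eqP; rewrite eq_le measure_ge0 andbT -B0 le_measure ?inE//.
  by move=> v [i /= m0 qv]; apply: sB => /=; rewrite qv; apply/negP; rewrite negbK.
have LB : L A - L A' = L (fun t => A t + -1 * A' t).
  by rewrite LD ?LZ ?mulN1r//; exact: bounded_measurableZ.
have : `|L A - L A'| <= M * e.
  rewrite LB; apply: (LM N) => //; last 2 first.
  - exact: ltW.
  - move=> s sN; rewrite mulN1r distrC; apply: box_mean_approx => //.
      by move=> s' ss'; apply: qA => i; rewrite ss' tnth_map.
    move=> i; rewrite tnth_map; apply/negP => m0; apply: (sN i).
    by exists (q (tnth s i)).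
  by apply: bounded_measurableD => //; exact: bounded_measurableZ.
move=> h; have h1 : L A <= `|M| * e.
  rewrite (le_trans _ (ler_wpM2r (ltW e0) (ler_norm M)))// (le_trans _ h)//.
  by rewrite (le_trans _ (ler_norm _))// lerDl oppr_ge0.
have eE : e * (2 * (`|M| + 1)) = L A.
  by rewrite divfK// gt_eqF// mulr_gt0// ltr_wpDl.
have := normr_ge0 M; nra.
Qed.

End regular_functionals.

(** * Oscillation of a density on the cells of a partition *)

Lemma exprD_ge (R : realDomainType) (u v : R) p : 0 <= u -> 0 <= v -> (0 < p)%N ->
  u ^+ p + v ^+ p <= (u + v) ^+ p.
Proof.
move=> u0 v0; case: p => // p _; elim: p => [|p IH]; first by rewrite !expr1.
rewrite [leRHS]exprS (le_trans _ (ler_wpM2l (addr_ge0 u0 v0) IH))//.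
rewrite mulrDl !mulrDr -!exprS.
have := mulr_ge0 u0 (exprn_ge0 p.+1 v0); have := mulr_ge0 v0 (exprn_ge0 p.+1 u0).
by lra.
Qed.

(** For [b <= a], superadditivity of the power gives [(a - b) ^+ p <= a ^+ p - b ^+ p]; both sides
    are symmetric in [a] and [b]. *)
Lemma dist_expr_le (R : realDomainType) (a b : R) p : 0 <= a -> 0 <= b -> (0 < p)%N ->
  `|a - b| ^+ p.+1 <= (a - b) * (a ^+ p - b ^+ p).
Proof.
move=> a0 b0 p0; wlog ba : a b a0 b0 / b <= a.
  move=> H; have [/H|/ltW/H] := leP b a; first exact.
  by rewrite distrC => /(_ b0 a0); rewrite -mulrNN !opprB.
rewrite ger0_norm ?subr_ge0// exprS ler_wpM2l ?subr_ge0//.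
rewrite lerBrDl; have := exprD_ge b0 (_ : 0 <= a - b) p0.
by rewrite subrKC; apply; rewrite subr_ge0.
Qed.

(** Above the level [e] the factor [(|t| / e) ^+ p] is at least 1. Integrated, this trades an
    L^(p+1) bound for an L^1 bound. *)
Lemma norm_le_expr (R : realFieldType) (t e : R) p : 0 < e ->
  `|t| <= e + e^-1 ^+ p * `|t| ^+ p.+1.
Proof.
move=> e0; have [te|et] := leP `|t| e.
  by rewrite (le_trans te)// lerDl mulr_ge0// exprn_ge0// invr_ge0 ltW.
rewrite (@le_trans _ _ (e^-1 ^+ p * `|t| ^+ p.+1))//; last by rewrite lerDr ltW.
rewrite exprSr mulrA ler_peMl// -exprMn exprn_ege1//.
by rewrite mulrC ler_pdivlMr// mul1r ltW.
Qed.

Section cell_averages.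
Context {R : realType} {d : measure_display} {V : borelType d}.
Variables (mu : probability V R) (n : nat) (q : V -> 'I_n).
Hypothesis mq : forall i, measurable (q @^-1` [set i]).

Definition cell_avg (f : V -> R) (x : V) : R := cell_mean mu q f (q x).

(* Averaging over the cells has kernel [\sum_C 1_C(x) 1_C(y) / mu(C)]. *)
Definition cell_kernel (p : V * V) : R :=
  \sum_(i < n) (cell_mass mu q i)^-1 *
    (\1_(q @^-1` [set i]) p.1 * \1_(q @^-1` [set i]) p.2).

Lemma bounded_measurable_cell_avg (f : V -> R) : bounded_measurable (cell_avg f).
Proof. exact: (@bounded_measurable_cell _ _ _ _ q mq (cell_mean mu q f)). Qed.

Lemma cell_kernelE x y : cell_kernel (x, y) =
  (cell_mass mu q (q x))^-1 * \1_(q @^-1` [set q x]) y.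
Proof.
rewrite /cell_kernel (bigD1 (q x))//= big1 ?addr0.
  by rewrite [\1__ x]indicE mem_set// mul1r.
move=> i iq; rewrite [\1__ x]indicE memNset ?mul0r ?mulr0//= => qi.
by rewrite qi eqxx in iq.
Qed.

Lemma bounded_measurable_cell_kernel : bounded_measurable cell_kernel.
Proof.
apply: bounded_measurable_sum => i; apply: bounded_measurableZ.
have b1 := bounded_measurable_indic (R := R) (mq i).
apply: bounded_measurableM.
  exact: (bounded_measurable_comp b1 measurable_fst).
exact: (bounded_measurable_comp b1 measurable_snd).
Qed.

Lemma Rintegral_cell_kernel (f : V -> R) x : bounded_measurable f ->
  \int[mu]_y (f y * cell_kernel (x, y)) = cell_avg f x.
Proof.
move=> bf; rewrite /cell_avg /cell_mean -RintegralZl//.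
  by apply: eq_Rintegral => y _; rewrite cell_kernelE mulrCA.
apply: bounded_measurable_integrable; apply: bounded_measurableM => //.
exact: bounded_measurable_indic.
Qed.

Lemma cell_mass_neq0_ae : exists N, [/\ measurable N, mu N = 0%E &
  forall x, ~ N x -> cell_mass mu q (q x) != 0].
Proof.
have [N [mN N0 sN]] : {ae mu, forall v, forall i, q v = i -> cell_mass mu q i != 0}.
  apply: filter_forall => i; have [m0|m0] := eqVneq (cell_mass mu q i) 0; last first.
    exact: aeW.
  exists (q @^-1` [set i]); split=> //.
    by rewrite -[LHS]fineK ?fin_num_measure//; congr EFin.
  by move=> v /= /not_implyP[].
exists N; split=> // x Nx; apply: contrapT => m0; apply: Nx; apply: sN => /(_ (q x)).
by move=> /(_ erefl).
Qed.

Lemma cell_avg_cst x : cell_mass mu q (q x) != 0 -> cell_avg (fun=> 1) x = 1.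
Proof.
move=> m0; rewrite /cell_avg /cell_mean; under eq_Rintegral do rewrite mul1r.
by rewrite Rintegral_indic// mulVf.
Qed.

(** [cell_avg f] is the conditional expectation of [f] given the cells, so it may replace [f]
    against functions constant on cells. On a null cell both integrals vanish, whatever the default
    value of the mean. *)
Lemma Rintegral_cell_avgM (f : V -> R) (c : 'I_n -> R) : bounded_measurable f ->
  \int[mu]_x (cell_avg f x * c (q x)) = \int[mu]_x (f x * c (q x)).
Proof.
move=> bf.
have bi i := bounded_measurable_indic (R := R) (mq i).
have E (g : V -> R) (b : 'I_n -> R) : bounded_measurable g ->
    \int[mu]_x (g x * b (q x)) =
    \sum_(i < n) b i * \int[mu]_x (g x * \1_(q @^-1` [set i]) x).
  move=> bg; have bgi i : bounded_measurable (fun x => b i * (g x * \1_(q @^-1` [set i]) x)).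
    by apply: bounded_measurableZ; exact: bounded_measurableM.
  have -> : \sum_(i < n) b i * \int[mu]_x (g x * \1_(q @^-1` [set i]) x) =
      \sum_(i < n) \int[mu]_x (b i * (g x * \1_(q @^-1` [set i]) x)).
    apply: eq_bigr => i _; rewrite RintegralZl//.
    by apply: bounded_measurable_integrable; exact: bounded_measurableM.
  rewrite -Rintegral_sum//; last first.
    by move=> i; exact: bounded_measurable_integrable.
  apply: eq_Rintegral => x _; rewrite (bigD1 (q x))//= big1 ?addr0.
    by rewrite indicE mem_set// mulr1 mulrC.
  move=> i iq; rewrite indicE memNset ?mulr0//= => qi.
  by rewrite qi eqxx in iq.
rewrite !E//; last exact: bounded_measurable_cell_avg.
apply: eq_bigr => i _; congr (_ * _).
transitivity (\int[mu]_x (cell_mean mu q f i * \1_(q @^-1` [set i]) x)).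
  apply: eq_Rintegral => x _; rewrite !indicE; have [|_] := boolP (x \in _).
    by rewrite inE /= /cell_avg => ->.
  by rewrite !mulr0.
rewrite RintegralZl//; last exact: bounded_measurable_integrable.
rewrite Rintegral_indic// -/(cell_mass mu q i) /cell_mean.
have [m0|m0] := eqVneq (cell_mass mu q i) 0; last by rewrite mulrAC mulVf ?mul1r.
rewrite m0 mulr0; symmetry; rewrite -[RHS](Rintegral_const mu 0).
apply: (@Rintegral_ae_eq _ _ _ mu _ _ (q @^-1` [set i])) => //.
- by case: (bounded_measurableM bf (bi i)).
- by rewrite -[LHS]fineK ?fin_num_measure//; congr EFin.
- by move=> x qx; rewrite indicE memNset ?mulr0.
Qed.

(* The right-hand side is linear in the tensor power of f, unlike the left-hand
   side; the two are compared through [dist_expr_le] and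
   [\int (f - cell_avg f) * (cell_avg f) ^+ p = 0]. *)
Lemma cell_oscillation (f : V -> R) p : (0 < p)%N -> bounded_measurable f ->
  (forall x, 0 <= f x) ->
  \int[mu]_x (`|f x - cell_avg f x| ^+ p.+1) <=
  \int[mu]_x (f x ^+ p.+1) - \int[mu]_x (f x ^+ p * cell_avg f x).
Proof.
move=> p0 bf f0; have ba := bounded_measurable_cell_avg f.
have a0 x : 0 <= cell_avg f x.
  apply: cell_mean_ge0 => //; first exact: bounded_measurable_integrable.
  exact: aeW.
have bfp := bounded_measurable_exp p bf; have bap := bounded_measurable_exp p ba.
have bm1 := bounded_measurableM bf bfp; have bm2 := bounded_measurableM bfp ba.
have bm3 := bounded_measurableM bf bap; have bm4 := bounded_measurableM ba bap.
have E := Rintegral_cell_avgM (fun i => cell_mean mu q f i ^+ p) bf.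
have bd := bounded_measurableB bf ba; have bdp := bounded_measurableB bfp bap.
apply: (@le_trans _ _ (\int[mu]_x ((f x - cell_avg f x) * (f x ^+ p - cell_avg f x ^+ p)))).
  apply: le_Rintegral => //.
  - apply: bounded_measurable_integrable; apply: bounded_measurable_exp.
    exact: bounded_measurable_norm.
  - by apply: bounded_measurable_integrable; exact: bounded_measurableM.
  by move=> x _; exact: dist_expr_le.
have -> : \int[mu]_x ((f x - cell_avg f x) * (f x ^+ p - cell_avg f x ^+ p)) =
    \int[mu]_x ((f x * f x ^+ p - f x ^+ p * cell_avg f x) -
                (f x * cell_avg f x ^+ p - cell_avg f x * cell_avg f x ^+ p)).
  by apply: eq_Rintegral => x _; ring.
rewrite RintegralB//; try exact: bounded_measurable_integrable; last 2 first.
- by apply: bounded_measurable_integrable; exact: bounded_measurableB.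
- by apply: bounded_measurable_integrable; exact: bounded_measurableB.
rewrite RintegralB//; try exact: bounded_measurable_integrable.
rewrite (RintegralB measurableT (bounded_measurable_integrable mu bm3)
  (bounded_measurable_integrable mu bm4)).
rewrite E subrr subr0.
by under [X in _ <= X - _]eq_Rintegral do rewrite exprS.
Qed.

Lemma cell_avg_dist (f : V -> R) p (e : R) : (0 < p)%N -> bounded_measurable f ->
  (forall x, 0 <= f x) -> 0 < e ->
  \int[mu]_x (f x ^+ p.+1) - \int[mu]_x (f x ^+ p * cell_avg f x) <= e ^+ p.+1 ->
  \int[mu]_x `|f x - cell_avg f x| <= 2 * e.
Proof.
move=> p0 bf f0 e0 osc.
have bd := bounded_measurableB bf (bounded_measurable_cell_avg f).
have bn := bounded_measurable_norm bd.
have bnp := bounded_measurable_exp p.+1 bn.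
have bz := bounded_measurableZ (e^-1 ^+ p) bnp.
apply: (@le_trans _ _ (\int[mu]_x (e + e^-1 ^+ p * `|f x - cell_avg f x| ^+ p.+1))).
  apply: le_Rintegral => //; first exact: bounded_measurable_integrable.
    apply: bounded_measurable_integrable; apply: bounded_measurableD => //.
    exact: bounded_measurable_cst.
  by move=> x _; exact: norm_le_expr.
rewrite (RintegralD measurableT
  (bounded_measurable_integrable mu (bounded_measurable_cst e))
  (bounded_measurable_integrable mu bz)).
rewrite Rintegral_const RintegralZl//; last exact: bounded_measurable_integrable.
rewrite mulrDl mul1r lerD2l.
have ie0 : 0 <= e^-1 ^+ p by rewrite exprn_ge0// invr_ge0 ltW.
rewrite (le_trans (ler_wpM2l ie0 (le_trans (cell_oscillation p0 bf f0) osc)))//.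
by rewrite exprSr mulrA -exprMn mulVf ?gt_eqF// expr1n mul1r.
Qed.

End cell_averages.

(** * Densities approximating a completely positive kernel *)

Section approximate_densities.
Context {R : realType} {dV dO : measure_display}.
Context {V : borelType dV} {O : measurableType dO}.
Variables (mu : probability V R) (P : probability O R) (act : O -> V -> V).
Variables (p : nat) (e : nat -> p.+1.-tuple V) (A : p.+1.-tuple V -> R).
Hypothesis p_gt0 : (0 < p)%N.
Hypothesis cV : compact [set: V].
Hypothesis mact : forall v, measurable_fun setT (fun o => act o v).
Hypothesis act_law : forall v (N : set V), measurable N ->
  P [set o | N (act o v)] = mu N.
Hypothesis cpA : CPc mu p.+1 A.
Hypothesis A_diag : \int[mu]_v A [tuple v | _ < p.+1] = 1.
Hypothesis A_edge : forall o j, A (map_tuple (act o) (e j)) = 0.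
Implicit Types F : p.+1.-tuple V -> R.

Lemma tensorZ c (f : V -> R) (t : p.+1.-tuple V) :
  tensor (fun x => c * f x) t = c ^+ p.+1 * tensor f t.
Proof. by rewrite /tensor big_split/= prodr_const card_ord. Qed.

Lemma tensor_ge0 (f : V -> R) (t : p.+1.-tuple V) : (forall x, 0 <= f x) ->
  0 <= tensor f t.
Proof. by move=> f0; apply: prodr_ge0. Qed.

(** With p coordinates x and one coordinate y, a tensor becomes [f x ^+ p * f y]; integrating y
    against [cell_kernel] produces the subtracted term of [cell_oscillation]. *)
Definition pair_tuple (xy : V * V) : p.+1.-tuple V :=
  [tuple if i == ord0 then xy.2 else xy.1 | i < p.+1].

Lemma tensor_pair (f : V -> R) x y :
  tensor f (pair_tuple (x, y)) = f x ^+ p * f y.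
Proof.
rewrite /tensor big_ord_recl tnth_mktuple/= mulrC; congr (_ * _).
under eq_bigr do rewrite tnth_mktuple/=.
by rewrite prodr_const card_ord.
Qed.

Lemma tensor_diag (f : V -> R) x :
  tensor f [tuple x | _ < p.+1] = f x ^+ p.+1.
Proof.
rewrite /tensor; under eq_bigr do rewrite tnth_mktuple.
by rewrite prodr_const card_ord.
Qed.

Lemma measurable_pair_tuple : measurable_fun setT pair_tuple.
Proof.
apply/measurable_fun_tnthP => i.
have -> : @tnth _ V ^~ i \o pair_tuple =
    fun xy => if i == ord0 then xy.2 else xy.1.
  by apply/funext => xy /=; rewrite tnth_mktuple.
by case: (i == ord0); [exact: measurable_snd|exact: measurable_fst].
Qed.

Lemma measurable_diag : measurable_fun setT (fun x : V => [tuple x | _ < p.+1]).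
Proof.
apply/measurable_fun_tnthP => i.
rewrite (_ : _ \o _ = id); first exact: measurable_id.
by apply/funext => x /=; rewrite tnth_mktuple.
Qed.

Lemma measurable_act_tuple (t : p.+1.-tuple V) :
  measurable_fun setT (fun o => map_tuple (act o) t).
Proof.
apply/measurable_fun_tnthP => i.
rewrite (_ : _ \o _ = fun o => act o (tnth t i)); first exact: mact.
by apply/funext => o /=; rewrite tnth_map.
Qed.

Definition full_functional F := \int[power_measure mu p.+1]_t F t.

Definition diag_functional F := \int[mu]_v F [tuple v | _ < p.+1].

Definition pair_functional n (q : V -> 'I_n) F :=
  \int[(mu \x mu)%E]_xy (F (pair_tuple xy) * cell_kernel mu q xy).

(** Integration against the law of a random translate of [t]. It is carried by a single orbit, yet
    by [act_law] each coordinate has law [mu], which makes it regular. *)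
Definition edge_functional (t : p.+1.-tuple V) F :=
  \int[P]_o F (map_tuple (act o) t).

Lemma regular_full : regular_functional mu full_functional.
Proof.
rewrite (_ : full_functional =
  fun F => \int[power_measure mu p.+1]_t (F (id t) * 1)); last first.
  by apply/funext => F; apply: eq_Rintegral => t _; rewrite mulr1.
apply: regular_functional_pushforward; first exact: measurable_id.
  exact: bounded_measurable_cst.
by move=> i N mN N0; have [_ ->] := power_measure_marginal mu i mN.
Qed.

Lemma regular_diag : regular_functional mu diag_functional.
Proof.
rewrite (_ : diag_functional =
  fun F => \int[mu]_v (F [tuple v | _ < p.+1] * 1)); last first.
  by apply/funext => F; apply: eq_Rintegral => t _; rewrite mulr1.
apply: regular_functional_pushforward; first exact: measurable_diag.
  exact: bounded_measurable_cst.
move=> i N mN N0; rewrite (_ : [set o | _] = N)//.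
by apply/seteqP; split=> x /=; rewrite tnth_mktuple.
Qed.

Lemma regular_edge t : regular_functional mu (edge_functional t).
Proof.
rewrite (_ : edge_functional t =
  fun F => \int[P]_o (F (map_tuple (act o) t) * 1)); last first.
  by apply/funext => F; apply: eq_Rintegral => o _; rewrite mulr1.
apply: regular_functional_pushforward; first exact: measurable_act_tuple.
  exact: bounded_measurable_cst.
move=> i N mN N0; rewrite -N0 -(act_law (tnth t i) mN); congr (P _).
by apply/seteqP; split=> x /=; rewrite tnth_map.
Qed.

Lemma regular_pair n (q : V -> 'I_n) : (forall i, measurable (q @^-1` [set i])) ->
  regular_functional mu (pair_functional q).
Proof.
move=> mq; apply: regular_functional_pushforward.
- exact: measurable_pair_tuple.
- exact: bounded_measurable_cell_kernel.
move=> i N mN N0; have [i0|i0] := eqVneq i ord0.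
  rewrite (_ : [set o | _] = [set: V] `*` N).
    by apply: (etrans (product_measure1E mu mu measurableT mN));
      rewrite /= [X in (_ * X)%E]N0 mule0.
  apply/seteqP; split=> [x|x []] /=; rewrite tnth_mktuple i0 eqxx//.
rewrite (_ : [set o | _] = N `*` [set: V]).
  by apply: (etrans (product_measure1E mu mu mN measurableT));
      rewrite /= [X in (X * _)%E]N0 mul0e.
by apply/seteqP; split=> [x|x []] /=; rewrite tnth_mktuple (negPf i0).
Qed.

Lemma full_tensor (f : V -> R) : bounded_measurable f ->
  full_functional (tensor f) = (\int[mu]_x f x) ^+ p.+1.
Proof. exact: Rintegral_tensor. Qed.

Lemma diag_tensor (f : V -> R) :
  diag_functional (tensor f) = \int[mu]_x f x ^+ p.+1.
Proof. by apply: eq_Rintegral => x _; rewrite tensor_diag. Qed.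

Lemma pair_functionalE n (q : V -> 'I_n) F :
  (forall i, measurable (q @^-1` [set i])) -> bounded_measurable F ->
  pair_functional q F =
  \int[mu]_x \int[mu]_y (F (pair_tuple (x, y)) * cell_kernel mu q (x, y)).
Proof.
move=> mq bF; have b : bounded_measurable
    (fun xy => F (pair_tuple xy) * cell_kernel mu q xy).
  apply: bounded_measurableM; last exact: bounded_measurable_cell_kernel.
  exact: (bounded_measurable_comp bF measurable_pair_tuple).
rewrite (Rintegral12 (bounded_measurable_integrable2 mu mu b))// => x.
by apply: bounded_measurable_integrable; exact: (bounded_measurable_pair1 x b).
Qed.

Lemma pair_tensor n (q : V -> 'I_n) (f : V -> R) :
  (forall i, measurable (q @^-1` [set i])) -> bounded_measurable f ->
  pair_functional q (tensor f) = \int[mu]_x (f x ^+ p * cell_avg mu q f x).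
Proof.
move=> mq bf; rewrite pair_functionalE//; last exact: bounded_measurable_tensor.
apply: eq_Rintegral => x _.
under eq_Rintegral do rewrite tensor_pair -mulrA.
rewrite RintegralZl ?Rintegral_cell_kernel//.
apply: bounded_measurable_integrable; apply: bounded_measurableM => //.
exact: (bounded_measurable_pair1 x (bounded_measurable_cell_kernel mu mq)).
Qed.

(** The kernel charges only pairs x, y in one cell, for which the diagonal tuple of x and
    [pair_tuple (x, y)] have coordinates in the same cells; and its integral in y is 1 off null
    cells. *)
Lemma diag_sub_pair n (q : V -> 'I_n) F (delta : R) :
  (forall i, measurable (q @^-1` [set i])) -> bounded_measurable F ->
  (forall s t : p.+1.-tuple V, (forall i, q (tnth s i) = q (tnth t i)) ->
    `|F s - F t| <= delta) ->
  diag_functional F - pair_functional q F <= delta.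
Proof.
move=> mq bF Fq; rewrite pair_functionalE//.
pose D (x : V) := F [tuple x | _ < p.+1].
have bD : bounded_measurable D := bounded_measurable_comp bF measurable_diag.
have bK := bounded_measurable_cell_kernel mu mq.
have bKx x := bounded_measurable_pair1 x bK.
have bT : bounded_measurable (fun xy => F (pair_tuple xy) * cell_kernel mu q xy).
  apply: bounded_measurableM => //.
  exact: (bounded_measurable_comp bF measurable_pair_tuple).
have bDd : bounded_measurable (fun x => D x - delta).
  by apply: bounded_measurableB => //; exact: bounded_measurable_cst.
have ba := @bounded_measurable_cell_avg _ _ _ mu _ q mq (fun=> 1).
rewrite lerBlDr addrC -lerBlDr.
have -> : diag_functional F - delta = \int[mu]_x (D x - delta).
  rewrite (RintegralB measurableT (bounded_measurable_integrable mu bD)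
    (bounded_measurable_integrable mu (bounded_measurable_cst delta))).
  by rewrite Rintegral_const.
have [N [mN N0 Nq]] := cell_mass_neq0_ae mu mq.
(* Multiplies by the cell average of 1, which is almost everywhere 1, so that both sides become
   integrals over y against [cell_kernel]. *)
rewrite (@Rintegral_ae_eq _ _ _ mu _
    (fun x => (D x - delta) * cell_avg mu q (fun=> 1) x) N)//; last 3 first.
- by case: bDd.
- by case: (bounded_measurableM bDd ba).
- by move=> x Nx; rewrite cell_avg_cst ?mulr1//; exact: Nq.
apply: le_Rintegral => //.
- by apply: bounded_measurable_integrable; exact: bounded_measurableM.
- apply: bounded_measurable_integrable.
  exact: (bounded_measurable_Rintegral mu mu bT).
move=> x _; rewrite -(Rintegral_cell_kernel mu mq x (bounded_measurable_cst 1)).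
have b1K : bounded_measurable (fun y => 1 * cell_kernel mu q (x, y)).
  exact: bounded_measurableZ.
rewrite -RintegralZl//; last exact: bounded_measurable_integrable.
apply: le_Rintegral => //.
- by apply: bounded_measurable_integrable; exact: bounded_measurableZ.
- by apply: bounded_measurable_integrable; exact: (bounded_measurable_pair1 x bT).
move=> y _; rewrite mul1r; rewrite cell_kernelE indicE.
have [|_] := boolP (y \in _); last by rewrite !mulr0.
rewrite inE /= => yx; rewrite ler_wpM2r//.
  by rewrite mulr1 invr_ge0 cell_mass_ge0.
rewrite lerBlDr -lerBlDl (le_trans (ler_norm _))//; apply: Fq => i.
by rewrite !tnth_mktuple; case: eqP.
Qed.

Section density_step.
Variables (th : R) (N : nat -> nat) (q : forall m, V -> 'I_(N m)).
Arguments q : clear implicits.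
Hypothesis th_gt0 : 0 < th.
Hypothesis th_lt : th < full_functional A.
Hypothesis mq : forall m i, measurable (q m @^-1` [set i]).
Hypothesis qA : forall m (s t : p.+1.-tuple V),
  (forall i, q m (tnth s i) = q m (tnth t i)) ->
  `|A s - A t| <= (full_functional A - th) / ((2 ^+ m) ^+ p.+1 * 2 ^+ m.+2).

(* [penalized n (tensor f) > 0] forces (\int f)^k > th \int f^k, a small
   oscillation of f on the first n partitions and small return integrals on the
   first n edges; the weights K make the oscillations summable in L^1, and qA
   makes the total penalty of A smaller than the gap. *)
Let gap := full_functional A - th.
Let K m : R := (2 ^+ m) ^+ p.+1.
Let osc m F := K m * (diag_functional F + -1 * pair_functional (q m) F).
Let penalized n F := full_functional F + (- th) * diag_functional F +
  -1 * (\sum_(m < n) osc m F) + (- 2 ^+ n) * (\sum_(j < n) edge_functional (e j) F).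

Let regular_penalized n : regular_functional mu (penalized n).
Proof.
apply: regular_functionalD; first apply: regular_functionalD.
- apply: regular_functionalD; first exact: regular_full.
  by apply: regular_functionalZ; exact: regular_diag.
- apply: regular_functionalZ; apply: (@regular_functional_sum _ _ _ mu p.+1 n osc) => m.
  apply: regular_functionalZ; apply: regular_functionalD; first exact: regular_diag.
  by apply: regular_functionalZ; apply: regular_pair; exact: mq.
- apply: regular_functionalZ.
  apply: (@regular_functional_sum _ _ _ mu p.+1 n (fun j => edge_functional (e j))) => j.
  exact: regular_edge.
Qed.

Let K_gt0 m : 0 < K m. Proof. by rewrite /K !exprn_gt0. Qed.

Let penalized_gt0 n : 0 < penalized n A.
Proof.
have bA : bounded_measurable A by case: cpA => _; exact: continuous_bounded_measurable.
have gap0 : 0 < gap by rewrite subr_gt0.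
have h2 m : 0 < 2 ^+ m :> R by rewrite exprn_gt0.
have oscA m : osc m A <= gap / 2 ^+ m.+2.
  rewrite /osc mulN1r -ler_pdivlMl//.
  have h := diag_sub_pair (@mq m) bA (@qA m).
  apply: (le_trans h).
  by rewrite invfM mulrCA mulrA.
(* The right-hand side is the sum of the [gap / 2 ^+ m.+2]. It stays below [gap], so [penalized n A]
   is positive: A is 0 in the edge terms and has diagonal integral 1. *)
have S : \sum_(m < n) osc m A <= gap * (2^-1 - (2 ^+ n.+1)^-1).
  elim: n => [|n IH]; first by rewrite big_ord0 expr1 subrr mulr0.
  rewrite big_ord_recr/= (le_trans (lerD IH (oscA n)))//.
  rewrite -mulrDr ler_pM2l// -addrA lerD2l.
  rewrite [2 ^+ n.+2]exprS invfM.
  set x := (2 ^+ n.+1)^-1; have -> : - x + 2^-1 * x = - (2^-1 * x) by lra.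
  by [].
have E0 : \sum_(j < n) edge_functional (e j) A = 0.
  apply: big1 => j _; rewrite /edge_functional.
  under eq_Rintegral do rewrite A_edge.
  by rewrite Rintegral_const.
rewrite /penalized E0 mulr0 addr0 mulN1r.
have -> : diag_functional A = 1 by [].
rewrite mulr1 -/gap subr_gt0 (le_lt_trans S)// gtr_pMr//.
by have := h2 n.+1; rewrite -invr_gt0; lra.
Qed.

(** On the tensor of a nonnegative f every penalty is nonnegative (by [cell_oscillation] for the
    oscillations), so positivity of [penalized] bounds each one separately by the full integral. All
    terms are homogeneous of degree p+1 in f, which permits the normalization to integral 1. *)
Lemma approximate_density n : exists f : V -> R,
  [/\ bounded_measurable f /\ (forall x, 0 <= f x),
      \int[mu]_x f x = 1,
      \int[mu]_x (f x ^+ p.+1) <= th^-1,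
      forall m, (m < n)%N ->
        \int[mu]_x `|f x - cell_avg mu (q m) f x| <= 2 * (2 ^+ m)^-1
    & forall j, (j < n)%N -> edge_functional (e j) (tensor f) <= (2 ^+ n)^-1].
Proof.
have rL := regular_penalized n.
have [f0 [bf0 f00 Lf0]] := CP_regular_functional cV rL cpA (penalized_gt0 n).
have posE j f : bounded_measurable f -> (forall x, 0 <= f x) ->
    0 <= edge_functional (e j) (tensor f).
  by move=> _ f0'; apply: Rintegral_ge0 => o _; exact: tensor_ge0.
have posD f : (forall x, 0 <= f x) -> 0 <= diag_functional (tensor f).
  by move=> f0'; apply: Rintegral_ge0 => o _; exact: tensor_ge0.
have posO m f : bounded_measurable f -> (forall x, 0 <= f x) ->
    0 <= osc m (tensor f).
  move=> bf f0'; rewrite /osc mulr_ge0 ?(ltW (K_gt0 m))//.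
  rewrite mulN1r diag_tensor (pair_tensor (@mq m) bf).
  apply: (le_trans _ (cell_oscillation mu (@mq m) p_gt0 bf f0')).
  by apply: Rintegral_ge0 => x _; exact: exprn_ge0.
have fullpos f : bounded_measurable f -> (forall x, 0 <= f x) ->
    0 < penalized n (tensor f) ->
    [/\ th * diag_functional (tensor f) < full_functional (tensor f),
      forall m, (m < n)%N -> osc m (tensor f) < full_functional (tensor f) &
      forall j, (j < n)%N -> 2 ^+ n * edge_functional (e j) (tensor f) <
         full_functional (tensor f)].
  move=> bf f0'; rewrite /penalized.
  have hD := mulr_ge0 (ltW th_gt0) (posD f f0').
  have hO : 0 <= \sum_(m < n) osc m (tensor f) by apply: sumr_ge0 => m _; exact: posO.
  have hE' : 0 <= \sum_(j < n) edge_functional (e j) (tensor f).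
    by apply: sumr_ge0 => m _; exact: posE.
  have h2 : 0 <= 2 ^+ n :> R by rewrite exprn_ge0.
  have hE := mulr_ge0 h2 hE'.
  move=> L; split; first by lra.
    move=> m mn; have : osc m (tensor f) <= \sum_(m < n) osc m (tensor f).
      rewrite (bigD1 (Ordinal mn))//= lerDl.
      by apply: sumr_ge0 => i _; exact: posO.
    by lra.
  move=> j jn.
  have : 2 ^+ n * edge_functional (e j) (tensor f) <=
      2 ^+ n * \sum_(j < n) edge_functional (e j) (tensor f).
    rewrite ler_wpM2l// (bigD1 (Ordinal jn))//= lerDl.
    by apply: sumr_ge0 => i _; exact: posE.
  by lra.
have [hD _ _] := fullpos _ bf0 f00 Lf0.
have I0 : 0 < \int[mu]_x f0 x.
  have I0 : 0 <= \int[mu]_x f0 x by apply: Rintegral_ge0.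
  rewrite lt_neqAle I0 andbT eq_sym; apply/eqP => I00.
  move: hD; rewrite full_tensor// I00 expr0n/= ltNge => /negP; apply.
  by rewrite mulr_ge0 ?(ltW th_gt0)//; exact: posD.
set c := (\int[mu]_x f0 x)^-1; have c0 : 0 < c by rewrite invr_gt0.
pose f x := c * f0 x.
have bf : bounded_measurable f by exact: bounded_measurableZ.
have f_ge0 x : 0 <= f x by rewrite mulr_ge0// ltW.
have If : \int[mu]_x f x = 1.
  rewrite RintegralZl//; last exact: bounded_measurable_integrable.
  by rewrite mulVf// gt_eqF.
have Lf : 0 < penalized n (tensor f).
  have [_ LZ _] := rL.
  rewrite (_ : tensor f = fun t => c ^+ p.+1 * tensor f0 t).
    by rewrite LZ ?mulr_gt0 ?exprn_gt0//; exact: bounded_measurable_tensor.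
  by apply/funext => t; rewrite -tensorZ.
have [] := fullpos _ bf f_ge0 Lf.
rewrite full_tensor// If expr1n => hD1 hO hE.
exists f; split=> //.
- by rewrite -diag_tensor -[leRHS]mul1r ler_pdivlMr// mulrC ltW.
(* After normalization [osc m (tensor f) < 1], and [K m] is the inverse of [((2 ^+ m)^-1) ^+ p.+1],
   the threshold in [cell_avg_dist]. *)
- move=> m mn; apply: (@cell_avg_dist _ _ _ mu _ (q m) (@mq m) f p (2 ^+ m)^-1) => //.
  have := hO m mn; rewrite /osc mulN1r diag_tensor (pair_tensor (@mq m) bf).
  by rewrite exprVn -[leRHS]mul1r ler_pdivlMr// mulrC => /ltW.
- move=> j jn; rewrite -[leRHS]mul1r ler_pdivlMr ?exprn_gt0// mulrC ltW//.
  exact: hE.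
Qed.

End density_step.

End approximate_densities.

(** * Compactness of the densities and support of a limit *)

Lemma fmap_ultra (T T' : choiceType) (F : set_system T) (f : T -> T') :
  UltraFilter F -> UltraFilter (f @ F).
Proof.
move=> UF; split; first exact: fmap_proper_filter.
move=> G PG sG; apply/seteqP; split=> // A GA.
have [//|FA] := in_ultra_setVsetC (f @^-1` A) UF.
have : G (~` A) by exact: (sG (~` A) FA).
move=> GCA; have : G (A `&` ~` A) by exact: filterI.
by rewrite setICr => /(@filter_not_empty _ G PG).
Qed.

Section extraction.
Context {R : realType} {d : measure_display} {V : borelType d}.
Variables (mu : probability V R) (N : nat -> nat) (q : forall m, V -> 'I_(N m)).
Arguments q : clear implicits.
Hypothesis mq : forall m i, measurable (q m @^-1` [set i]).
Variable f : nat -> V -> R.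
Hypothesis bf : forall n, bounded_measurable (f n).
Hypothesis f_ge0 : forall n x, 0 <= f n x.
Hypothesis f_int : forall n, \int[mu]_x f n x = 1.
Hypothesis f_avg : forall n m, (m < n)%N ->
  \int[mu]_x `|f n x - cell_avg mu (q m) (f n) x| <= 2 * (2 ^+ m)^-1.

(** Integral 1 confines each mean to a segment independent of [n], so that limits along an
    ultrafilter exist. On a null cell the segment reduces to 0, since [0^-1 = 0]. *)
Lemma cell_mean_bound m i n :
  0 <= cell_mean mu (q m) (f n) i <= (cell_mass mu (q m) i)^-1.
Proof.
apply/andP; split.
  apply: cell_mean_ge0 => //; first exact: bounded_measurable_integrable.
  exact: aeW.
rewrite /cell_mean ler_piMr ?invr_ge0 ?cell_mass_ge0// -(f_int n).
have bI := bounded_measurable_indic (R := R) (@mq m i).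
apply: le_Rintegral => //.
- by apply: bounded_measurable_integrable; exact: bounded_measurableM.
- exact: bounded_measurable_integrable.
- move=> x _; rewrite indicE; case: (x \in _); rewrite ?mulr1// mulr0.
  exact: f_ge0.
Qed.

(* Along an ultrafilter all the (bounded) cell means converge. *)
Lemma fast_subsequence : exists g : nat -> nat, forall m, (m < g m)%N /\
  \int[mu]_x `|f (g m) x - f (g m.+1) x| <= 4 * (2 ^+ m)^-1.
Proof.
have [U [UU ooU]] := ultraFilterLemma (@eventually_filter).
have PU : ProperFilter U by exact: ultra_proper.
have /choice[F FP] : forall mi : {m : nat & 'I_(N m)}, exists r : R,
    cell_mean mu (q (projT1 mi)) (f n) (projT2 mi) @[n --> U] --> r.
  move=> [m i] /=.
  have := @segment_compact R 0 (cell_mass mu (q m) i)^-1.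
  rewrite compact_ultra => /(_ _ (fmap_ultra _ UU)) => H.
  have [|r [_ rP]] := H (fun n => cell_mean mu (q m) (f n) i); last by exists r.
  by apply: nearW => n /=; rewrite in_itv; exact: cell_mean_bound.
(* Consecutive densities are compared at the common level [m.+1]: [f (g m)] through the last clause
   of [G m], [f (g m.+1)] through the middle clause of [G m.+1]. *)
pose G m n := [/\ (m.+1 < n)%N,
  forall i, `|F (existT _ m i) - cell_mean mu (q m) (f n) i| <= (2 ^+ m)^-1 &
  forall i, `|F (existT _ m.+1 i) - cell_mean mu (q m.+1) (f n) i| <= (2 ^+ m)^-1].
have /choice[g gP] : forall m, exists n, G m n.
  move=> m; suff : \forall n \near U, G m n by move=> /filter_ex.
  have e0 : 0 < (2 ^+ m)^-1 :> R by rewrite invr_gt0 exprn_gt0.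
  near=> n; split.
  - by near: n; apply: ooU; exact: nbhs_infty_gt.
  - near: n; apply: filter_forall => i.
    by have /cvgrPdist_le := FP (existT _ m i); apply.
  - near: n; apply: filter_forall => i.
    by have /cvgrPdist_le := FP (existT _ m.+1 i); apply.
exists g => m; have [gm _ gm2] := gP m; have [gm3 gm4 _] := gP m.+1.
split; first exact: ltnW.
pose E n x := cell_avg mu (q m.+1) (f n) x.
pose Fq x := F (existT _ m.+1 (q m.+1 x)).
have bE n : bounded_measurable (E n).
  by apply: bounded_measurable_cell_avg; exact: mq.
have bF : bounded_measurable Fq.
  exact: (@bounded_measurable_cell _ _ _ _ (q m.+1) (@mq m.+1) (fun i => F (existT _ m.+1 i))).
pose a x := `|f (g m) x - E (g m) x| + `|f (g m.+1) x - E (g m.+1) x|.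
pose b : R := (2 ^+ m)^-1 + (2 ^+ m.+1)^-1.
have bn1 := bounded_measurable_norm (bounded_measurableB (bf (g m)) (bE (g m))).
have bn2 := bounded_measurable_norm (bounded_measurableB (bf (g m.+1)) (bE (g m.+1))).
have ba : bounded_measurable a by exact: bounded_measurableD.
apply: (@le_trans _ _ (\int[mu]_x (a x + b))).
  apply: le_Rintegral => //.
  - apply: bounded_measurable_integrable; apply: bounded_measurable_norm.
    exact: bounded_measurableB.
  - apply: bounded_measurable_integrable; apply: bounded_measurableD => //.
    exact: bounded_measurable_cst.
  move=> x _; rewrite /a /b.
  have := gm2 (q m.+1 x); have := gm4 (q m.+1 x).
  rewrite -/(cell_avg mu (q m.+1) (f (g m)) x) -/(E (g m) x).
  rewrite -/(cell_avg mu (q m.+1) (f (g m.+1)) x) -/(E (g m.+1) x).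
  rewrite !ler_norml -/(Fq x) => /andP[h1 h2] /andP[h3 h4].
  have [h5 h6] : f (g m) x - E (g m) x <= `|f (g m) x - E (g m) x| /\
      - `|f (g m) x - E (g m) x| <= f (g m) x - E (g m) x.
    by rewrite ler_norm lerNl -normrN ler_norm.
  have [h7 h8] : f (g m.+1) x - E (g m.+1) x <= `|f (g m.+1) x - E (g m.+1) x| /\
      - `|f (g m.+1) x - E (g m.+1) x| <= f (g m.+1) x - E (g m.+1) x.
    by rewrite ler_norm lerNl -normrN ler_norm.
  by apply/andP; split; lra.
rewrite (RintegralD measurableT (bounded_measurable_integrable mu ba)
  (bounded_measurable_integrable mu (bounded_measurable_cst b))) Rintegral_const.
rewrite (RintegralD measurableT (bounded_measurable_integrable mu bn1)
  (bounded_measurable_integrable mu bn2)).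
(* Each distance to the cell average at level [m.+1] is at most [1 / 2 ^+ m], and [b] is 3/2 of
   that; the total 7/2 is below 4. *)
have := f_avg gm; have := f_avg (ltnW gm3).
rewrite /b exprS invfM; set y := (2 ^+ m)^-1.
have : 0 <= y by rewrite invr_ge0 exprn_ge0.
rewrite -/(E (g m)) -/(E (g m.+1)).
lra.
Unshelve. all: by end_near. Qed.

End extraction.

(** Homogeneous form of Bernoulli's inequality. Multiplying the tangent bound by [x] leaves the
    defect [p.+1%:R * a ^+ p * (x - a) ^+ 2] over the next tangent. *)
Lemma le_expr_tangent (R : realFieldType) (x a : R) p : 0 <= x -> 0 <= a ->
  a ^+ p.+1 + p.+1%:R * a ^+ p * (x - a) <= x ^+ p.+1.
Proof.
move=> x0 a0; elim: p => [|p IH]; first by rewrite !expr1 expr0 !mul1r addrC subrK.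
rewrite [leRHS]exprS (le_trans _ (ler_wpM2l x0 IH))// -subr_ge0.
have -> : x * (a ^+ p.+1 + p.+1%:R * a ^+ p * (x - a)) -
    (a ^+ p.+2 + p.+2%:R * a ^+ p.+1 * (x - a)) =
    p.+1%:R * a ^+ p * (x - a) ^+ 2.
  have -> : p.+2%:R = p.+1%:R + 1 :> R by rewrite -natr1.
  by rewrite !exprS; ring.
by rewrite mulr_ge0 ?sqr_ge0// mulr_ge0 ?exprn_ge0.
Qed.

(** Hoelder's inequality for [f] times the indicator of [S], proved as Jensen's: the tangent of the
    power at the mean of [f] on [S] is integrated over [S]. A null [S] is treated apart. *)
Lemma Rintegral_expr_indic (R : realType) d (T : measurableType d)
    (P : probability T R) (f : T -> R) (S : set T) p : (0 < p)%N ->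
  bounded_measurable f -> (forall x, 0 <= f x) -> measurable S ->
  (\int[P]_x (f x * \1_S x)) ^+ p.+1 <=
  fine (P S) ^+ p * \int[P]_x (f x ^+ p.+1).
Proof.
move=> p0 bf f0 mS; have bI := bounded_measurable_indic (R := R) mS.
have bfI := bounded_measurableM bf bI; have bfp := bounded_measurable_exp p.+1 bf.
set s := fine (P S); set J := \int[P]_x (f x * \1_S x).
have s0 : 0 <= s by exact: fine_ge0.
have J0 : 0 <= J by apply: Rintegral_ge0 => x _; rewrite mulr_ge0// indicE; case: (_ \in _).
have [sz|sn] := eqVneq s 0.
  rewrite sz expr0n/= gtn_eqF// mul0r.
  have -> : J = 0.
    rewrite -[RHS](Rintegral_const P 0).
    apply: (@Rintegral_ae_eq _ _ _ P _ _ S) => //; first by case: bfI.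
    - by rewrite -[LHS]fineK ?fin_num_measure//; congr EFin.
    - by move=> x Sx; rewrite indicE memNset ?mulr0.
  by rewrite expr0n.
have sp : 0 < s by rewrite lt_neqAle eq_sym sn.
pose a := J / s; have a0 : 0 <= a by rewrite divr_ge0.
have aJ : a * s = J by rewrite divfK.
clearbody a.
have b1 : bounded_measurable (fun x => (p.+1%:R * a ^+ p) * (f x * \1_S x)).
  exact: bounded_measurableZ.
have b2 : bounded_measurable (fun x => (a ^+ p.+1 - p.+1%:R * a ^+ p * a) * \1_S x).
  exact: bounded_measurableZ.
have : \int[P]_x (p.+1%:R * a ^+ p * (f x * \1_S x) +
    (a ^+ p.+1 - p.+1%:R * a ^+ p * a) * \1_S x) <= \int[P]_x (f x ^+ p.+1).
  apply: le_Rintegral => //.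
  - by apply: bounded_measurable_integrable; exact: bounded_measurableD.
  - exact: bounded_measurable_integrable.
  move=> x _; rewrite indicE; case: (x \in S).
    by have := le_expr_tangent p (f0 x) a0; rewrite !mulr1; lra.
  by rewrite !mulr0 addr0 exprn_ge0.
rewrite (RintegralD measurableT (bounded_measurable_integrable P b1)
  (bounded_measurable_integrable P b2)).
rewrite (RintegralZl _ measurableT (bounded_measurable_integrable P bfI)).
rewrite (RintegralZl _ measurableT (bounded_measurable_integrable P bI)).
rewrite Rintegral_indic// -/s -/J.
have -> : p.+1%:R * a ^+ p * J + (a ^+ p.+1 - p.+1%:R * a ^+ p * a) * s = a ^+ p.+1 * s.
  by rewrite -aJ; ring.
move=> /(ler_wpM2l (exprn_ge0 p s0)); apply: le_trans.
have -> : s ^+ p * (a ^+ p.+1 * s) = (a * s) ^+ p.+1 by rewrite exprMn [s ^+ p.+1]exprSr mulrCA.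
by rewrite aJ.
Qed.

Section support.
Context {R : realType} {dV dO : measure_display}.
Context {V : borelType dV} {O : measurableType dO}.
Variables (mu : probability V R) (P : probability O R) (act : O -> V -> V).
Variables (p : nat) (e : nat -> p.+1.-tuple V) (A : p.+1.-tuple V -> R).
Hypothesis p_gt0 : (0 < p)%N.
Hypothesis cV : compact [set: V].
Hypothesis mact : forall v, measurable_fun setT (fun o => act o v).
Hypothesis act_law : forall v (N : set V), measurable N ->
  P [set o | N (act o v)] = mu N.
Hypothesis cpA : CPc mu p.+1 A.
Hypothesis A_diag : \int[mu]_v A [tuple v | _ < p.+1] = 1.
Hypothesis A_edge : forall o j, A (map_tuple (act o) (e j)) = 0.

(* The set S is where the M-th density, minus the total variation of the later
   ones, is at least 2^-M: all later densities are then at least 2^-M on S, so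
   their return integrals, which tend to 0, bound those of S. *)
Lemma support_of_CP (th : R) M : 0 < th ->
  th < \int[power_measure mu p.+1]_t A t -> 9 * (2 ^+ M)^-1 <= 1 :> R ->
  exists S : set V, [/\ measurable S,
    th * (1 - 9 * (2 ^+ M)^-1) ^+ p.+1 <= fine (mu S) ^+ p &
    forall j, P [set o | forall i, S (act o (tnth (e j) i))] = 0%E].
Proof.
move=> th0 thA M9.
have gap0 : 0 < \int[power_measure mu p.+1]_t A t - th by rewrite subr_gt0.
have cA : continuous A by case: cpA.
have h2 m : 0 < (2 ^+ m)^-1 :> R by rewrite invr_gt0 exprn_gt0.
have /choice[N NP] : forall m, exists n, exists q : V -> 'I_n,
    (forall i, measurable (q @^-1` [set i])) /\
    forall s t : p.+1.-tuple V, (forall i, q (tnth s i) = q (tnth t i)) ->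
    `|A s - A t| <= (full_functional mu A - th) / ((2 ^+ m) ^+ p.+1 * 2 ^+ m.+2).
  by move=> m; apply: continuous_partition => //; rewrite divr_gt0//.
pose q m := sval (cid (NP m)).
have mq m : forall i, measurable (q m @^-1` [set i]).
  by rewrite /q; case: cid => x [].
have qA m : forall s t : p.+1.-tuple V, (forall i, q m (tnth s i) = q m (tnth t i)) ->
    `|A s - A t| <= (full_functional mu A - th) / ((2 ^+ m) ^+ p.+1 * 2 ^+ m.+2).
  by rewrite /q; case: cid => x [].
have /choice[f fP] := approximate_density p_gt0 cV mact act_law cpA A_diag A_edge
  th0 thA mq qA.
have bf n : bounded_measurable (f n) by have [[]] := fP n.
have f0 n x : 0 <= f n x by have [[_]] := fP n.
have f1 n : \int[mu]_x f n x = 1 by have [] := fP n.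
have fp n : \int[mu]_x (f n x ^+ p.+1) <= th^-1 by have [] := fP n.
have [g gP] := fast_subsequence mq bf f0 f1 (fun n => let: And5 _ _ _ h _ := fP n in h).
pose D j x := `|f (g (M + j)%N) x - f (g (M + j).+1) x|.
have bD j : bounded_measurable (D j).
  by apply: bounded_measurable_norm; exact: bounded_measurableB.
pose T n x := \sum_(j < n) D j x + (2 ^+ M)^-1.
have bT n : bounded_measurable (T n).
  apply: bounded_measurableD; last exact: bounded_measurable_cst.
  by apply: (@bounded_measurable_sum _ _ _ _ _ _ (fun j : 'I_n => D j)).
pose S_ n := [set x | T n x <= f (g M) x].
have mS_ n : measurable (S_ n).
  rewrite -[X in measurable X]setTI; apply: measurable_fun_le => //.
    by case: (bT n).
  by case: (bf (g M)).
(* 9 = 8 + 1: the bounds [4 / 2 ^+ (M + j)] from [fast_subsequence] sum to at most [8 / 2 ^+ M], and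
   the constant in [T] adds [1 / 2 ^+ M]. *)
have T_int n : \int[mu]_x T n x <= 9 * (2 ^+ M)^-1.
  have -> : \int[mu]_x T n x = \sum_(j < n) \int[mu]_x D j x + (2 ^+ M)^-1.
    rewrite (RintegralD measurableT); last 2 first.
    - apply: bounded_measurable_integrable.
      by apply: (@bounded_measurable_sum _ _ _ _ _ _ (fun j : 'I_n => D j)).
    - by apply: bounded_measurable_integrable; exact: bounded_measurable_cst.
    rewrite Rintegral_const (@Rintegral_sum _ _ _ mu _ _ (fun j : 'I_n => D j))// => j.
    exact: bounded_measurable_integrable.
  have : \sum_(j < n) \int[mu]_x D j x <= 8 * (2 ^+ M)^-1 - 8 * (2 ^+ (M + n))^-1.
    elim: n => [|n IH]; first by rewrite big_ord0 addn0 subrr.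
    rewrite big_ord_recr/= (le_trans (lerD IH (gP (M + n)%N).2))//.
    by rewrite addnS exprS invfM; have := h2 (M + n)%N; lra.
  by have := h2 (M + n)%N; lra.
(* Off [S_ n] the density is below [T n], so at least [1 - 9 / 2 ^+ M] of its mass sits on [S_ n];
   [Rintegral_expr_indic] with the bound [fp] converts this into measure. *)
have S_mass n : th * (1 - 9 * (2 ^+ M)^-1) ^+ p.+1 <= fine (mu (S_ n)) ^+ p.
  have bI := bounded_measurable_indic (R := R) (mS_ n).
  have bfI := bounded_measurableM (bf (g M)) bI.
  have : 1 - 9 * (2 ^+ M)^-1 <= \int[mu]_x (f (g M) x * \1_(S_ n) x).
    rewrite lerBlDr -[leLHS](f1 (g M)).
    rewrite (le_trans _ (lerD (lexx _) (T_int n)))//.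
    rewrite -(RintegralD measurableT (bounded_measurable_integrable mu bfI)
      (bounded_measurable_integrable mu (bT n))).
    apply: le_Rintegral => //; try exact: bounded_measurable_integrable.
      by apply: bounded_measurable_integrable; exact: bounded_measurableD.
    have T0 x : 0 <= T n x.
      by apply: addr_ge0; [apply: sumr_ge0 => j _; exact: normr_ge0|exact: ltW].
    move=> x _; rewrite indicE; have [|] := boolP (x \in S_ n).
      by rewrite mulr1 lerDl.
    by rewrite notin_setE /S_ /= mulr0 add0r => /negP; rewrite -ltNge => /ltW.
  have y0 : 0 <= 1 - 9 * (2 ^+ M)^-1 :> R by rewrite subr_ge0.
  move=> yI; rewrite mulrC -ler_pdivlMr//.
  have := @lerXn2r _ p.+1 _ _ y0 (le_trans y0 yI) yI => /le_trans; apply.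
  rewrite (le_trans (Rintegral_expr_indic mu p_gt0 (bf _) (f0 _) (mS_ n)))//.
  by rewrite ler_wpM2l// exprn_ge0// fine_ge0.
pose S := \bigcap_n S_ n.
have mS : measurable S by exact: bigcapT_measurable.
exists S; split=> //.
  have niS : nonincreasing_seq S_.
    apply/nonincreasing_seqP => n; apply/subsetPset => x; rewrite /S_ /= /T.
    rewrite big_ord_recr/=; apply: le_trans; rewrite lerD2r lerDl.
    exact: normr_ge0.
  have cv : mu (S_ n) @[n --> \oo] --> mu S.
    by apply: nonincreasing_cvg_mu => //; rewrite ltey_eq fin_num_measure.
  have cvf : fine (mu (S_ n)) @[n --> \oo] --> fine (mu S).
    by apply: fine_cvg; rewrite fineK ?fin_num_measure.
  have cvp : fine (mu (S_ n)) ^+ p @[n --> \oo] --> fine (mu S) ^+ p.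
    exact: (cvg_comp _ _ cvf (@exprn_continuous R p (fine (mu S)))).
  rewrite -(cvg_lim _ cvp)//; apply: limr_ge; first exact: cvgP cvp.
  by apply: nearW => n; exact: S_mass.
have S_low n x : S x -> (2 ^+ M)^-1 <= f (g (M + n)%N) x.
  move=> /(_ n I); rewrite /S_ /= /T => TS.
  have : f (g M) x <= f (g (M + n)%N) x + \sum_(j < n) D j x.
    elim: n {TS} => [|n IH]; first by rewrite big_ord0 addn0 addr0.
    rewrite big_ord_recr/= addnS.
    have := ler_norm (f (g (M + n)%N) x - f (g (M + n).+1) x).
    by rewrite -/(D n x); lra.
  by lra.
move=> j; set B := [set o | _].
have mB : measurable B.
  have [mS' _] := @power_measure_box _ _ _ mu p.+1 (fun=> S) (fun=> mS).
  rewrite (_ : B = (fun o => map_tuple (act o) (e j)) @^-1`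
      [set t : p.+1.-tuple V | forall i, S (tnth t i)]).
    by rewrite -[X in measurable X]setTI; exact: measurable_act_tuple.
  by apply/seteqP; split=> o h i; have := h i; rewrite tnth_map.
rewrite -[LHS]fineK ?fin_num_measure//; congr EFin.
apply/eqP; rewrite eq_le fine_ge0// andbT leNgt; apply/negP => B0.
(* A lower bound on S^k for the tensor power of every later density: [r * P B] is at most the return
   integral of [f (g n)], itself at most [1 / 2 ^+ n] because [n < g n]. *)
pose r := ((2 ^+ M)^-1) ^+ p.+1 : R.
have r0 : 0 < r by rewrite exprn_gt0.
have bound n : (j < n)%N -> (M <= n)%N -> r * fine (P B) <= (2 ^+ n)^-1.
  move=> jn Mn; have [gn _] := gP n.
  have [_ _ _ _ /(_ j (ltn_trans jn gn)) h] := fP (g n).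
  apply: (@le_trans _ _ (2 ^+ g n)^-1); last first.
    rewrite lef_pV2 ?posrE ?exprn_gt0//; apply: ler_weXn2l; last exact: ltnW.
    by rewrite ler1n.
  apply: le_trans h; rewrite -Rintegral_indic// -RintegralZl//; last first.
    by apply: bounded_measurable_integrable; exact: bounded_measurable_indic.
  apply: le_Rintegral => //.
  - apply: bounded_measurable_integrable; apply: bounded_measurableZ.
    exact: bounded_measurable_indic.
  - apply: bounded_measurable_integrable.
    apply: (bounded_measurable_comp (bounded_measurable_tensor p.+1 (bf (g n)))).
    exact: measurable_act_tuple.
  move=> o _; rewrite indicE; have [|_] := boolP (o \in B); last first.
    by rewrite mulr0; exact: tensor_ge0.
  rewrite inE => Bo; rewrite mulr1 /r -[X in _ ^+ X](card_ord p.+1) -prodr_const.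
  apply: ler_prod => i _; rewrite ltW//= tnth_map -(subnKC Mn).
  exact: S_low.
have [n [h [jn Mn]]] : exists n, (2 ^+ n)^-1 < r * fine (P B) /\
    (j < n)%N /\ (M <= n)%N.
  have c0 : 0 < r * fine (P B) by rewrite mulr_gt0.
  suff : \forall n \near \oo, (2 ^+ n)^-1 < r * fine (P B) /\
    (j < n)%N /\ (M <= n)%N by move=> /filter_ex.
  near=> n; split; last by split; near: n; [exact: nbhs_infty_gt|exact: nbhs_infty_ge].
  near: n; have := near_infty_natSinv_expn_lt (PosNum c0) => /=.
  by apply: filterS => n; rewrite div1r.
by have := bound n jn Mn; rewrite leNgt h.
Unshelve. all: by end_near. Qed.

End support.

(** * Compact group actions *)

Definition countable_base (X : topologicalType) (B : nat -> set X) : Prop :=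
  (forall n, open (B n)) /\
  forall (x : X) U, nbhs x U -> exists n, B n x /\ B n `<=` U.

(** An open set is the union of the countably many basic rectangles that it contains; this
    reconciles the product sigma-algebra with the product topology. *)
Lemma measurable_open_prod (dX dY : measure_display) (X : borelType dX)
    (Y : borelType dY) (B : nat -> set X) (C : nat -> set Y) (U : set (X * Y)) :
  countable_base B -> countable_base C -> open U -> measurable U.
Proof.
move=> [oB nB] [oC nC] oU.
have -> : U = \bigcup_m \bigcup_n
    (if `[< B m `*` C n `<=` U >] then B m `*` C n else set0).
  apply/seteqP; split=> [[x y] Uxy|xy [m _ [n _]]]; last first.
    by case: asboolP => // + ?; apply.
  have [[U1 U2] [/= /nB[m [Bx BU]] /nC[n [Cy CU]]] UU] : nbhs (x, y) U.
    exact: open_nbhs_nbhs.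
  exists m => //; exists n => //; case: asboolP => //.
  by case=> -[a b] [/= ? ?]; apply: UU; split; [exact: BU|exact: CU].
apply: bigcupT_measurable => m; apply: bigcupT_measurable => n.
case: ifP => // _; apply: measurableX; exact: open_measurable_borel.
Qed.

Lemma continuous_measurable_prod (dX dY dZ : measure_display) (X : borelType dX)
    (Y : borelType dY) (Z : borelType dZ) (B : nat -> set X) (C : nat -> set Y)
    (f : X * Y -> Z) :
  countable_base B -> countable_base C -> continuous f ->
  measurable_fun setT f.
Proof.
move=> cB cC /continuousP cf.
apply: (measurability _ (measurable_borel (s := Z))).
move=> _ [A oA <-]; rewrite setTI; apply: (measurable_open_prod cB cC).
exact: cf.
Qed.

Section metrizable.
Context {R : realType} {X : topologicalType} (dist : X -> X -> R).
Hypothesis md : metrizes dist.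

Lemma open_metric_ball x r : open (metric_ball dist x r).
Proof.
have [[d0 d00 dC dT] nE] := md; rewrite openE => y xy.
rewrite /interior nE; exists (r - dist x y); first by rewrite /= subr_gt0.
move=> z yz; rewrite /metric_ball /= (le_lt_trans (dT _ y _))//.
by rewrite -ltrBrDl.
Qed.

Lemma metric_ball_self x r : 0 < r -> metric_ball dist x r x.
Proof. by have [[_ d00 _ _] _] := md; rewrite /metric_ball /= (d00 x x).2. Qed.

Lemma nbhs_metric_ball x r : 0 < r -> nbhs x (metric_ball dist x r).
Proof. by have [_ ->] := md; exists r. Qed.

(** Balls of radius 1/(m+1) about a finite net, for every m, coded by [pickle]. The centre is only
    near [x], whence the halving of the radius. *)
Lemma compact_metrizable_base (x0 : X) : compact [set: X] ->
  exists B : nat -> set X, countable_base B.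
Proof.
move=> cX; have [[d0 d00 dC dT] nE] := md.
have /choice[s sP] : forall m : nat, exists s : seq X, forall x,
    exists2 y, y \in s & metric_ball dist y m.+1%:R^-1 x.
  move=> m; have [|s sP] := compact_finite_cover
    (U := fun x => metric_ball dist x m.+1%:R^-1) cX.
    by move=> x _; exact: nbhs_metric_ball.
  by exists s => x; exact: sP.
pose b (mj : nat * nat) := metric_ball dist (nth x0 (s mj.1) mj.2) mj.1.+1%:R^-1.
exists (fun n => if unpickle n is Some mj then b mj else set0); split.
  move=> n; case: unpickle => [mj|]; last exact: open0.
  exact: open_metric_ball.
move=> x U; rewrite nE => -[r r0 rU].
have [m mr] : exists m : nat, m.+1%:R^-1 < r / 2.
  have r20 : 0 < r / 2 by rewrite divr_gt0.
  exact: (filter_ex (near_infty_natSinv_lt (PosNum r20))).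
have [y ys yx] := sP m x.
exists (pickle (m, index y (s m))); rewrite pickleK /b /= nth_index//; split=> // z yz.
apply: rU; rewrite /metric_ball /= (le_lt_trans (dT _ y _))// dC.
by rewrite (splitr r) ltrD// (lt_trans _ mr).
Qed.

End metrizable.

Section group_action.
Context {R : realType} {k : nat} {dG dV : measure_display}.
Context {G : borelGroupType dG} {V : borelType dV}.
Variables (H : homogeneous_hypergraph k G V) (nu : probability G R) (v0 : V).
Hypothesis cG : compact [set: G].
Hypothesis hV : hausdorff_space V.
Hypothesis haar : haar_probability nu.
Variable BG : nat -> set G.
Hypothesis baseG : countable_base BG.

Local Notation mu := (quotient_measure H v0 nu).
Local Notation a := (act H).

Lemma act_continuous_left v : continuous (fun g => a g v).
Proof.
move=> g; have ct : (fun h : G => (h, v)) @ g --> nbhs (g, v).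
  by apply: cvg_pair; [exact: cvg_id|exact: cvg_cst].
exact: (cvg_comp _ _ ct (@act_continuous _ _ _ _ _ H (g, v))).
Qed.

Lemma act_continuous_right g : continuous (a g).
Proof.
move=> v; have ct : (fun w : V => (g, w)) @ v --> nbhs (g, v).
  by apply: cvg_pair; [exact: cvg_cst|exact: cvg_id].
exact: (cvg_comp _ _ ct (@act_continuous _ _ _ _ _ H (g, v))).
Qed.

Lemma mulg_continuous_left (h : G) : continuous (fun g : G => (g * h)%g).
Proof.
move=> g; have ct : (fun x : G => (x, h)) @ g --> nbhs (g, h).
  by apply: cvg_pair; [exact: cvg_id|exact: cvg_cst].
exact: (cvg_comp _ _ ct (@mulg_continuous _ G (g, h))).
Qed.

Lemma mulg_continuous_right (h : G) : continuous (fun g : G => (h * g)%g).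
Proof.
move=> g; have ct : (fun x : G => (h, x)) @ g --> nbhs (h, g).
  by apply: cvg_pair; [exact: cvg_cst|exact: cvg_id].
exact: (cvg_comp _ _ ct (@mulg_continuous _ G (h, g))).
Qed.

Lemma compact_space : compact [set: V].
Proof.
have -> : [set: V] = (fun g => a g v0) @` [set: G].
  apply/seteqP; split=> // v _; have [g gv] := act_transitive H v0 v.
  by exists g.
apply: continuous_compact => //; apply: continuous_subspaceT.
exact: act_continuous_left.
Qed.

(** [K] is closed: if [g v = w v] with [w] in [W], then [x v = (x g^-1 w) v], and [x g^-1 w] stays
    in [W] for [x] near [g]. By compactness of G the image of [K], which is the complement of the
    image of [W], is closed. *)
Lemma open_orbit_map (v : V) (W : set G) : open W -> open [set a g v | g in W].
Proof.
move=> oW; pose K := [set g | ~ [set a g v | g in W] (a g v)].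
have cK : closed K.
  rewrite -[K]setCK; apply: open_closedC; rewrite openE => g /= /contrapT[w Ww wg].
  have cr := @mulg_continuous_left (g^-1 * w)%g.
  have gW : nbhs g [set x | W (x * (g^-1 * w))%g].
    by apply: cr; rewrite mulVKg; exact: open_nbhs_nbhs.
  rewrite /interior; apply: (@filterS _ (nbhs g) _ _ _ _ gW) => x Wx; apply.
  exists (x * (g^-1 * w))%g => //.
  by rewrite act_mul act_mul wg -(act_mul _ g^-1%g g) mulVg act_one.
have -> : [set a g v | g in W] = ~` [set a g v | g in K].
  apply/seteqP; split=> [_ [g Wg <-] [h Kh hg]|w Kw].
    by apply: Kh; rewrite /= hg; exists g.
  have [g gw] := act_transitive H v w.
  by apply: contrapT => nw; apply: Kw; exists g => //; rewrite /K /= gw.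
apply: closed_openC; apply: compact_closed => //.
apply: continuous_compact; first by apply: continuous_subspaceT; exact: act_continuous_left.
exact: (subclosed_compact cK cG).
Qed.

Lemma orbit_base : exists BV : nat -> set V, countable_base BV.
Proof.
have [oB nB] := baseG.
exists (fun n => [set a g v0 | g in BG n]); split.
  by move=> n; exact: open_orbit_map.
move=> v U vU; have [g gv] := act_transitive H v0 v.
have : nbhs g [set h | U (a h v0)].
  by apply: act_continuous_left; rewrite gv.
move=> /nB[n [Bg BU]]; exists n; split; first by exists g.
by move=> _ [h Bh <-]; exact: BU.
Qed.

Lemma measurable_left (g : G) (A : set G) : measurable A ->
  measurable [set h | A (g * h)%g].
Proof.
move=> mA; rewrite -[X in measurable X]setTI.
by apply: (continuous_borel_measurable (@mulg_continuous_right g)).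
Qed.

Lemma measurable_right (g : G) (A : set G) : measurable A ->
  measurable [set h | A (h * g)%g].
Proof.
move=> mA; rewrite -[X in measurable X]setTI.
by apply: (continuous_borel_measurable (@mulg_continuous_left g)).
Qed.

Lemma measurable_inv (A : set G) : measurable A -> measurable [set h | A h^-1%g].
Proof.
move=> mA; rewrite -[X in measurable X]setTI.
by apply: (continuous_borel_measurable (@invg_continuous _ G)).
Qed.

Lemma haar_left (g : G) (A : set G) : measurable A ->
  nu [set h | A (g * h)%g] = nu A.
Proof.
move=> mA; rewrite -(haar g (measurable_left g mA)); congr (nu _).
apply/seteqP; split=> [_ [h Ah <-]//|h Ah]; exists (g^-1 * h)%g; rewrite /= mulVKg//.
Qed.

(* Fubini for the set of pairs (x, y) with x^-1 y in A. *)
Lemma haar_inv (A : set G) : measurable A -> nu [set h | A h^-1%g] = nu A.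
Proof.
move=> mA; pose J := [set xy : G * G | A (xy.1^-1 * xy.2)%g].
have mJ : measurable J.
  have c : continuous (fun xy : G * G => (xy.1^-1 * xy.2)%g).
    have c1 : continuous (fun xy : G * G => xy.1^-1%g).
      move=> z; apply: (@continuous_comp _ _ _ (@fst G G) (fun g : G => g^-1%g)).
        exact: cvg_fst.
      exact: invg_continuous.
    move=> z; have c2 : (fun xy : G * G => (xy.1^-1%g, xy.2)) @ z --> nbhs (z.1^-1%g, z.2).
      by apply: cvg_pair; [exact: c1|exact: cvg_snd].
    exact: (cvg_comp _ _ c2 (@mulg_continuous _ G (z.1^-1%g, z.2))).
  rewrite -[X in measurable X]setTI.
  exact: (continuous_measurable_prod baseG baseG c).
have bJ := bounded_measurable_indic (R := R) mJ.
have := bounded_Fubini nu nu bJ.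
have -> : \int[nu]_x \int[nu]_y (\1_J (x, y) : R) = fine (nu A).
  rewrite -[RHS](Rintegral_const nu); apply: eq_Rintegral => x _.
  rewrite -(haar_left x^-1%g mA) -Rintegral_indic; last exact: measurable_left.
  by apply: eq_Rintegral => y _; rewrite !indicE; congr (_%:R); congr (nat_of_bool _);
    apply/idP/idP; rewrite !inE.
have -> : \int[nu]_y \int[nu]_x (\1_J (x, y) : R) = fine (nu [set h | A h^-1%g]).
  rewrite -[RHS](Rintegral_const nu); apply: eq_Rintegral => y _.
  rewrite -(haar_left y^-1%g (measurable_inv mA)) -Rintegral_indic; last first.
    exact/measurable_left/measurable_inv.
  by apply: eq_Rintegral => x _; rewrite !indicE; congr (_%:R); congr (nat_of_bool _);
    apply/idP/idP; rewrite !inE /J /= invgM invgK.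
move=> E; rewrite -[LHS]fineK ?fin_num_measure//; last exact: measurable_inv.
by rewrite -E fineK ?fin_num_measure.
Qed.

(** Inversion turns right translations into left ones. Right translations govern both the change of
    base point in V and the balls of a right-invariant metric. *)
Lemma haar_right (g : G) (A : set G) : measurable A ->
  nu [set h | A (h * g)%g] = nu A.
Proof.
move=> mA; rewrite -haar_inv; last exact: measurable_right.
rewrite -[RHS](haar_inv mA) -(haar_left g^-1%g (measurable_inv mA)).
by congr (nu _); apply/seteqP; split=> h /=; rewrite invgM invgK.
Qed.

Lemma measurable_act_left v : measurable_fun setT (fun g => a g v).
Proof. exact: continuous_borel_measurable (@act_continuous_left v). Qed.

Lemma measurable_act_right g : measurable_fun setT (a g).
Proof. exact: continuous_borel_measurable (@act_continuous_right g). Qed.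

Lemma measurable_orbit v (S : set V) : measurable S ->
  measurable [set g | S (a g v)].
Proof.
by move=> mS; rewrite -[X in measurable X]setTI; exact: measurable_act_left.
Qed.

Lemma measurable_translate g (S : set V) : measurable S ->
  measurable [set v | S (a g v)].
Proof.
by move=> mS; rewrite -[X in measurable X]setTI; exact: measurable_act_right.
Qed.

Lemma quotient_measureE (S : set V) : mu S = nu [set g | S (a g v0)].
Proof. by []. Qed.

(** For [v = h v0] this is invariance under right translation by [h]. *)
Lemma act_law v (S : set V) : measurable S -> nu [set g | S (a g v)] = mu S.
Proof.
move=> mS; have [h <-] := act_transitive H v0 v.
rewrite quotient_measureE -(haar_right h (measurable_orbit v0 mS)).
by congr (nu _); apply/seteqP; split=> g /=; rewrite act_mul.
Qed.

Lemma translate_law g (S : set V) : measurable S -> mu [set v | S (a g v)] = mu S.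
Proof.
move=> mS; rewrite !quotient_measureE -(haar_left g (measurable_orbit v0 mS)).
by congr (nu _); apply/seteqP; split=> h /=; rewrite act_mul.
Qed.

End group_action.

(** * Continuity of return measures *)

Section translation_continuity.
Context {R : realType} {k : nat} {dG dV : measure_display}.
Context {G : borelGroupType dG} {V : borelType dV}.
Variables (H : homogeneous_hypergraph k G V) (nu : probability G R) (v0 : V).
Hypothesis haar : haar_probability nu.
Variable BG : nat -> set G.
Hypothesis baseG : countable_base BG.
Variable BV : nat -> set V.
Hypothesis baseV : countable_base BV.

Local Notation mu := (quotient_measure H v0 nu).
Local Notation a := (act H).

(** One half of the symmetric difference of the orbit preimages of [S] at [v] and [w]. The preimages
    have equal measure, hence so do the halves ([exit_sym]), and one suffices. *)
Definition exit_set (S : set V) (v w : V) : set G :=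
  [set g | S (a g v) /\ ~ S (a g w)].

Lemma measurable_exit S v w : measurable S -> measurable (exit_set S v w).
Proof.
move=> mS; apply: measurableD; exact: measurable_orbit.
Qed.

Lemma exit_sym S v w : measurable S ->
  nu (exit_set S v w) = nu (exit_set S w v).
Proof.
move=> mS; have mv := measurable_orbit H v mS; have mw := measurable_orbit H w mS.
rewrite [LHS](measureD mv mw) ?ltey_eq ?fin_num_measure//.
rewrite [RHS](measureD mw mv) ?ltey_eq ?fin_num_measure//.
rewrite setIC; congr (_ - _)%E.
exact: (etrans (act_law H v0 haar baseG v mS) (esym (act_law H v0 haar baseG w mS))).
Qed.

(* The sets S with this property form a sigma-algebra containing the open sets,
   so no regularity of the measures is needed. *)
Lemma exit_near S v (e : R) : measurable S -> 0 < e ->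
  \forall w \near v, fine (nu (exit_set S v w)) < e.
Proof.
pose L S := measurable S /\ forall v (e : R), 0 < e ->
  \forall w \near v, fine (nu (exit_set S v w)) < e.
suff SL : measurable `<=` L by move=> mS e0; have [_ +] := SL S mS; apply.
have LC S' : L S' -> L (~` S').
  move=> [mS LS]; split; first exact: measurableC.
  move=> v' e' e'0; apply: filterS (LS v' _ e'0) => w.
  rewrite exit_sym//; congr (fine (nu _) < _).
  by apply/seteqP; split=> g [h1 h2]; [split=> //; exact|split=> //; exact: contrapT].
have LU S1 S2 : L S1 -> L S2 -> L (S1 `|` S2).
  move=> [m1 L1] [m2 L2]; split; first exact: measurableU.
  move=> v' e' e'0; have e2 : 0 < e' / 2 by rewrite divr_gt0.
  apply: filterS2 (L1 v' _ e2) (L2 v' _ e2) => w h1 h2.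
  rewrite (splitr e'); apply: le_lt_trans (ltrD h1 h2).
  have mE1 := measurable_exit v' w m1; have mE2 := measurable_exit v' w m2.
  rewrite -fineD ?fin_num_measure// fine_le ?fin_numD ?fin_num_measure//.
    by apply: measurable_exit; exact: measurableU.
  apply: (le_trans _ (measureU2 _ mE1 mE2)); apply: le_measure; rewrite ?inE.
  - by apply: measurable_exit; exact: measurableU.
  - exact: measurableU.
  by move=> g [[?|?] /not_orP[? ?]]; [left|right].
have L0 : L set0.
  split=> // v' e' e'0; apply: nearW => w.
  by rewrite (_ : exit_set _ _ _ = set0) ?measure0//; apply/seteqP; split=> g [].
rewrite measurable_borel; apply: smallest_sub.
  split=> //; first by move=> A /LC; rewrite setTD.
  (* The part of the union outside [B n] has small measure, and by [act_law] its orbit preimage at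
     any point is equally small; the other exits are exits from the finite union [B n]. *)
  move=> A LA; pose B n := \big[setU/set0]_(i < n) A i.
  have LB n : L (B n).
    by elim: n => [|n IH]; rewrite /B ?big_ord0// big_ord_recr; exact: LU.
  have mB n : measurable (B n) by case: (LB n).
  have mU : measurable (\bigcup_n A n) by apply: bigcupT_measurable => n; case: (LA n).
  split=> // v' e' e'0; have e2 : 0 < e' / 2 by rewrite divr_gt0.
  have mAB n : measurable (\bigcup_n A n `\` B n) by exact: measurableD.
  have cv : mu (\bigcup_n A n `\` B n) @[n --> \oo] --> (0 : \bar R).
    rewrite -(measure0 mu); have <- : \bigcap_n (\bigcup_n A n `\` B n) = set0.
      apply/seteqP; split=> // x xB; have [[i _ Ai] _] := xB 0%N Logic.I.
      have [_] := xB i.+1 Logic.I; apply; rewrite /B.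
      by rewrite big_ord_recr; right.
    apply: nonincreasing_cvg_mu => //; first by rewrite ltey_eq fin_num_measure.
      exact: bigcapT_measurable.
    apply/nonincreasing_seqP => n; apply/subsetPset => x [Ax nB]; split=> // Bx.
    by apply: nB; rewrite /B big_ord_recr; left.
  have [n nP] : exists n, fine (mu (\bigcup_n A n `\` B n)) < e' / 2.
    have /fine_cvgP[_ /cvgrPdist_lt/(_ _ e2)] := cv.
    move=> /filter_ex[n]; rewrite sub0r normrN => h; exists n.
    by rewrite (le_lt_trans (ler_norm _)).
  have [_ LBn] := LB n; apply: filterS (LBn v' _ e2) => w h.
  rewrite (splitr e'); apply: le_lt_trans (ltrD nP h).
  have mE := measurable_exit v' w (mB n).
  have mO := measurable_orbit H v' (mAB n).
  have mEU := measurable_exit v' w mU.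
  rewrite -(act_law H v0 haar baseG v' (mAB n)).
  rewrite -fineD ?fin_num_measure// fine_le ?fin_numD ?fin_num_measure//.
  apply: (le_trans _ (measureU2 _ mO mE)); apply: le_measure; rewrite ?inE//.
    exact: measurableU.
  move=> g [Ag nAg]; have [Bg|nBg] := pselect (B n (a g v')); [right|left] => //.
  split=> // Bw; apply: nAg.
  exact: (@bigsetU_bigcup _ A n).
move=> S' oS; have mS : measurable S' by exact: open_measurable_borel.
(* Otherwise some [w n], in all of the first basic neighbourhoods of [v'], keep exit sets of measure
   at least [e']. An element [g] in infinitely many of these contradicts continuity of [act H g] at
   [v'], so the tails [F n] decrease to the empty set. *)
split=> // v' e' e'0; apply: contrapT => nfar.
pose U n := [set w | forall m : 'I_n.+1, BV m v' -> BV m w].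
have nU n : nbhs v' (U n).
  apply: (@filter_forall _ _ (fun (m : 'I_n.+1) w => BV m v' -> BV m w) (nbhs v')) => m.
  have [Bm|nBm] := pselect (BV m v'); last by apply: nearW => w /nBm.
  suff : nbhs v' (BV m) by apply: filterS => w.
  by apply: open_nbhs_nbhs; split => //; have [+ _] := baseV; apply.
have /choice[w wP] : forall n, exists w, U n w /\ e' <= fine (nu (exit_set S' v' w)).
  move=> n; apply: contrapT => nw; apply: nfar; apply: filterS (nU n) => w Uw.
  by rewrite ltNge; apply/negP => we; apply: nw; exists w.
pose T n := exit_set S' v' (w n).
have mT n : measurable (T n) by exact: measurable_exit.
pose F n := \bigcup_(m in [set m | (n <= m)%N]) T m.
have mF n : measurable (F n) by apply: bigcup_measurable => m _.
have F0 : \bigcap_n F n = set0.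
  apply/seteqP; split=> // g gF.
  have Sg : S' (a g v') by have [m _ []] := gF 0%N Logic.I.
  have [_ nB] := baseV.
  have [j [Bj BS]] : exists j, BV j v' /\ BV j `<=` [set x | S' (a g x)].
    by apply: nB; apply: act_continuous_right; exact: open_nbhs_nbhs.
  have [m /= jm [_]] := gF j Logic.I; apply; apply: BS.
  by have [+ _] := wP m; move=> /(_ (Ordinal (jm : (j < m.+1)%N))); exact.
have cv : nu (F n) @[n --> \oo] --> (0 : \bar R).
  rewrite -(measure0 nu) -F0; apply: nonincreasing_cvg_mu => //.
  - by rewrite ltey_eq fin_num_measure.
  - exact: bigcapT_measurable.
  apply/nonincreasing_seqP => n; apply/subsetPset => g [m /= nm Tm].
  by exists m => //=; exact: ltnW.
have /fine_cvgP[_ /cvgrPdist_lt/(_ _ e'0)/filter_ex[n]] := cv.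
rewrite sub0r normrN => h.
have [_] := wP n; rewrite leNgt => /negP; apply.
apply: le_lt_trans (le_lt_trans (ler_norm _) h).
have mTn := mT n; rewrite -/(T n).
rewrite fine_le ?fin_num_measure//; apply: le_measure; rewrite ?inE//.
by move=> g Tg; exists n => /=.
Qed.

Definition return_set (S : set V) (t : k.-tuple V) : set G :=
  [set g | forall i, S (a g (tnth t i))].

Lemma measurable_return S t : measurable S -> measurable (return_set S t).
Proof.
move=> mS; have -> : return_set S t =
    \bigcap_(i in [set: 'I_k]) [set g | S (a g (tnth t i))].
  by apply/seteqP; split=> [g h i _|g h i]; exact: h.
by apply: fin_bigcap_measurable => // i _; exact: measurable_orbit.
Qed.

(** An element returning [s] but not [t] belongs to the exit set of some coordinate; the union bound
    is obtained by integrating indicators. *)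
Lemma return_diff S s t : measurable S ->
  fine (nu (return_set S s)) - fine (nu (return_set S t)) <=
  \sum_(i < k) fine (nu (exit_set S (tnth s i) (tnth t i))).
Proof.
move=> mS; rewrite lerBlDl.
have mE i := measurable_exit (tnth s i) (tnth t i) mS.
have mr := measurable_return _ mS.
have bI (A : set G) (mA : measurable A) := bounded_measurable_indic (R := R) mA.
have bsum : bounded_measurable (fun g =>
    \sum_(i < k) (\1_(exit_set S (tnth s i) (tnth t i)) g : R)).
  by apply: bounded_measurable_sum => i; exact: bI.
rewrite -!(Rintegral_indic nu)//.
under [X in _ <= _ + X]eq_bigr do rewrite -Rintegral_indic//.
rewrite -Rintegral_sum; last first.
  by move=> i; apply: bounded_measurable_integrable; exact: bI.
rewrite -RintegralD//; last 2 first.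
- by apply: bounded_measurable_integrable; exact: bI.
- exact: bounded_measurable_integrable.
apply: le_Rintegral => //.
- by apply: bounded_measurable_integrable; exact: bI.
- apply: bounded_measurable_integrable; apply: bounded_measurableD => //.
  exact: bI.
move=> g _; have s0 : 0 <= \sum_(i < k) (\1_(exit_set S (tnth s i) (tnth t i)) g : R).
  by apply: sumr_ge0 => i _; rewrite indicE.
rewrite [\1_(return_set S s) g]indicE [\1_(return_set S t) g]indicE.
have [|_] := boolP (g \in return_set S s).
  rewrite inE => rs; have [_|] := boolP (g \in return_set S t).
    by rewrite lerDl.
  rewrite notin_setE => /existsNP[i ni]; rewrite add0r (bigD1 i)//=.
  rewrite indicE mem_set; last by split=> //; exact: rs.
  by rewrite lerDl; apply: sumr_ge0 => j _; rewrite indicE.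
by rewrite addr_ge0.
Qed.

Lemma return_continuous S : measurable S ->
  continuous (fun t : k.-tuple V => fine (nu (return_set S t))).
Proof.
move=> mS t; have FF : Filter (nbhs t) by exact: nbhs_filter.
apply/(@cvgrPdist_lt _ _ _ (nbhs t) FF) => e e0.
(* Dividing by [k.+1] keeps the sum of the k terms strictly below [e], also for [k = 0]. *)
pose e' := e / k.+1%:R; have e'0 : 0 < e' by rewrite divr_gt0.
have near_t : \forall s \near t, forall i,
    fine (nu (exit_set S (tnth t i) (tnth s i))) < e'.
  have := @filter_forall _ _ (fun i (s : k.-tuple V) =>
    fine (nu (exit_set S (tnth t i) (tnth s i))) < e') (nbhs t) _.
  apply=> i.
  exact: (@tnth_continuous _ _ i t _ (exit_near (tnth t i) mS e'0)).
apply: filterS near_t => s st.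
have sum_lt : \sum_(i < k) fine (nu (exit_set S (tnth t i) (tnth s i))) < e.
  apply: (@le_lt_trans _ _ (\sum_(i < k) e')).
    by apply: ler_sum => i _; exact: ltW.
  rewrite sumr_const card_ord -mulr_natl /e' mulrCA gtr_pMr// ltr_pdivrMr// mul1r.
  by rewrite ltr_nat.
rewrite ltr_norml; apply/andP; split; last exact: le_lt_trans (return_diff t s mS) _.
rewrite ltrNl opprB; apply: le_lt_trans (return_diff s t mS) _.
apply: le_lt_trans sum_lt; apply: ler_sum => i _.
by rewrite exit_sym.
Qed.

End translation_continuity.

(** * Independent sets from density points *)

Section density_independent.
Context {R : realType} {k : nat} {dG dV : measure_display}.
Context {G : borelGroupType dG} {V : borelType dV}.
Variables (H : homogeneous_hypergraph k G V) (nu : probability G R) (v0 : V).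
Hypothesis k_gt0 : (0 < k)%N.
Hypothesis haar : haar_probability nu.
Variable BG : nat -> set G.
Hypothesis baseG : countable_base BG.
Variable BV : nat -> set V.
Hypothesis baseV : countable_base BV.
Variable dist : G -> G -> R.
Hypothesis md : metrizes dist.
Hypothesis rd : right_invariant dist.
Hypothesis dd : density_metric nu dist.

Local Notation mu := (quotient_measure H v0 nu).
Local Notation a := (act H).

Let B m := metric_ball dist 1%g m.+1%:R^-1.

Let mB m : measurable (B m).
Proof. by apply: open_measurable_borel; exact: open_metric_ball. Qed.

Let b m := fine (nu (B m)).

Let b_gt0 m : 0 < b m.
Proof.
rewrite fine_gt0// ltey_eq fin_num_measure//= andbT.
have [dp _ _] := dd; have [|_] := dp (B m); last by [].
by exists 1%g, m.+1%:R^-1.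
Qed.

Lemma measurable_act_pair : measurable_fun setT (fun vg : V * G => a vg.2 vg.1).
Proof.
apply: (continuous_measurable_prod baseV baseG) => vg.
have c : (fun vg : V * G => (vg.2, vg.1)) @ vg --> nbhs (vg.2, vg.1).
  by apply: cvg_pair; [exact: cvg_snd|exact: cvg_fst].
exact: (cvg_comp _ _ c (@act_continuous _ _ _ _ _ H (vg.2, vg.1))).
Qed.

(** The mass is a partial integral over G of a jointly measurable function; this makes the set built
    in [independent_of_return] measurable. *)
Lemma measurable_return_mass (A : set G) (S : set V) : measurable A ->
  measurable S ->
  measurable_fun setT (fun v => fine (nu (A `&` [set g | S (a g v)]))).
Proof.
move=> mA mS; pose f (vg : V * G) : R := \1_A vg.2 * \1_S (a vg.2 vg.1).
have bf : bounded_measurable f.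
  apply: bounded_measurableM.
    by apply: (bounded_measurable_comp (bounded_measurable_indic mA)).
  exact: (bounded_measurable_comp (bounded_measurable_indic mS) measurable_act_pair).
have [mf _] := bounded_measurable_Rintegral mu nu bf.
apply: eq_measurable_fun mf => v _.
rewrite -Rintegral_indic; last by apply: measurableI => //; exact: measurable_orbit.
apply: eq_Rintegral => g _; rewrite /f /= indicI /= !indicE.
by congr (_ * _%:R); congr (nat_of_bool _); apply/idP/idP; rewrite !inE.
Qed.

(* I is the set of points v whose small balls B v lie in S up to a fraction
   1/k; translating an edge in I by a suitable element of a small ball around 1
   would put it in S, on a set of positive measure. *)
Lemma independent_of_return (S : set V) : measurable S ->
  (forall t, edge H t -> nu (return_set H S t) = 0%E) ->
  exists I : set V, [/\ measurable I, independent H I & (mu S <= mu I)%E].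
Proof.
(* Density systems concern sets of positive measure; for a null [S] the empty set serves. *)
move=> mS S0; have [muS|muS] := leP (mu S) 0%E.
  exists set0; split=> //; last by rewrite measure0.
  by apply/seteqP; split=> t // [/(_ (Ordinal k_gt0))].
have k0 : 0 < k%:R :> R by rewrite ltr0n.
(* The threshold is such that k subsets of [B m], each of measure below [b m / k], cannot cover
   it. *)
pose J m := [set v | (1 - k%:R^-1) * b m < fine (nu (B m `&` [set g | S (a g v)]))].
have mJ m : measurable (J m).
  rewrite (_ : J m = [set: V] `&`
    (fun v => fine (nu (B m `&` [set g | S (a g v)]))) @^-1`
      [set` `](1 - k%:R^-1) * b m, +oo[]).
    exact: measurable_return_mass.
  by rewrite setTI; apply/seteqP; split=> v; rewrite /J /= in_itv/= andbT.
(* A lower limit, so that the k coordinates of an edge lie in a common [J m]: the largest of their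
   thresholds works for all. *)
pose I := \bigcup_M \bigcap_(m in [set m | (M <= m)%N]) J m.
exists I; split.
- apply: bigcupT_measurable => M; apply: bigcap_measurable => //.
  by exists M => /=.
- apply/seteqP; split=> t // -[It Et].
  have /choice[M MP] : forall i : 'I_k, exists M, forall m, (M <= m)%N -> J m (tnth t i).
    by move=> i; have [M _ h] := It i; exists M.
  pose m := \max_(i < k) M i.
  have Jm i : J m (tnth t i) by apply: MP; exact: leq_bigmax.
  have mr := measurable_return H t mS.
  have mBi i : measurable (B m `&` [set g | S (a g (tnth t i))]).
    by apply: measurableI => //; exact: measurable_orbit.
  have bI (A : set G) (mA : measurable A) := bounded_measurable_indic (R := R) mA.
  have : b m <= fine (nu (return_set H S t)) +
      \sum_(i < k) (b m - fine (nu (B m `&` [set g | S (a g (tnth t i))]))).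
    rewrite /b -!(Rintegral_indic nu)//.
    under eq_bigr => i _.
      rewrite -Rintegral_indic// -RintegralB//; last 2 first.
      - by apply: bounded_measurable_integrable; exact: bI.
      - by apply: bounded_measurable_integrable; exact: bI.
      over.
    have bd i : bounded_measurable (fun g => \1_(B m) g -
        (\1_(B m `&` [set g | S (a g (tnth t i))]) g : R)).
      by apply: bounded_measurableB; exact: bI.
    rewrite -Rintegral_sum; last by move=> i; exact: bounded_measurable_integrable.
    have bs : bounded_measurable (fun g => \sum_(i < k) (\1_(B m) g -
        (\1_(B m `&` [set g | S (a g (tnth t i))]) g : R))).
      exact: bounded_measurable_sum.
    rewrite -RintegralD//; last 2 first.
    - by apply: bounded_measurable_integrable; exact: bI.
    - exact: bounded_measurable_integrable.
    apply: le_Rintegral => //.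
    - by apply: bounded_measurable_integrable; exact: bI.
    - apply: bounded_measurable_integrable; apply: bounded_measurableD => //.
      exact: bI.
    move=> g _.
    have d0 i : 0 <= \1_(B m) g - \1_(B m `&` [set g | S (a g (tnth t i))]) g :> R.
      rewrite indicI /= [\1_(B m) g]indicE [X in _ - _ * X]indicE.
      by case: (_ \in _); case: (_ \in _); rewrite ?mulr0 ?mul0r ?mulr1 ?subr0 ?subrr.
    rewrite [\1_(return_set H S t) g]indicE.
    have [_|] := boolP (g \in return_set H S t).
      rewrite (@le_trans _ _ 1) ?lerDl ?sumr_ge0//.
    rewrite notin_setE add0r => /existsNP[i ni].
    rewrite (bigD1 i)//= indicI /= [X in _ * X]indicE memNset// mulr0 subr0.
    by rewrite lerDl sumr_ge0.
  rewrite (S0 t Et) add0r leNgt => /negP; apply.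
  apply: (@lt_le_trans _ _ (\sum_(i < k) (b m / k%:R))).
    apply: ltr_sum => [|i _].
      by apply/hasP; exists (Ordinal k_gt0) => //; exact: mem_index_enum.
    by have := Jm i; rewrite /J /= mulrBl mul1r [_ / _]mulrC; lra.
  by rewrite sumr_const card_ord -[leLHS]mulr_natr divfK ?gt_eqF.
have mS' := measurable_orbit H v0 mS.
have [_ _ /(_ _ mS' muS)[N [mN N0 sN]]] := dd.
have mI : measurable I.
  apply: bigcupT_measurable => M; apply: bigcap_measurable => //.
  by exists M => /=.
have mI' := measurable_orbit H v0 mI.
rewrite (quotient_measureE H nu v0 S) (quotient_measureE H nu v0 I).
rewrite -[leRHS]adde0 -N0.
apply: (le_trans _ (measureU2 _ mI' mN)); apply: le_measure; rewrite ?inE//.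
  exact: measurableU.
move=> g Sg; have [Ng|nNg] := pselect (N g); [by right|left].
have gD : density_points nu
    [set D | exists x r, 0 < r /\ D = metric_ball dist x r]
    [set g | S (a g v0)] g.
  by apply: contrapT => nD; apply: nNg; apply: sN; left.
have ik0 : 0 < k%:R^-1 :> R by rewrite invr_gt0.
(* The balls of the density system that contain [g] need not be centred at [g]. As [D0] is open,
   small balls centred at [g] lie inside it and inherit the estimate. *)
have [D0 [[x [r [r0 D0E]]] D0g] D0P] := gD _ (nbhsx_ballx (1 : R) _ ik0).
have : nbhs g D0.
  by apply: open_nbhs_nbhs; split => //; rewrite D0E; exact: open_metric_ball.
have [_ nE] := md; rewrite nE => -[r' r'0 r'D0].
have [M _ MP] := near_infty_natSinv_lt (PosNum (r'0 : 0 < r')).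
exists M => // m /= /MP /= mr'.
pose Bg := metric_ball dist g m.+1%:R^-1.
have BgP : `|1 - fine (nu (Bg `&` [set g | S (a g v0)])) / fine (nu Bg)| < k%:R^-1.
  apply: D0P; split.
  - by exists g, m.+1%:R^-1.
  - exact: metric_ball_self.
  - by move=> y gy; apply: r'D0; rewrite /metric_ball /= (lt_trans gy).
have mBg : measurable Bg by apply: open_measurable_borel; exact: open_metric_ball.
(* The ball about [g] is [B m] translated on the right by [g]. With right invariance of [nu], the
   density ratio at [g] becomes the one defining [J m] at the point [a g v0]. *)
have BgE : [set h | Bg (h * g)%g] = B m.
  apply/seteqP; split=> h; rewrite /Bg /B /metric_ball /=.
    by have := rd 1%g h g; rewrite mul1g => ->.
  by have := rd 1%g h g; rewrite mul1g => ->.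
have E1 : fine (nu Bg) = b m by rewrite -(haar_right haar baseG g mBg) BgE.
have E2 : fine (nu (Bg `&` [set g | S (a g v0)])) =
    fine (nu (B m `&` [set h | S (a h (a g v0))])).
  rewrite -(haar_right haar baseG g (measurableI _ _ mBg mS')) -BgE.
  by congr (fine (nu _)); apply/seteqP; split=> h []; rewrite /= act_mul.
move: BgP; rewrite E1 E2 ltr_norml => /andP[_]; rewrite /J /=.
rewrite -ltr_pdivlMr//; lra.
Qed.

End density_independent.

(** * Upper bound *)

(** Each product of basic sets that meets E contributes a point of E, with [t0] as default. The
    sequence must lie in E itself, since kernels are known to vanish only there. *)
Lemma dense_sequence (k : nat) (V : topologicalType) (BV : nat -> set V)
    (E : set (k.-tuple V)) (t0 : k.-tuple V) : countable_base BV -> E t0 ->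
  exists e : nat -> k.-tuple V, (forall j, E (e j)) /\
    forall t W, E t -> nbhs t W -> exists j, W (e j).
Proof.
move=> [_ nB] Et0.
have /choice[c cP] : forall u : k.-tuple nat, exists t, E t /\
    ((exists s, E s /\ forall i, BV (tnth u i) (tnth s i)) ->
     forall i, BV (tnth u i) (tnth t i)).
  move=> u; have [[s [Es us]]|ns] :=
    pselect (exists s, E s /\ forall i, BV (tnth u i) (tnth s i)).
    by exists s.
  by exists t0.
exists (fun n => if unpickle n is Some u then c u else t0); split.
  by move=> j; case: unpickle => // u; have [] := cP u.
move=> t W Et tW; have [U [Ut UW]] := nbhs_tuple_box tW.
have /choice[u uP] : forall i, exists n, BV n (tnth t i) /\ BV n `<=` U i.
  by move=> i; apply: nB; apply: open_nbhs_nbhs; exact: Ut.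
exists (pickle [tuple u i | i < k]); rewrite pickleK; apply: UW => i.
have [_ uc] := cP [tuple u i | i < k].
have [_] := uP i; apply; have := uc _ i; rewrite tnth_mktuple; apply.
by exists t; split => // j; rewrite tnth_mktuple; have [] := uP j.
Qed.

Section upper_bound.
Context {R : realType} {p : nat} {dG dV : measure_display}.
Context {G : borelGroupType dG} {V : borelType dV}.
Variables (H : homogeneous_hypergraph p.+1 G V) (nu : probability G R) (v0 : V).
Hypothesis p_gt0 : (0 < p)%N.
Hypothesis cG : compact [set: G].
Hypothesis hV : hausdorff_space V.
Hypothesis haar : haar_probability nu.
Variable dist : G -> G -> R.
Hypothesis md : metrizes dist.
Hypothesis rd : right_invariant dist.
Hypothesis dd : density_metric nu dist.

Local Notation mu := (quotient_measure H v0 nu).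

Lemma alpha_itv : exists al : R, 0 <= al /\ alpha H mu = al%:E.
Proof.
have a0 : (0 <= alpha H mu)%E.
  apply: ereal_sup_ubound; exists set0; last by rewrite measure0.
  by split=> //; apply/seteqP; split=> t // [/(_ ord0)].
have a1 : (alpha H mu <= 1)%E.
  by apply: ub_ereal_sup => _ [I [mI _] <-]; exact: probability_le1.
exists (fine (alpha H mu)); rewrite fine_ge0// fineK// ge0_fin_numE//.
by rewrite (le_lt_trans a1)// ltry.
Qed.

Lemma independent_le_alpha (I : set V) (al : R) : alpha H mu = al%:E ->
  measurable I -> independent H I -> fine (mu I) <= al.
Proof.
move=> aE mI iI; rewrite -lee_fin fineK ?fin_num_measure// -aE.
by apply: ereal_sup_ubound; exists I.
Qed.

Lemma CP_integral_le (A : p.+1.-tuple V -> R) (al : R) :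
  alpha H mu = al%:E -> 0 <= al -> CPc mu p.+1 A ->
  \int[mu]_v A [tuple v | _ < p.+1] = 1 ->
  (forall t, edge H t -> A t = 0) ->
  \int[power_measure mu p.+1]_t A t <= al ^+ p.
Proof.
move=> aE al0 cpA Ad AE; rewrite leNgt; apply/negP => alA.
have [BG baseG] := compact_metrizable_base md 1%g cG.
have [BV baseV] := orbit_base H v0 cG hV baseG.
have cV := compact_space H v0 cG.
(* Without edges there is no sequence to choose. Then V is independent, so [1 <= al], and the full
   integral minus the diagonal one, nonpositive on tensors by Hoelder on V, gives the
   contradiction. *)
have [[t0 Et0]|nE] := pselect (exists t, edge H t); last first.
  have al1 : 1 <= al.
    rewrite -[leLHS]/(fine 1%E) -(probability_setT mu).
    apply: independent_le_alpha => //.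
    by apply/seteqP; split=> t // [_ Et]; apply: nE; exists t.
  have rL : regular_functional mu
      (fun F => full_functional mu F + -1 * diag_functional mu (p := p) F).
    apply: regular_functionalD; first exact: regular_full.
    by apply: regular_functionalZ; exact: regular_diag.
  have [|f [bf f0]] := CP_regular_functional cV rL cpA.
    rewrite mulN1r subr_gt0 [X in X < _]Ad (le_lt_trans _ alA)//.
    exact: exprn_ege1.
  rewrite mulN1r subr_gt0 full_tensor// diag_tensor ltNge => /negP; apply.
  have := Rintegral_expr_indic mu p_gt0 bf f0 measurableT.
  rewrite [X in fine X](probability_setT mu) expr1n mul1r.
  by under eq_Rintegral do rewrite indicT mulr1.
have [e [eE eD]] := dense_sequence baseV Et0.
set th0 := \int[power_measure mu p.+1]_t A t in alA.
pose th := (al ^+ p + th0) / 2.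
have alp0 : 0 <= al ^+ p by exact: exprn_ge0.
have alth : al ^+ p < th by rewrite /th; lra.
have thth0 : th < th0 by rewrite /th; lra.
have th_gt0 : 0 < th by lra.
have mact (v : V) : measurable_fun setT (fun g => act H g v) by exact: measurable_act_left.
have alaw := act_law H v0 haar baseG.
have Ae g j : A (map_tuple (act H g) (e j)) = 0.
  by apply: AE; apply: edge_act; exact: eE.
(* By Bernoulli, [th * (1 - 9 / 2 ^+ M) ^+ p.+1] is at least [th - 9 * p.+1 * th / 2 ^+ M], which
   exceeds [al ^+ p] once [1 / 2 ^+ M < c]. The minimum with 1/9 secures the last hypothesis of
   [support_of_CP]. *)
pose c := (th - al ^+ p) / (9 * p.+1%:R * th).
have d0 : 0 < 9 * p.+1%:R * th by rewrite mulr_gt0// mulr_gt0 ?ltr0n.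
have c0 : 0 < c by rewrite divr_gt0 ?subr_gt0.
pose c' := Num.min c 9^-1.
have c'0 : 0 < c' by rewrite lt_min c0 invr_gt0 ltr0n.
have [M] := filter_ex (near_infty_natSinv_expn_lt (PosNum c'0)).
rewrite /= div1r lt_min => /andP[Mc M9].
have M9' : 9 * (2 ^+ M)^-1 <= 1 :> R by rewrite -ler_pdivlMl ?ltr0n// mulr1 ltW.
have [S [mS Sm Se]] := support_of_CP p_gt0 cV mact alaw cpA Ad Ae th_gt0 thth0 M9'.
have S0 t : edge H t -> nu (return_set H S t) = 0%E.
  move=> Et; have mr := measurable_return H t mS.
  rewrite -[LHS]fineK ?fin_num_measure//; congr EFin.
  apply/eqP; rewrite eq_le fine_ge0// andbT leNgt; apply/negP => r0.
  have ct := @return_continuous _ _ _ _ _ _ H nu v0 haar _ baseG _ baseV S mS t.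
  have [|j] := eD t [set s | 0 < fine (nu (return_set H S s))] Et.
    exact: (ct [set x : R | 0 < x] (open_nbhs_nbhs (conj (@open_gt R 0) r0))).
  by rewrite /= [X in fine X](Se j) ltxx.
have [I [mI iI SI]] := independent_of_return v0 (ltn0Sn p) haar baseG baseV md rd dd mS S0.
have Ial := independent_le_alpha aE mI iI.
have Sal : fine (mu S) <= al.
  by apply: le_trans Ial; rewrite fine_le ?fin_num_measure.
have Salp : fine (mu S) ^+ p <= al ^+ p by apply: lerXn2r => //; rewrite ?nnegrE ?fine_ge0.
have := le_trans Sm Salp; rewrite leNgt => /negP; apply.
have y0 : 0 <= 1 - 9 * (2 ^+ M)^-1 :> R by rewrite subr_ge0.
have /= := le_expr_tangent p y0 ler01; rewrite !expr1n mulr1.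
move=> /(ler_wpM2l (ltW th_gt0)); apply: lt_le_trans.
have cE : c * (9 * p.+1%:R * th) = th - al ^+ p.
  by rewrite divfK// gt_eqF.
have : (2 ^+ M)^-1 * (9 * p.+1%:R * th) < th - al ^+ p.
  by rewrite -cE ltr_pM2r.
by lra.
Qed.

End upper_bound.

(** * Lower bound *)

Lemma bounded_measurable_L2 (R : realType) d (T : measurableType d)
    (P : probability T R) (f : T -> R) (M : R) : bounded_measurable f ->
  (forall x, `|f x| <= M) ->
  f \in Lfun P 2%:E /\
  ('N[P]_(2%:E)[EFin \o f] `^ 2 = (\int[P]_x (f x ^+ 2))%:E)%E.
Proof.
move=> bf fM; have bf2 := bounded_measurable_exp 2 bf.
have E : (\int[P]_x (`|(EFin \o f) x| `^ 2) = (\int[P]_x (f x ^+ 2))%:E)%E.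
  rewrite -Rintegral_EFin; last exact: bounded_measurable_integrable.
  apply: eq_integral => x _ /=.
  by rewrite powR_mulrn// -normrX ger0_norm// sqr_ge0.
split; last by rewrite poweR_Lnorm.
rewrite inE/=; apply/andP; split; rewrite inE//=; first by case: bf.
rewrite /finite_norm unlock /=; apply: poweR_lty.
by rewrite [X in (X < _)%E]E ltry.
Qed.

(** Since [f ^+ 2 <= M * |f|], a uniform bound turns L^1 estimates into L^2 ones. *)
Lemma L2_lt (R : realType) d (T : measurableType d) (P : probability T R)
    (f : T -> R) (M e : R) : bounded_measurable f -> 0 < e ->
  (forall x, `|f x| <= M) -> M * \int[P]_x `|f x| < e ^+ 2 ->
  ('N[P]_(2%:E)[EFin \o f] < e%:E)%E.
Proof.
move=> bf e0 fM fe; have [_ E] := bounded_measurable_L2 P bf fM.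
have bn := bounded_measurable_norm bf.
have f2 : \int[P]_x (f x ^+ 2) < e ^+ 2.
  apply: le_lt_trans fe; rewrite -RintegralZl//; last exact: bounded_measurable_integrable.
  apply: le_Rintegral => //.
  - by apply: bounded_measurable_integrable; exact: bounded_measurable_exp.
  - by apply: bounded_measurable_integrable; exact: bounded_measurableZ.
  by move=> x _; rewrite -real_normK ?num_real// expr2 ler_wpM2r.
rewrite ltNge; apply/negP => eN.
have : ((e ^+ 2)%:E <= (\int[P]_x (f x ^+ 2))%:E)%E.
  rewrite -E -powR_mulrn; last exact: ltW.
  rewrite -poweR_EFin gt0_ler_poweR//.
  - by rewrite in_itv/= lee_fin ltW// leey.
  - by rewrite in_itv/= Lnorm_ge0 leey.
by rewrite lee_fin leNgt f2.
Qed.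

(** [q x] is the first index in a finite subcover whose set contains [x]; a cell is an open set
    minus finitely many earlier ones. *)
Lemma finite_cover_partition (d : measure_display) (X : borelType d)
    (U : X -> set X) (x0 : X) : compact [set: X] -> (forall x, open (U x) /\ U x x) ->
  exists n, exists q : X -> 'I_n, exists y : 'I_n -> X,
    (forall i, measurable (q @^-1` [set i])) /\ forall x, U (y (q x)) x.
Proof.
move=> cX UP; have [|s sP] := compact_finite_cover (U := U) cX.
  by move=> x _; apply: open_nbhs_nbhs; exact: UP.
have fP x : (find (fun y => `[< U y x >]) s < size s)%N.
  rewrite -has_find; apply/hasP; have [y ys Uy] := sP x Logic.I.
  by exists y => //; exact/asboolP.
exists (size s), (fun x => Ordinal (fP x)), (fun i => nth x0 s i); split; last first.
  move=> x /=; apply/asboolP.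
  by apply: (@nth_find _ x0 (fun y => `[< U y x >])); rewrite has_find.
move=> i; have mU y : measurable (U y) by apply: open_measurable_borel; have [] := UP y.
rewrite (_ : _ @^-1` _ = U (nth x0 s i) `&`
    \bigcap_(j in [set j | (j < i)%N]) ~` U (nth x0 s j)).
  apply: measurableI => //; apply: bigcap_measurableType => j _.
  exact: measurableC.
apply/seteqP; split=> [x /= xi|x [Ux nU]].
  have E : find (fun y => `[< U y x >]) s = i by rewrite -xi.
  split.
    apply/asboolP; rewrite -E.
    by apply: (@nth_find _ x0 (fun y => `[< U y x >])); rewrite has_find.
  move=> j /= ji /asboolP Uj.
  by have := @before_find _ x0 (fun y => `[< U y x >]) s j; rewrite E => /(_ ji); rewrite Uj.
apply: val_inj => /=; apply/eqP; rewrite eqn_leq; apply/andP; split.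
  rewrite leqNgt; apply/negP => h.
  by have := @before_find _ x0 (fun y => `[< U y x >]) s i h; move/asboolP: Ux => ->.
rewrite leqNgt; apply/negP => h; apply: (nU _ h); apply/asboolP.
by apply: (@nth_find _ x0 (fun y => `[< U y x >])); rewrite has_find.
Qed.

(** Factors are exchanged one at a time; the remaining ones lie in [0, 1] and do not enlarge the
    error. *)
Lemma prod_indic_dist (R : realDomainType) (I : Type) (r : seq I) (f g : I -> R) :
  (forall i, 0 <= f i <= 1) -> (forall i, 0 <= g i <= 1) ->
  `|\prod_(i <- r) f i - \prod_(i <- r) g i| <= \sum_(i <- r) `|f i - g i|.
Proof.
move=> f01 g01; elim: r => [|i r IH]; first by rewrite !big_nil subrr normr0.
rewrite !big_cons; set F := \prod_(j <- r) f j; set G := \prod_(j <- r) g j.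
have -> : f i * F - g i * G = (f i - g i) * F + g i * (F - G) by ring.
have [f0 f1] := andP (f01 i); have [g0 g1] := andP (g01 i).
have F0 : 0 <= F by apply: prodr_ge0 => j _; have /andP[] := f01 j.
have F1 : F <= 1 by apply: prodr_ile1 => j _; exact: f01.
rewrite (le_trans (ler_normD _ _))// lerD//.
  by rewrite normrM ler_piMr// ger0_norm.
by rewrite normrM ger0_norm// (le_trans _ IH)// ler_piMl.
Qed.

Section real_fubini_L1.
Context {R : realType} {d1 d2 : measure_display}.
Context {T1 : measurableType d1} {T2 : measurableType d2}.
Variables (P1 : probability T1 R) (P2 : probability T2 R).
Variables (f : T2 -> R) (K : T1 * T2 -> R).
Hypothesis fi : P2.-integrable setT (EFin \o f).
Hypothesis bK : bounded_measurable K.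

Lemma integrableM_bounded (T : measurableType d2) (P : probability T R)
    (h u : T -> R) : P.-integrable setT (EFin \o h) -> bounded_measurable u ->
  P.-integrable setT (EFin \o (fun x => h x * u x)).
Proof.
move=> hi [mu [M uM]]; have mh := measurable_int _ hi.
have : P.-integrable setT (EFin \o (fun x => M * h x)).
  by apply: eq_integrable (integrableZl measurableT M hi).
apply: le_integrable => //.
  by apply/measurable_EFinP/measurable_funM => //; exact/measurable_EFinP.
move=> x _ /=; rewrite lee_fin !normrM mulrC ler_wpM2r//.
by rewrite (le_trans (uM x))// ler_norm.
Qed.

Let integrable_fK :
  (P1 \x P2)%E.-integrable setT (EFin \o (fun p => f p.2 * K p)).
Proof.
have [mK [M KM]] := bK; have mf := measurable_int _ fi.
have := integrable_tensor2 (bounded_measurable_integrable P1 (bounded_measurable_cst M)) fi.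
apply: le_integrable => //.
  apply/measurable_EFinP/measurable_funM => //.
  by apply: measurableT_comp measurable_snd; exact/measurable_EFinP.
move=> [x y] _ /=; rewrite lee_fin !normrM mulrC ler_wpM2r//.
by rewrite (le_trans (KM _))// ler_norm.
Qed.

(** In [slice_positive] the test function is only square-integrable, so [bounded_Fubini] does not
    apply to it. *)
Lemma Rintegral_Fubini_L1 :
  \int[P2]_y (f y * \int[P1]_x K (x, y)) = \int[P1]_x \int[P2]_y (f y * K (x, y)).
Proof.
transitivity (\int[P2]_y \int[P1]_x (f y * K (x, y))).
  apply: eq_Rintegral => y _; rewrite RintegralZl//.
  by apply: bounded_measurable_integrable; exact: (bounded_measurable_pair2 y bK).
rewrite (@Rintegral21 _ _ _ _ _ P1 P2 (fun p => f p.2 * K p))//; last first.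
  move=> y; have := integrableZl measurableT (f y)
    (bounded_measurable_integrable P1 (bounded_measurable_pair2 y bK)).
  by apply: eq_integrable.
rewrite -(@Rintegral12 _ _ _ _ _ P1 P2 (fun p => f p.2 * K p))// => x.
by have := integrableM_bounded fi (bounded_measurable_pair1 x bK).
Qed.

Lemma bounded_measurable_Rintegral_L1 :
  bounded_measurable (fun x => \int[P2]_y (f y * K (x, y))).
Proof.
split.
  apply: measurableT_comp => //.
  exact: (measurable_fubini_F integrable_fK).
have [mK [M KM]] := bK; exists (M * \int[P2]_y `|f y|) => x.
have ii := integrableM_bounded fi (bounded_measurable_pair1 x bK).
apply: (le_trans (le_normr_Rintegral _ _)) => //.
have ni := integrable_norm fi.
rewrite -RintegralZl//; apply: le_Rintegral => //.
- exact: integrable_norm.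
- by have := integrableZl measurableT M ni; apply: eq_integrable.
by move=> y _; rewrite normrM mulrC ler_wpM2r.
Qed.

End real_fubini_L1.

Section regular_action.
Context {dG : measure_display} (G : borelGroupType dG).

Let lmul (g h : G) := (g * h)%g.

Let lmul_one h : lmul 1%g h = h. Proof. exact: mul1g. Qed.
Let lmul_mul g g' h : lmul (g * g')%g h = lmul g (lmul g' h).
Proof. by rewrite /lmul mulgA. Qed.
Let lmul_transitive v w : exists g, lmul g v = w.
Proof. by exists (w * v^-1)%g; rewrite /lmul mulgVK. Qed.

Let set0_borel : <<s @open (0.-tuple G) >> set0.
Proof. by move=> M [[]]. Qed.

(* G acting on itself, so that [exit_near] applies to translations of G; the
   edges are irrelevant. *)
Definition regular_hypergraph : homogeneous_hypergraph 0 G G :=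
  @HomogeneousHypergraph 0 dG dG G G lmul lmul_one lmul_mul mulg_continuous
    lmul_transitive set0 (fun t (f : set0 t) => match f with end)
    (fun t s (f : set0 t) => match f with end)
    (fun g t (f : set0 t) => match f with end)
    set0_borel.

End regular_action.

Section lower_bound.
Context {R : realType} {n : nat} {dG dV : measure_display}.
Context {G : borelGroupType dG} {V : borelType dV}.
Variables (H : homogeneous_hypergraph n.+2 G V) (nu : probability G R) (v0 : V).
Hypothesis cG : compact [set: G].
Hypothesis hV : hausdorff_space V.
Hypothesis haar : haar_probability nu.
Variable BG : nat -> set G.
Hypothesis baseG : countable_base BG.
Variable BV : nat -> set V.
Hypothesis baseV : countable_base BV.
Variable S : set V.
Hypothesis mS : measurable S.

Local Notation mu := (quotient_measure H v0 nu).
Local Notation a := (act H).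
(** The indicator of [g^-1 S]. *)
Definition translate (g : G) (v : V) : R := \1_S (a g v).

Local Notation f := translate.

Let bS : bounded_measurable (\1_S : V -> R) := bounded_measurable_indic mS.

Let bf g : bounded_measurable (f g).
Proof. exact: (bounded_measurable_comp bS (measurable_act_right H g)). Qed.

Let f01 g v : 0 <= f g v <= 1.
Proof. by rewrite /translate indicE; case: (_ \in _); rewrite ?lexx ?ler01. Qed.

Lemma translate_exit_sym g g' :
  mu [set v | S (a g v) /\ ~ S (a g' v)] = mu [set v | S (a g' v) /\ ~ S (a g v)].
Proof.
have m1 := measurable_translate H g mS; have m2 := measurable_translate H g' mS.
rewrite [LHS](measureD m1 m2) ?ltey_eq ?fin_num_measure//.
rewrite [RHS](measureD m2 m1) ?ltey_eq ?fin_num_measure//.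
rewrite setIC; congr (_ - _)%E.
exact: (etrans (translate_law H v0 haar g mS) (esym (translate_law H v0 haar g' mS))).
Qed.

Lemma translate_dist g g' : \int[mu]_v `|f g v - f g' v| =
  2 * fine (mu [set v | S (a g v) /\ ~ S (a g' v)]).
Proof.
have m1 := measurable_translate H g mS; have m2 := measurable_translate H g' mS.
pose A1 := [set v | S (a g v) /\ ~ S (a g' v)].
pose A2 := [set v | S (a g' v) /\ ~ S (a g v)].
have mA1 : measurable A1 by exact: measurableD.
have mA2 : measurable A2 by exact: measurableD.
have b1 := bounded_measurable_indic (R := R) mA1.
have b2 := bounded_measurable_indic (R := R) mA2.
transitivity (\int[mu]_v (\1_A1 v + \1_A2 v : R)).
  apply: eq_Rintegral => v _; rewrite /translate !indicE.
  have [s1|s1] := pselect (S (a g v)); have [s2|s2] := pselect (S (a g' v));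
    rewrite ?(mem_set s1) ?(mem_set s2) ?(memNset s1) ?(memNset s2).
  - have n1 : ~ A1 v by case.
    have n2 : ~ A2 v by case.
    by rewrite (memNset n1) (memNset n2) subrr normr0 addr0.
  - have i1 : A1 v by [].
    have n2 : ~ A2 v by case.
    by rewrite (mem_set i1) (memNset n2) subr0 normr1 addr0.
  - have n1 : ~ A1 v by case.
    have i2 : A2 v by [].
    by rewrite (memNset n1) (mem_set i2) sub0r normrN normr1 add0r.
  - have n1 : ~ A1 v by case.
    have n2 : ~ A2 v by case.
    by rewrite (memNset n1) (memNset n2) subrr normr0 addr0.
rewrite (RintegralD measurableT (bounded_measurable_integrable mu b1)
  (bounded_measurable_integrable mu b2)) !Rintegral_indic//.
by rewrite -/A1 [in RHS]/A1 translate_exit_sym -/A2 mulr_natl mulr2n.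
Qed.

(** [exit_near] moves a point, whereas here the group element moves. Lifting to G along the orbit
    map and inverting turns the set of [v] into an exit set for G acting on itself, at the points
    [g^-1] and [g'^-1]. *)
Lemma translate_near g e : 0 < e ->
  \forall g' \near g, \int[mu]_v `|f g v - f g' v| < e.
Proof.
move=> e0; have e20 : 0 < e / 2 by rewrite divr_gt0.
have mS' := measurable_inv (measurable_orbit H v0 mS).
have near_inv := @exit_near _ _ _ _ _ _ (regular_hypergraph G) nu 1%g haar _ baseG
  _ baseG _ g^-1%g _ mS' e20.
have near_g := @invg_continuous _ G g _ near_inv; move: near_g.
apply: (@filterS _ (nbhs g)) => g' h.
rewrite translate_dist -ltr_pdivlMl// mulrC.
rewrite (_ : fine _ = fine (nu (exit_set (regular_hypergraph G)
  [set h | S (a h^-1%g v0)] g^-1%g g'^-1%g)))//; congr (fine _).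
have m1 := measurable_translate H g mS; have m2 := measurable_translate H g' mS.
have mD : measurable [set v | S (a g v) /\ ~ S (a g' v)] by exact: measurableD.
have mO := measurable_orbit H v0 mD.
rewrite quotient_measureE -(haar_inv haar baseG mO).
congr (nu _); apply/seteqP; split=> x; rewrite /exit_set /= !invgM !invgK !act_mul;
  exact.
Qed.

Let bPhi m : bounded_measurable
  (fun tg : m.-tuple V * G => tensor (f tg.2) tg.1).
Proof.
apply: bounded_measurable_prod => i.
apply: (bounded_measurable_comp (h := fun tg : m.-tuple V * G => a tg.2 (tnth tg.1 i)) bS).
have mc : measurable_fun setT (fun tg : m.-tuple V * G => (tnth tg.1 i, tg.2)).
  apply: measurable_fun_pair => //.
  exact: (measurableT_comp (measurable_tnth i) measurable_fst).
exact: (measurableT_comp (measurable_act_pair H baseG baseV) mc).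
Qed.

Let bpair : bounded_measurable (fun gv : G * V => f gv.1 gv.2).
Proof.
have msw : measurable_fun setT (fun gv : G * V => (gv.2, gv.1)).
  exact: measurable_fun_pair.
exact: (bounded_measurable_comp bS
  (measurableT_comp (measurable_act_pair H baseG baseV) msw)).
Qed.

Lemma translate_integral g : \int[mu]_v f g v = fine (mu S).
Proof.
rewrite -(translate_law H v0 haar g mS).
rewrite -(Rintegral_indic mu (measurable_translate H g mS)).
by apply: eq_Rintegral => v _; rewrite /translate !indicE; congr (_%:R).
Qed.

(* The average over G of the k-th tensor powers of the translates of 1_S,
   normalized on the diagonal. *)
Definition invariant_kernel (t : n.+2.-tuple V) : R :=
  (fine (mu S))^-1 * fine (nu (return_set H S t)).

Local Notation A := invariant_kernel.

Lemma return_massE t : fine (nu (return_set H S t)) = \int[nu]_g tensor (f g) t.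
Proof.
rewrite -Rintegral_indic; last exact: measurable_return.
apply: eq_Rintegral => g _; rewrite /tensor indicE.
have [|] := boolP (g \in return_set H S t).
  rewrite inE => gt; rewrite big1// => i _.
  by rewrite /translate indicE mem_set//; exact: gt.
rewrite notin_setE => /existsNP[i ni].
by rewrite (bigD1 i)//= /translate indicE memNset// mul0r.
Qed.

Hypothesis S_gt0 : 0 < fine (mu S).

Let s := fine (mu S).

Let cV : compact [set: V] := compact_space H v0 cG.

Lemma kernel_continuous : continuous A.
Proof.
move=> t.
have h1 := @return_continuous _ _ _ _ _ _ H nu v0 haar _ baseG _ baseV S mS t.
have h2 := @mulrl_continuous R (fine (mu S))^-1 (fine (nu (return_set H S t))).
exact: (continuous_comp h1 h2).
Qed.

Let bA : bounded_measurable A := continuous_bounded_measurable cV kernel_continuous.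

Lemma kernel_diag : \int[mu]_v A [tuple v | _ < n.+2] = 1.
Proof.
rewrite -[RHS](Rintegral_const mu); apply: eq_Rintegral => v _.
rewrite /A (_ : return_set H S _ = [set g | S (a g v)]).
  by rewrite [X in _ * X](congr1 fine (act_law H v0 haar baseG v mS)) mulVf// gt_eqF.
apply/seteqP; split=> g /= => [/(_ ord0)|gv i]; by rewrite tnth_mktuple.
Qed.

Lemma kernel_edge t : independent H S -> edge H t -> A t = 0.
Proof.
move=> iS Et; rewrite /A (_ : return_set H S t = set0) ?measure0 ?mulr0//.
apply/seteqP; split=> // g gt.
have : set0 (map_tuple (a g) t).
  rewrite -iS; split; last exact: edge_act.
  by move=> i; rewrite tnth_map; exact: gt.
by [].
Qed.

(** After Fubini every translate contributes [s ^+ n.+2], and the normalization removes one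
    factor. *)
Lemma kernel_integral : \int[power_measure mu n.+2]_t A t = s ^+ n.+1.
Proof.
rewrite /A RintegralZl//; last first.
  apply: bounded_measurable_integrable; apply: (continuous_bounded_measurable cV).
  exact: (return_continuous v0 haar baseG baseV mS).
under eq_Rintegral do rewrite return_massE.
rewrite (bounded_Fubini (power_measure mu n.+2) nu (bPhi n.+2)).
have -> : \int[nu]_g \int[power_measure mu n.+2]_t tensor (f g) t =
    \int[nu]_g (s ^+ n.+2).
  by apply: eq_Rintegral => g _; rewrite Rintegral_tensor// translate_integral.
by rewrite Rintegral_const exprS mulKf// gt_eqF.
Qed.

Lemma kernel_L2sym : L2sym mu n.+2 A.
Proof.
split.
  by have [_ [M AM]] := bA; have [] := bounded_measurable_L2 (power_measure mu n.+2) bA AM.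
move=> sg; apply: aeW => t; rewrite /A; congr (_ * fine (nu _)).
apply/seteqP; split=> g h i.
  by have := h (sg^-1%g i); rewrite tnth_mktuple permKV.
by rewrite tnth_mktuple; exact: h.
Qed.

Lemma tensor_dist g g' : \int[power_measure mu n.+2]_t `|tensor (f g) t - tensor (f g') t|
  <= n.+2%:R * \int[mu]_v `|f g v - f g' v|.
Proof.
have bd := bounded_measurable_norm (bounded_measurableB (bf g) (bf g')).
have bdi i : bounded_measurable (fun t : n.+2.-tuple V =>
    `|f g (tnth t i) - f g' (tnth t i)|).
  exact: (bounded_measurable_comp bd (measurable_tnth i)).
have marg i : \int[power_measure mu n.+2]_t `|f g (tnth t i) - f g' (tnth t i)| =
    \int[mu]_v `|f g v - f g' v|.
  have [|_] := @power_measure_prod _ _ _ mu n.+2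
      (fun j v => if j == i then `|f g v - f g' v| else 1).
    move=> j; apply: bounded_measurable_integrable; case: (j == i) => //.
    exact: bounded_measurable_cst.
  rewrite (bigD1 i)//= eqxx big1 ?mulr1 => [<-|j /negPf ->]; last first.
    by rewrite Rintegral_const.
  apply: eq_Rintegral => t _; rewrite (bigD1 i)//= eqxx big1 ?mulr1//.
  by move=> j /negPf ->.
apply: (@le_trans _ _ (\int[power_measure mu n.+2]_t
    \sum_(i < n.+2) `|f g (tnth t i) - f g' (tnth t i)|)).
  apply: le_Rintegral => //.
  - apply: bounded_measurable_integrable; apply: bounded_measurable_norm.
    by apply: bounded_measurableB; exact: bounded_measurable_tensor.
  - by apply: bounded_measurable_integrable; exact: bounded_measurable_sum.
  by move=> t _; exact: prod_indic_dist.
rewrite Rintegral_sum; last by move=> i; exact: bounded_measurable_integrable.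
under eq_bigr do rewrite marg.
by rewrite sumr_const card_ord -[leLHS]mulr_natl.
Qed.

Let tensor01 g t : 0 <= @tensor _ _ V n.+2 (f g) t <= 1.
Proof.
apply/andP; split; first by apply: tensor_ge0 => v; have /andP[] := f01 g v.
by apply: prodr_ile1 => i _; exact: f01.
Qed.

Lemma kernel_CP : CP mu n.+2 A.
Proof.
move=> C [[CL CD CZ Ccl] Cgen]; apply: Ccl; first exact: kernel_L2sym.
(* [L2_lt] with the uniform bound [s^-1] requires [s^-1 * (s^-1 * (n.+2 * e')) < e ^+ 2]; this
   choice makes the left side [e ^+ 2] times [n.+2 / n.+3]. *)
move=> e e0; pose e' := (e * s) ^+ 2 / n.+3%:R.
have e'0 : 0 < e' by rewrite divr_gt0// exprn_gt0// mulr_gt0.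
pose U g := [set g' | \int[mu]_v `|f g v - f g' v| < e']°.
have [g|N [q [y [mq qU]]]] := @finite_cover_partition _ G U 1%g cG.
  by split; [exact: open_interior|exact: translate_near].
have yq g : \int[mu]_v `|f (y (q g)) v - f g v| < e'.
  exact: (interior_subset (qU g)).
(* Riemann sums of the average over a fine finite partition of G. *)
have Ctensor g c : 0 <= c -> C (fun t => c * tensor (f g) t).
  move=> c0; apply: CZ => //; apply: Cgen; exists (f g) => //; split.
    have [_ [M fM]] := bf g; have [] := bounded_measurable_L2 mu (bf g) fM.
    by [].
  by apply: aeW => v; have /andP[] := f01 g v.
pose w j := s^-1 * fine (nu (q @^-1` [set j])).
have w0 j : 0 <= w j by rewrite mulr_ge0 ?invr_ge0 ?(ltW S_gt0)// fine_ge0.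
pose F (t : n.+2.-tuple V) : R := \sum_(j < N) w j * tensor (f (y j)) t.
exists F.
  rewrite /F; elim: (index_enum _) => [|j r IH].
    rewrite (_ : (fun _ => _) = fun t => 0 * tensor (f 1%g) t); first exact: Ctensor.
    by apply/funext => t; rewrite big_nil mul0r.
  rewrite (_ : (fun _ => _) = (fun t => w j * tensor (f (y j)) t) \+
    (fun t => \sum_(j <- r) w j * tensor (f (y j)) t)).
    by apply: CD => //; exact: Ctensor.
  by apply/funext => t; rewrite big_cons.
(* The error of the Riemann sum before averaging over G. For each fixed [g] its L^1 norm on V^k is
   small by [tensor_dist] and [yq]; Fubini carries this over to the average. *)
pose Psi (tg : n.+2.-tuple V * G) :=
  tensor (f tg.2) tg.1 - tensor (f (y (q tg.2))) tg.1.
have bPsi : bounded_measurable Psi.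
  apply: bounded_measurableB; first exact: bPhi.
  rewrite (_ : (fun _ => _) = fun tg : n.+2.-tuple V * G =>
      \sum_(j < N) \1_(q @^-1` [set j]) tg.2 * tensor (f (y j)) tg.1).
    apply: bounded_measurable_sum => j; apply: bounded_measurableM.
      exact: (bounded_measurable_comp (bounded_measurable_indic (mq j)) measurable_snd).
    exact: (bounded_measurable_comp (bounded_measurable_tensor n.+2 (bf (y j))) measurable_fst).
  apply/funext => -[t g]; rewrite (bigD1 (q g))//= big1 ?addr0.
    by rewrite indicE mem_set// mul1r.
  move=> j jq; rewrite indicE memNset ?mul0r//= => qj.
  by rewrite qj eqxx in jq.
have AF t : A t - F t = s^-1 * \int[nu]_g Psi (t, g).
  have b1 : bounded_measurable (fun g => tensor (f g) t).
    exact: (bounded_measurable_pair1 t (bPhi n.+2)).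
  have b2 : bounded_measurable (fun g => tensor (f (y (q g))) t).
    exact: (@bounded_measurable_cell _ _ _ _ q mq (fun j => tensor (f (y j)) t)).
  rewrite /Psi (RintegralB measurableT (bounded_measurable_integrable nu b1)
    (bounded_measurable_integrable nu b2)) mulrBr /A return_massE; congr (_ - _).
  rewrite /F /w; under eq_bigr do rewrite -mulrA; rewrite -mulr_sumr; congr (_ * _).
  have -> : \int[nu]_g tensor (f (y (q g))) t =
      \int[nu]_g \sum_(j < N) tensor (f (y j)) t * \1_(q @^-1` [set j]) g.
    apply: eq_Rintegral => g _; rewrite (bigD1 (q g))//= big1 ?addr0.
      by rewrite indicE mem_set// mulr1.
    move=> j jq; rewrite indicE memNset ?mulr0//= => qj.
    by rewrite qj eqxx in jq.
  have bj j := bounded_measurable_indic (R := R) (mq j).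
  rewrite Rintegral_sum; last first.
    by move=> j; apply: bounded_measurable_integrable; exact: bounded_measurableZ.
  apply: eq_bigr => j _; rewrite RintegralZl//; last exact: bounded_measurable_integrable.
  by rewrite Rintegral_indic// mulrC.
have bF : bounded_measurable F.
  apply: bounded_measurable_sum => j; apply: bounded_measurableZ.
  exact: bounded_measurable_tensor.
have bAF := bounded_measurableB bA bF.
have bPt t := bounded_measurable_norm (bounded_measurable_pair1 t bPsi).
have AFle t : `|A t - F t| <= s^-1 * \int[nu]_g `|Psi (t, g)|.
  rewrite AF normrM ger0_norm ?invr_ge0 ?(ltW S_gt0)// ler_wpM2l ?invr_ge0 ?(ltW S_gt0)//.
  apply: le_normr_Rintegral => //.
  by apply: bounded_measurable_integrable; exact: (bounded_measurable_pair1 t bPsi).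
apply: (@L2_lt _ _ _ (power_measure mu n.+2) _ s^-1) => //.
  move=> t; rewrite (le_trans (AFle t))// ler_piMr ?invr_ge0 ?(ltW S_gt0)//.
  apply: Rintegral_le_const; first exact: bounded_measurable_integrable.
  move=> g; rewrite /Psi /= ler_norml.
  by have := tensor01 g t; have := tensor01 (y (q g)) t; lra.
have bN := bounded_measurable_norm bPsi.
have AFint : \int[power_measure mu n.+2]_t `|A t - F t| <= s^-1 * (n.+2%:R * e').
  have bR := bounded_measurable_Rintegral (power_measure mu n.+2) nu bN.
  apply: (@le_trans _ _ (\int[power_measure mu n.+2]_t (s^-1 * \int[nu]_g `|Psi (t, g)|))).
    apply: le_Rintegral => //.
    - by apply: bounded_measurable_integrable; exact: bounded_measurable_norm.
    - by apply: bounded_measurable_integrable; exact: bounded_measurableZ.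
  rewrite RintegralZl//; last exact: bounded_measurable_integrable.
  rewrite ler_wpM2l ?invr_ge0 ?(ltW S_gt0)//.
  rewrite (bounded_Fubini (power_measure mu n.+2) nu bN).
  apply: Rintegral_le_const.
    apply: bounded_measurable_integrable.
    have msw : measurable_fun setT (fun gt : G * n.+2.-tuple V => (gt.2, gt.1)).
      exact: measurable_fun_pair.
    exact: (bounded_measurable_Rintegral nu (power_measure mu n.+2)
      (bounded_measurable_comp bN msw)).
  move=> g; rewrite /Psi /=; apply: (le_trans (tensor_dist _ _)).
  rewrite ler_wpM2l//; apply: ltW; have := yq g.
  by under eq_Rintegral do rewrite distrC.
have s1 : 0 <= s^-1 by rewrite invr_ge0 ltW.
apply: le_lt_trans (ler_wpM2l s1 AFint) _.
have -> : s^-1 * (s^-1 * (n.+2%:R * e')) = e ^+ 2 * (n.+2%:R / n.+3%:R).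
  by rewrite /e'; field; rewrite !gt_eqF ?ltr0n.
by rewrite gtr_pMr ?exprn_gt0// ltr_pdivrMr ?ltr0n// mul1r ltr_nat.
Qed.

(** The kernel averages [f g x * f g y] times a nonnegative factor over [g]; integrating x and y
    against [u] yields the same number [b g] twice, so an average of nonnegative multiples of
    squares remains. *)
Lemma kernel_slice_positive : slice_positive mu A.
Proof.
move=> w u wL w0 uL; have ui := Lfun2_integrable uL.
pose b g := \int[mu]_x (u x * f g x).
have bb : bounded_measurable b := bounded_measurable_Rintegral_L1 nu ui bpair.
have bfy y : bounded_measurable (fun g => f g y) := bounded_measurable_pair2 y bpair.
have bt m (t : m.-tuple V) : bounded_measurable (fun g => tensor (f g) t).
  exact: (bounded_measurable_pair1 t (bPhi m)).
(* Used twice: for x with the weight [tensor (f g) v * f g y], then for y with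
   [tensor (f g) v * b g]. *)
have step (c : R) (ka : G -> R) : bounded_measurable ka ->
    \int[mu]_x (c * (u x * \int[nu]_g (ka g * f g x))) = c * \int[nu]_g (ka g * b g).
  move=> bka.
  have bK : bounded_measurable (fun gv : G * V => ka gv.1 * f gv.1 gv.2).
    apply: bounded_measurableM => //.
    exact: (bounded_measurable_comp bka measurable_fst).
  have msw : measurable_fun setT (fun vg : V * G => (vg.2, vg.1)).
    exact: measurable_fun_pair.
  have bKi := bounded_measurable_Rintegral mu nu (bounded_measurable_comp bK msw).
  rewrite (RintegralZl _ measurableT (integrableM_bounded ui bKi)); congr (_ * _).
  rewrite [LHS](Rintegral_Fubini_L1 nu ui bK); apply: eq_Rintegral => g _ /=.
  rewrite /b -RintegralZl//; last exact: (integrableM_bounded ui (bf g)).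
  by apply: eq_Rintegral => x _; rewrite mulrCA.
pose h (v : n.-tuple V) := s^-1 * \int[nu]_g (tensor (f g) v * b g * b g).
have h0 v : 0 <= h v.
  rewrite mulr_ge0 ?invr_ge0 ?(ltW S_gt0)//; apply: Rintegral_ge0 => g _.
  rewrite -mulrA mulr_ge0 -?expr2 ?sqr_ge0//.
  by apply: prodr_ge0 => i _; have /andP[] := f01 g (tnth v i).
have inner (v : n.-tuple V) : \int[mu]_y \int[mu]_x (A [tuple of x :: y :: v] * w v * u x * u y) =
    w v * h v.
  have E (y : V) : \int[mu]_x (A [tuple of x :: y :: v] * w v * u x * u y) =
      s^-1 * w v * (u y * \int[nu]_g (tensor (f g) v * b g * f g y)).
    transitivity (\int[mu]_x ((s^-1 * w v * u y) *
        (u x * \int[nu]_g (tensor (f g) v * f g y * f g x)))).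
      apply: eq_Rintegral => x _; rewrite /A return_massE -/s.
      have -> : \int[nu]_g tensor (f g) [tuple of x :: y :: v] =
          \int[nu]_g (tensor (f g) v * f g y * f g x).
        apply: eq_Rintegral => g _; rewrite /tensor !big_ord_recl tnth0 tnthS tnth0.
        under [X in _ * (_ * X)]eq_bigr do rewrite !tnthS.
        by set z := \prod_(i < n) _; ring.
      by set z := \int[nu]_g _; ring.
    rewrite step; last by apply: bounded_measurableM; [exact: bt|exact: bfy].
    rewrite mulrA; congr (_ * _); apply: eq_Rintegral => g _; ring.
  under eq_Rintegral do rewrite E.
  rewrite step; last by apply: bounded_measurableM => //; exact: bt.
  by rewrite /h mulrA [w v * _]mulrC.
under eq_Rintegral do rewrite inner.
have mw : measurable_fun setT w by exact: set_mem (sub_Lfun_mfun wL).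
have mh : measurable_fun setT h.
  have bk : bounded_measurable (fun vg : n.-tuple V * G =>
      tensor (f vg.2) vg.1 * b vg.2 * b vg.2).
    have bb2 := bounded_measurable_comp bb (@measurable_snd _ _ (n.-tuple V) G).
    by apply: bounded_measurableM => //; apply: bounded_measurableM.
  have [] := bounded_measurableZ s^-1 (bounded_measurable_Rintegral (power_measure mu n) nu bk).
  by [].
have mwh : measurable_fun setT (fun v => w v * h v) by exact: measurable_funM.
have [N [mN N0 sN]] := w0.
rewrite (@Rintegral_ae_eq _ _ _ (power_measure mu n) _ (fun v => `|w v * h v|) N)//.
- by apply: Rintegral_ge0 => v _.
- exact: measurableT_comp.
move=> v Nv; rewrite ger0_norm// mulr_ge0//; apply: contrapT => wv.
by apply: Nv; apply: sN => /= h'; apply: wv.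
Qed.

End lower_bound.

Lemma theta_kernel (R : realType) (n : nat) (dG dV : measure_display)
    (G : borelGroupType dG) (V : borelType dV)
    (H : homogeneous_hypergraph n.+2 G V) (nu : probability G R) (v0 : V)
    (BG : nat -> set G) (S : set V) :
  compact [set: G] -> hausdorff_space V -> haar_probability nu ->
  countable_base BG -> measurable S -> independent H S ->
  let mu := quotient_measure H v0 nu in
  0 < fine (mu S) ->
  ((fine (mu S) ^+ n.+1)%:E <= theta_small H mu (CPc mu n.+2))%E.
Proof.
move=> cG hV haar baseG mS iS mu S0.
have [BV baseV] := orbit_base H v0 cG hV baseG.
have cA : continuous (invariant_kernel H nu v0 S).
  exact: (kernel_continuous haar baseG baseV mS).
have bA := continuous_bounded_measurable (compact_space H v0 cG) cA.
apply: ereal_sup_ubound; exists (invariant_kernel H nu v0 S).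
  split.
  - by split=> //; exact: (kernel_CP cG haar baseG baseV mS S0).
  - exact: (kernel_slice_positive baseG baseV mS S0).
  - rewrite Rintegral_EFin ?(kernel_diag haar baseG mS S0)//.
    apply: bounded_measurable_integrable.
    exact: (bounded_measurable_comp bA (measurable_diag (p := n.+1))).
  - by move=> t; exact: kernel_edge.
rewrite /inner -(kernel_integral cG haar baseG baseV mS S0) -Rintegral_EFin.
  by apply: eq_integral => t _; rewrite /tensor big1 ?mulr1.
exact: bounded_measurable_integrable.
Qed.

Theorem theorem4p12 (R : realType) (k : nat) (dG dV : measure_display)
    (G : borelGroupType dG) (V : borelType dV)
    (H : homogeneous_hypergraph k G V) (nu : probability G R) (v0 : V) :
  (2 <= k)%N ->
  compact [set: G] ->
  hausdorff_space G ->
  hausdorff_space V ->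
  haar_probability nu ->
  (exists dist : G -> G -> R,
    [/\ metrizes dist, right_invariant dist & density_metric nu dist]) ->
  let mu := quotient_measure H v0 nu in
  (0 < alpha H mu)%E ->
  (alpha H mu ^+ k.-1)%E = theta_small H mu (CPc mu k).
Proof.
case: k H => [|[|n]] // H _ cG _ hV haar [dist [md rd dd]] mu a0.
have [al [al0 alE]] := alpha_itv H nu v0.
have al_gt0 : 0 < al by rewrite -lte_fin -alE.
have [BG baseG] := compact_metrizable_base md 1%g cG.
rewrite alE -EFin_expe; apply/eqP; rewrite eq_le; apply/andP; split; last first.
  apply: ub_ereal_sup => _ [A [cpA _ Ad AE] <-].
  have bA := continuous_bounded_measurable (compact_space H v0 cG) cpA.2.
  have -> : inner mu A (tensor (cst 1)) =
      (\int[power_measure mu n.+2]_t A t)%:E.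
    rewrite -Rintegral_EFin; last exact: bounded_measurable_integrable.
    by apply: eq_integral => t _; rewrite /tensor big1 ?mulr1.
  rewrite lee_fin; apply: (CP_integral_le (ltn0Sn n) cG hV haar md rd dd alE al0 cpA) => //.
  by rewrite /Rintegral Ad.
have kernel_le (S : set V) : measurable S -> independent H S ->
    0 < fine (mu S) -> ((fine (mu S) ^+ n.+1)%:E <= theta_small H mu (CPc mu n.+2))%E.
  by move=> mS iS S0; exact: (theta_kernel cG hV haar baseG mS iS S0).
rewrite leNgt; apply/negP => tha.
have below d : 0 < d -> exists S, [/\ measurable S, independent H S & al - d < fine (mu S)].
  move=> d0; have : (al%:E - d%:E < alpha H mu)%E by rewrite alE -EFinB lte_fin gtrBl.
  move=> /ereal_sup_gt[_ [S [mS iS] <-]]; rewrite -EFinB => dS; exists S; split=> //.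
  by rewrite -lte_fin fineK ?fin_num_measure.
(* One independent set of positive measure bounds [theta_small] below by a real, which excludes -oo;
   [tha] excludes +oo. *)
have [S0 [mS0 iS0]] := below al al_gt0; rewrite subrr => S0_gt0.
have th0 := kernel_le S0 mS0 iS0 S0_gt0.
move: tha th0 kernel_le; case: (theta_small _ _ _) => [r| |]//= tha th0 kernel_le.
have : nbhs al [set x | r < x ^+ n.+1].
  apply: (@exprn_continuous R n.+1 al [set y | r < y]).
  by apply: open_nbhs_nbhs; split; [exact: open_gt|rewrite /= -lte_fin].
move=> /nbhs_ballP[d /= d0 dr].
(* [d] serves the continuity of the power at [al], while [al] keeps the measure of [S] positive, as
   [kernel_le] requires. *)
have md0 : 0 < Num.min d al by rewrite lt_min d0.
have [S [mS iS aS]] := below _ md0.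
have S_gt0 : 0 < fine (mu S).
  by apply: le_lt_trans aS; rewrite subr_ge0 ge_min lexx orbT.
have Sal : fine (mu S) <= al by exact: (independent_le_alpha alE mS iS).
have : r < fine (mu S) ^+ n.+1.
  apply: dr; rewrite /ball /= ger0_norm ?subr_ge0//.
  by rewrite ltrBlDl -ltrBlDr (le_lt_trans _ aS)// lerB// ge_min lexx.
have := kernel_le S mS iS S_gt0; rewrite lee_fin => h1 h2.
by have := lt_le_trans h2 h1; rewrite ltxx.
Qed.
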